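(* Let $\Psi(z) = \gamma\bar{z} + \psi(z)$, where $\gamma \in \mathbb{C} \setminus \{0\}$ and $\psi$ is analytic on an open neighborhood of $\overline{\mathbb{D}}$, and let $R(z) = \gamma/z + \psi(z)$ be the associated meromorphic function. If $\Psi$ is sense-reversing on $\overline{\mathbb{D}}$, i.e. $|\gamma| > |\psi'(z)|$ for all $z \in \overline{\mathbb{D}}$, then $\Psi$ is an orientation-reversing diffeomorphism from $\mathbb{D}$ onto the bounded open domain $\Psi(\mathbb{D})$, and for every $\lambda \in \Psi(\mathbb{D})$ one has $\lambda \notin R(\overline{\mathbb{D}})$. In particular, $\Psi(\mathbb{D}) \subset \sigma_p(T_\Psi)$, where $T_\Psi$ acts on the Bergman space $L_A^2(\mathbb{D})$.
   Context: $\mathbb{D} = \{z \in \mathbb{C} : |z| < 1\}$ and $\overline{\mathbb{D}}$ is its closure. The function $R$ has a pole at $0$ with $R(0)=\infty$, so for $\lambda\in\mathbb{C}$, $\lambda \notin R(\overline{\mathbb{D}})$ means $R(z)\ne\lambda$ for all $z\in\overline{\mathbb{D}}\setminus\{0\}$. The Bergman space $L_A^2(\mathbb{D}) = L^2(\mathbb{D}, dA) \cap \mathcal{H}(\mathbb{D})$ consists of the analytic functions on $\mathbb{D}$ that are square-integrable with respect to the normalized area measure $dA(z) = \frac{1}{\pi}\,dx\,dy$; $P : L^2(\mathbb{D}, dA) \to L_A^2(\mathbb{D})$ is the orthogonal (Bergman) projection, $Pf(z)= \int_{\mathbb{D}} \frac{f(\omega)}{(1-\bar{\omega}z)^{2}}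 \, dA(\omega)$. For $\phi \in L^\infty(\mathbb{D})$, the Toeplitz operator on $L_A^2(\mathbb{D})$ is $T_{\phi}f = P(\phi f)$. $\sigma_p(T)$ denotes the point spectrum (set of eigenvalues) of $T$. *)

(* Defs.v *)
From HB Require Import structures.
From mathcomp Require Import all_boot all_order all_algebra.
From mathcomp Require Import all_classical all_reals all_analysis.
From mathcomp Require Import complex.
Set Implicit Arguments.
Unset Strict Implicit.
Unset Printing Implicit Defensive.
Import Order.TTheory GRing.Theory Num.Theory.
Import numFieldNormedType.Exports.
Local Open Scope classical_set_scope.
Local Open Scope ring_scope.

(* [R[i]] with the topology of its modulus, as a normed space over itself; in
   particular [derivable f z 1] is complex differentiability of
   [f : R[i] -> R[i]] at [z], and [derive1 f z] is its complex derivative. *)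
HB.instance Definition _ (R : rcfType) := NormedModule.copy R[i] R[i]^o.

Section Smoothness.
Context {R : realType}.

(* For finite-dimensional [V] and open [U], the existence and continuity on [U]
   of all iterated directional derivatives up to order [n] is the usual C^n. *)
Fixpoint Cn_on (V W : normedModType R) (n : nat) (U : set V) (F : V -> W)
    : Prop :=
  (forall x, U x -> {for x, continuous F}) /\
  (if n is n'.+1 then
     forall v : V, (forall x, U x -> derivable F x v) /\
                   Cn_on n' U (fun x => 'D_v F x)
   else True).

Definition smooth_on (V W : normedModType R) (U : set V) (F : V -> W) : Prop :=
  forall n, Cn_on n U F.

Definition diffeomorphism (V W : normedModType R) (U : set V) (U' : set W)
    (F : V -> W) : Prop :=
  [/\ open U, open U', set_bij U U' F, smooth_on U F
    & exists2 G : W -> V, (forall x, U x -> G (F x) = x) & smooth_on U' G].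

Definition jacobian_det (F : R * R -> R * R) (p : R * R) : R :=
  let Fx := 'D_((1 : R), (0 : R)) F p in
  let Fy := 'D_((0 : R), (1 : R)) F p in
  Fx.1 * Fy.2 - Fy.1 * Fx.2.

End Smoothness.

Section ComplexPlane.
Context {R : realType}.
Implicit Types (z w : R[i]) (f phi : R[i] -> R[i]) (U : set R[i]).

Definition of_plane (p : R * R) : R[i] := Complex p.1 p.2.
Definition to_plane z : R * R := (complex.Re z, complex.Im z).

Definition real_map f : R * R -> R * R := to_plane \o f \o of_plane.

Definition orientation_reversing_diffeo U (U' : set R[i]) f : Prop :=
  diffeomorphism (of_plane @^-1` U) (of_plane @^-1` U') (real_map f) /\
  (forall p, U (of_plane p) -> jacobian_det (real_map f) p < 0).

Definition domain U : Prop := [/\ U !=set0, open U & connected U].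

Definition analytic_on U f : Prop :=
  open U /\ forall z, U z -> derivable f z 1.

Definition disk : set R[i] := [set z | `|z| < 1].

Lemma pi_inv_ge0 : 0 <= (pi : R)^-1.
Proof. by rewrite invr_ge0 pi_ge0. Qed.

Definition area_measure :
    {measure set (measurableTypeR R * measurableTypeR R) -> \bar R} :=
  mscale (NngNum pi_inv_ge0) (@lebesgue_measure R \x @lebesgue_measure R)%E.

Definition area_integral U f : R[i] :=
  Complex (\int[area_measure]_(p in of_plane @^-1` U) complex.Re (f (of_plane p)))
          (\int[area_measure]_(p in of_plane @^-1` U) complex.Im (f (of_plane p))).

(* [`|w|] lives in [R[i]]; [complex.Re `|w|] is the same number as an element of [R]. *)
Definition L2_disk f : Prop :=
  [/\ measurable_fun (of_plane @^-1` disk)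
        (fun p : R * R => complex.Re (f (of_plane p))),
      measurable_fun (of_plane @^-1` disk)
        (fun p : R * R => complex.Im (f (of_plane p)))
    & (\int[area_measure]_(p in of_plane @^-1` disk)
         ((complex.Re `|f (of_plane p)|) ^+ 2)%:E < +oo)%E].

(* Elements of function spaces on the disk are represented by total functions
   on [R[i]]; only their values on [disk] are relevant. *)
Definition bergman_space f : Prop := L2_disk f /\ analytic_on disk f.

(* Bergman kernel formula; on [L2_disk] it is the orthogonal projection onto
   [bergman_space]. *)
Definition bergman_proj f : R[i] -> R[i] := fun z =>
  area_integral disk (fun w => f w / (1 - conjc w * z) ^+ 2).

Definition toeplitz phi f : R[i] -> R[i] :=
  bergman_proj (fun w => phi w * f w).

Definition bergman_point_spectrum (T : (R[i] -> R[i]) -> (R[i] -> R[i])) :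
    set R[i] :=
  [set lambda | exists f,
    [/\ bergman_space f,
        (exists2 z, disk z & f z != 0)
      & forall z, disk z -> T f z = lambda * f z]].

Definition harmonic_symbol (gamma : R[i]) (psi : R[i] -> R[i]) :
    R[i] -> R[i] :=
  fun z => gamma * conjc z + psi z.

(* Only meaningful away from the pole [0]. *)
Definition meromorphic_symbol (gamma : R[i]) (psi : R[i] -> R[i]) :
    R[i] -> R[i] :=
  fun z => gamma / z + psi z.

End ComplexPlane.

(* Main.v *)
(* Injectivity and the avoidance of the values of [R] follow from the strict
   contraction [|psi z - psi w| < |gamma| |z - w|] on the closed disk, together
   with [|z - w| <= |1 - z w^*|].  The inverse of [Psi] is differentiable with
   Wirtinger derivatives that are rational in [psi'] and its conjugate, so it is
   smooth once [psi] is infinitely differentiable.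

   All the complex analysis comes from area integrals.  If [g] is Lipschitz near
   the closed disk, [W] is Lipschitz and vanishes off the disk, and both are
   pointwise differentiable, then the integral of [g_z W_zbar - g_zbar W_z], with
   subscripts for Wirtinger derivatives, vanishes (translation invariance
   applied to difference quotients).  This yields the
   Bergman reproducing formula for every pointwise differentiable [f] with
   bounded derivative, without Goursat's theorem; differentiating the kernel
   gives derivatives of all orders, and integrating it gives primitives.

   For [lam = Psi z0], the function [N z = gamma + z (psi z - lam)] has no zero
   on the closed disk.  With [H] a primitive of [(psi - lam) / N],
   [G = exp (- H)] and [f = (z G)' = gamma G / N], one has
   [gamma G' + (psi - lam) f = 0].  Since the Toeplitz operator with symbol
   [z^*] maps [(z G)'] to [G'], [f] is an eigenfunction for [lam]. *)

Require Import Defs.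
From mathcomp Require Import all_boot all_order all_algebra.
From mathcomp Require Import all_classical all_reals all_analysis measurable_realfun.
From mathcomp Require Import complex.
From mathcomp Require Import ring lra.
Import Order.TTheory GRing.Theory Num.Theory.
Import numFieldNormedType.Exports.
Set Implicit Arguments.
Unset Strict Implicit.
Unset Printing Implicit Defensive.
Local Open Scope classical_set_scope.
Local Open Scope ring_scope.

(** * Complex modulus and Wirtinger derivatives *)

(** The hypothesis on [psi] gives complex differentiability point by point and says nothing about
    continuity of the derivative, so Green's formula for C^1 functions is out of reach; difference
    quotients and dominated convergence replace it. The dominating Lipschitz bounds come from
    [|psi'| < |gamma|] and the mean value inequality, and the weight [1 - |w|^2] supplies functions
    [W] that stay Lipschitz across the circle.

    The reproducing formula rests on the dilations [w -> z + s (w - z)]. For [s < 1] the dilated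
    function is Lipschitz on a larger disk, and the [s]-derivative of the integral is a Jacobian
    integral because the conjugate derivative of [(1 - |w|^2) / (1 - conj w z)] contains the factor
    [w - z], up to sign. The end [s = 1] is reached by Lipschitz continuity alone. The normalization
    comes from the area of the disk, through the formula at the centre [0].

    The denominator [N] is dictated by the eigenvalue equation: with [f = G + z G'], the condition
    [gamma G' + (psi - lam) f = 0] reads [N G' = - (psi - lam) G], a linear equation solved by an
    exponential. *)

Section ComplexModulus.
Context {R : realType}.
Implicit Types (z w h : R[i]) (x : R).

(** The norm of [R[i]] takes values in [R[i]], whose order is only partial; a real-valued modulus
    makes case analysis on the order and [lra] available. *)
Definition cabs z : R := complex.Re `|z|.

Lemma normr_cabs z : `|z| = (cabs z)%:C%C.
Proof. by rewrite /cabs normc_def. Qed.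

Lemma cabs_def z : cabs z = Num.sqrt (complex.Re z ^+ 2 + complex.Im z ^+ 2).
Proof. by rewrite /cabs normc_def. Qed.

Lemma cabs_ge0 z : 0 <= cabs z.
Proof. by rewrite cabs_def sqrtr_ge0. Qed.

Lemma cabs0 : cabs 0 = 0. Proof. by rewrite /cabs normr0. Qed.
Lemma cabs1 : cabs 1 = 1. Proof. by rewrite /cabs normr1. Qed.
Lemma cabsN z : cabs (- z) = cabs z. Proof. by rewrite /cabs normrN. Qed.
Lemma cabsBC z w : cabs (z - w) = cabs (w - z). Proof. by rewrite /cabs distrC. Qed.
Lemma cabsM z w : cabs (z * w) = cabs z * cabs w.
Proof. by apply: (@complexI R); rewrite -normr_cabs normrM !normr_cabs rmorphM. Qed.
Lemma cabsV z : cabs z^-1 = (cabs z)^-1.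
Proof. by apply: (@complexI R); rewrite -normr_cabs normfV !normr_cabs fmorphV. Qed.
Lemma cabsX z n : cabs (z ^+ n) = cabs z ^+ n.
Proof. by elim: n => [|n IH]; rewrite ?expr0 ?cabs1// !exprS cabsM IH. Qed.
Lemma cabsD z w : cabs (z + w) <= cabs z + cabs w.
Proof. by rewrite -(lecR (cabs _)) rmorphD /= -!normr_cabs ler_normD. Qed.
Lemma cabsB z w : cabs (z - w) <= cabs z + cabs w.
Proof. by rewrite -(cabsN w) cabsD. Qed.
Lemma cabsJ z : cabs (conjc z) = cabs z.
Proof. by rewrite /cabs normcJ. Qed.
Lemma cabs_eq0 z : (cabs z == 0) = (z == 0).
Proof. by rewrite -(normr_eq0 z) normr_cabs eq_complex /= eqxx andbT. Qed.
Lemma cabs_gt0 z : (0 < cabs z) = (z != 0).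
Proof. by rewrite lt_def cabs_ge0 andbT cabs_eq0. Qed.
Lemma cabsR x : cabs (x%:C%C) = `|x|.
Proof. by rewrite cabs_def /= expr0n /= addr0 sqrtr_sqr. Qed.
Lemma cabs_sqr z : cabs z ^+ 2 = complex.Re z ^+ 2 + complex.Im z ^+ 2.
Proof. by rewrite cabs_def sqr_sqrtr// addr_ge0 ?sqr_ge0. Qed.
Lemma mulcJ z : z * conjc z = (cabs z ^+ 2)%:C%C.
Proof. by rewrite -sqr_normc normr_cabs rmorphXn. Qed.
Lemma cabs_Re z : `|complex.Re z| <= cabs z.
Proof.
rewrite -sqrtr_sqr cabs_def ler_wsqrtr// lerDl sqr_ge0 //.
Qed.
Lemma cabs_Im z : `|complex.Im z| <= cabs z.
Proof.
rewrite -sqrtr_sqr cabs_def ler_wsqrtr// lerDr sqr_ge0 //.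
Qed.
Lemma cabs_ReIm z : cabs z <= `|complex.Re z| + `|complex.Im z|.
Proof.
case: z => a b /=.
have -> : (Complex a b) = a%:C%C + 'i%C * b%:C%C by simpc.
apply: (le_trans (cabsD _ _)); rewrite cabsM !cabsR.
have -> : cabs ('i%C : R[i]) = 1 by rewrite cabs_def /= expr0n expr1n /= add0r sqrtr1.
by rewrite mul1r.
Qed.
Lemma cabs_dist z w : `|cabs z - cabs w| <= cabs (z - w).
Proof.
have h1 := cabsD (z - w) w; have h2 := cabsD (w - z) z.
rewrite !subrK in h1 h2; rewrite (cabsBC w) in h2.
by rewrite ler_norml; apply/andP; split; lra.
Qed.

Lemma diskE z : disk z = (cabs z < 1) :> Prop.
Proof. by rewrite /disk /= normr_cabs -[1]/((1:R)%:C%C) ltcR. Qed.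

Lemma ReD z w : complex.Re (z + w) = complex.Re z + complex.Re w.
Proof. by case: z; case: w. Qed.
Lemma ImD z w : complex.Im (z + w) = complex.Im z + complex.Im w.
Proof. by case: z; case: w. Qed.
Lemma ReZ x z : complex.Re (x%:C%C * z) = x * complex.Re z.
Proof. by case: z => a b /=; rewrite mul0r subr0. Qed.
Lemma ReN z : complex.Re (- z) = - complex.Re z. Proof. by case: z. Qed.
Lemma ImN z : complex.Im (- z) = - complex.Im z. Proof. by case: z. Qed.
Lemma ReM z w : complex.Re (z * w) =
  complex.Re z * complex.Re w - complex.Im z * complex.Im w.
Proof. by case: z; case: w. Qed.
Lemma ImM z w : complex.Im (z * w) =
  complex.Re z * complex.Im w + complex.Im z * complex.Re w.
Proof. by case: z => a b; case: w => c d /=. Qed.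

Lemma conjcD z w : conjc (z + w) = conjc z + conjc w. Proof. exact: rmorphD. Qed.
Lemma conjcN z : conjc (- z) = - conjc z. Proof. exact: rmorphN. Qed.
Lemma conjcB z w : conjc (z - w) = conjc z - conjc w. Proof. exact: rmorphB. Qed.
Lemma conjcM z w : conjc (z * w) = conjc z * conjc w. Proof. exact: rmorphM. Qed.

End ComplexModulus.

Section Wirtinger.
Context {R : realType}.
Implicit Types (z w h a b c d : R[i]) (f g : R[i] -> R[i]).

(* [a] and [b] are the Wirtinger derivatives of [f] with respect to the
   variable and its conjugate; [b = 0] is complex differentiability. *)
Definition wder f z a b := forall e : R, 0 < e -> exists2 r : R, 0 < r &
  forall h, cabs h < r -> cabs (f (z + h) - f z - (a * h + b * conjc h)) <= e * cabs h.

Lemma wder_eq f z a b a' b' : wder f z a b -> a = a' -> b = b' -> wder f z a' b'.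
Proof. by move=> H <- <-. Qed.

Lemma wder_cst c z : wder (fun=> c) z 0 0.
Proof.
move=> e e0; exists 1 => // h _.
by rewrite subrr !mul0r addr0 subr0 cabs0 mulr_ge0 ?cabs_ge0// ltW.
Qed.

Lemma wder_id z : wder id z 1 0.
Proof.
move=> e e0; exists 1 => // h _.
have -> : z + h - z - (1 * h + 0 * conjc h) = 0 by ring.
by rewrite cabs0 mulr_ge0 ?cabs_ge0// ltW.
Qed.

Lemma wder_conj z : wder (fun w => conjc w) z 0 1.
Proof.
move=> e e0; exists 1 => // h _.
have -> : conjc (z + h) - conjc z - (0 * h + 1 * conjc h) = 0.
  by rewrite rmorphD /=; ring.
by rewrite cabs0 mulr_ge0 ?cabs_ge0// ltW.
Qed.

Lemma wder_lip f z a b : wder f z a b -> exists2 r : R, 0 < r &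
  forall h, cabs h < r -> cabs (f (z + h) - f z) <= (cabs a + cabs b + 1) * cabs h.
Proof.
move=> /(_ 1 ltr01)[r r0 H]; exists r => // h /H H1.
have := cabsD (f (z + h) - f z - (a * h + b * conjc h)) (a * h + b * conjc h).
rewrite subrK => /le_trans; apply.
apply: (le_trans (lerD H1 (cabsD _ _))); rewrite !cabsM cabsJ; lra.
Qed.

Lemma wder_comp f g z a b c d : wder g z a b -> wder f (g z) c d ->
  wder (f \o g) z (c * a + d * conjc b) (c * b + d * conjc a).
Proof.
move=> dg df e e0.
have [r1 r10 L] := wder_lip dg.
set K := cabs a + cabs b + 1 in L.
have K1 : 1 <= K by rewrite /K; have := cabs_ge0 a; have := cabs_ge0 b; lra.
have K0 : 0 < K by lra.
set M := cabs c + cabs d + 1.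
have M0 : 0 < M by rewrite /M; have := cabs_ge0 c; have := cabs_ge0 d; lra.
have [r2 r20 F] := df (e / 2 / K) (divr_gt0 (divr_gt0 e0 (ltr0Sn _ _)) K0).
have [r3 r30 G] := dg (e / 2 / M) (divr_gt0 (divr_gt0 e0 (ltr0Sn _ _)) M0).
exists (Num.min r1 (Num.min (r2 / K) r3)).
  by rewrite !lt_min r10 r30 divr_gt0.
move=> h; rewrite !lt_min => /andP[h1 /andP[h2 h3]] /=.
set k := g (z + h) - g z.
have -> : g (z + h) = g z + k by rewrite /k; ring.
have kK : cabs k <= K * cabs h by exact: L.
have /F H1 : cabs k < r2.
  by apply: (le_lt_trans kK); rewrite mulrC -ltr_pdivlMr.
have H2 := G _ h3; rewrite -/k in H2.
set l := a * h + b * conjc h in H2.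
have -> : f (g z + k) - f (g z) -
    ((c * a + d * conjc b) * h + (c * b + d * conjc a) * conjc h) =
    (f (g z + k) - f (g z) - (c * k + d * conjc k)) +
    (c * (k - l) + d * conjc (k - l)).
  by rewrite (conjcB k) /l (conjcD (a * h)) !conjcM !conjcK; ring.
apply: (le_trans (cabsD _ _)).
have H3 : cabs (c * (k - l) + d * conjc (k - l)) <= M * (e / 2 / M * cabs h).
  apply: (le_trans (cabsD _ _)); rewrite !cabsM cabsJ -mulrDl.
  apply: ler_pM => //; rewrite ?addr_ge0 ?cabs_ge0// /M; lra.
have H4 : e / 2 / K * cabs k <= e / 2 / K * (K * cabs h).
  by apply: ler_wpM2l => //; rewrite !divr_ge0// ltW.
have E3 : M * (e / 2 / M * cabs h) = e / 2 * cabs h by field; lra.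
have E4 : e / 2 / K * (K * cabs h) = e / 2 * cabs h by field; lra.
rewrite E3 in H3; rewrite E4 in H4.
have -> : e * cabs h = e / 2 * cabs h + e / 2 * cabs h by field.
apply: lerD => //; exact: le_trans H1 H4.
Qed.

Lemma wder_add f g z a b c d : wder f z a b -> wder g z c d ->
  wder (fun w => f w + g w) z (a + c) (b + d).
Proof.
move=> df dg e e0.
have e20 : 0 < e / 2 by lra.
have [r1 r10 F] := df _ e20; have [r2 r20 G] := dg _ e20.
exists (Num.min r1 r2); first by rewrite lt_min r10.
move=> h; rewrite lt_min => /andP[/F H1 /G H2].
have -> : f (z + h) + g (z + h) - (f z + g z) -
   ((a + c) * h + (b + d) * conjc h) =
   (f (z + h) - f z - (a * h + b * conjc h)) +
   (g (z + h) - g z - (c * h + d * conjc h)) by ring.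
apply: (le_trans (cabsD _ _)); lra.
Qed.

Lemma wder_scale f c z a b : wder f z a b -> wder (fun w => c * f w) z (c * a) (c * b).
Proof.
move=> df e e0.
have K0 : 0 < cabs c + 1 by have := cabs_ge0 c; lra.
have [r r0 F] := df _ (divr_gt0 e0 K0).
exists r => // h /F H.
have -> : c * f (z + h) - c * f z - (c * a * h + c * b * conjc h) =
  c * (f (z + h) - f z - (a * h + b * conjc h)) by ring.
rewrite cabsM.
have : cabs c * cabs (f (z + h) - f z - (a * h + b * conjc h)) <=
   (cabs c + 1) * (e / (cabs c + 1) * cabs h).
  by apply: ler_pM; rewrite ?cabs_ge0//; lra.
by rewrite (_ : (cabs c + 1) * _ = e * cabs h)//; field; lra.
Qed.

Lemma wder_sqr z : wder (fun w => w * w) z (2 * z) 0.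
Proof.
move=> e e0; exists e => // h he.
have -> : (z + h) * (z + h) - z * z - (2 * z * h + 0 * conjc h) = h * h by ring.
by rewrite cabsM ler_wpM2r ?cabs_ge0// ltW.
Qed.

(** Polarization: [2 f g = (f + g)^2 - f^2 - g^2] reduces the product rule to the chain rule for the
    square. *)
Lemma wder_mul f g z a b c d : wder f z a b -> wder g z c d ->
  wder (fun w => f w * g w) z (a * g z + f z * c) (b * g z + f z * d).
Proof.
move=> df dg.
have sq u p q : wder u z p q -> wder (fun w => u w * u w) z (2 * u z * p) (2 * u z * q).
  move=> du; apply: wder_eq (wder_comp du (wder_sqr _)) _ _; ring.
have H1 := sq _ _ _ (wder_add df dg).
have H2 := sq _ _ _ df; have H3 := sq _ _ _ dg.
have H := wder_scale (2^-1) (wder_add H1 (wder_scale (-1) (wder_add H2 H3))).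
have -> : (fun w => f w * g w) = (fun w => 2^-1 * ((f w + g w) * (f w + g w) +
   -1 * (f w * f w + g w * g w))).
  by apply/funext => w; field.
by apply: wder_eq H _ _; field.
Qed.

Lemma wder_invz z : z != 0 -> wder (fun w => w^-1) z (- z ^- 2) 0.
Proof.
move=> z0 e e0.
have cz : 0 < cabs z by rewrite cabs_gt0.
exists (Num.min (cabs z / 2) (e * cabs z ^+ 3 / 2)).
  by rewrite lt_min !divr_gt0// mulr_gt0// exprn_gt0.
move=> h; rewrite lt_min => /andP[h1 h2].
have czh : cabs z / 2 <= cabs (z + h).
  by have := cabsB (z + h) h; rewrite addrK; lra.
have zh0 : z + h != 0 by rewrite -cabs_gt0; lra.
have -> : (z + h)^-1 - z^-1 - (- z ^- 2 * h + 0 * conjc h) =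
  h * h / (z ^+ 2 * (z + h)) by field; rewrite z0 zh0.
rewrite cabsM cabsV !cabsM ler_pdivrMr; last first.
  by rewrite !mulr_gt0//; lra.
have : cabs h * cabs h <= (e * cabs z ^+ 3 / 2) * cabs h.
  by rewrite ler_wpM2r ?cabs_ge0// ltW.
move=> /le_trans; apply.
have -> : e * cabs z ^+ 3 / 2 * cabs h = e * cabs h * (cabs z * cabs z * (cabs z / 2)).
  by field.
rewrite ler_wpM2l ?mulr_ge0 ?cabs_ge0//; first lra.
by rewrite ler_wpM2l ?mulr_ge0 ?cabs_ge0.
Qed.

Lemma wder_inv f z a b : f z != 0 -> wder f z a b ->
  wder (fun w => (f w)^-1) z (- a / f z ^+ 2) (- b / f z ^+ 2).
Proof.
move=> f0 df; apply: wder_eq (wder_comp df (wder_invz f0)) _ _; field => //.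
Qed.

Lemma wder_conjc f z a b : wder f z a b ->
  wder (fun w => conjc (f w)) z (conjc b) (conjc a).
Proof.
by move=> df; apply: wder_eq (wder_comp df (wder_conj _)) _ _; ring.
Qed.

Lemma wder_ext f g z a b (r : R) : 0 < r ->
  (forall w, cabs (w - z) < r -> f w = g w) -> wder f z a b -> wder g z a b.
Proof.
move=> r0 fg df e e0; have [s s0 F] := df _ e0.
exists (Num.min r s); first by rewrite lt_min r0.
move=> h; rewrite lt_min => /andP[h1 h2].
rewrite -!fg ?subrr ?cabs0//; last by rewrite addrAC subrr add0r.
exact: F.
Qed.

(** The difference of the two differentials is real-linear and [o(h)], hence zero in every
    direction; the directions [1] and [i] then separate the two coefficients. *)
Lemma wder_unique f z a b a' b' : wder f z a b -> wder f z a' b' -> a = a' /\ b = b'.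
Proof.
move=> d1 d2.
have key : forall h, (a - a') * h + (b - b') * conjc h = 0.
  move=> h; apply/eqP; rewrite -cabs_eq0; apply/eqP/le_anti; rewrite cabs_ge0 andbT.
  have [->|h0] := eqVneq h 0; first by rewrite conjc0 !mulr0 addr0 cabs0.
  have ch : 0 < cabs h by rewrite cabs_gt0.
  apply/ler_addgt0Pl => e e0; rewrite addr0.
  have e' : 0 < e / 2 / cabs h by rewrite !divr_gt0.
  have [r r0 F] := d1 _ e'; have [s s0 G] := d2 _ e'.
  set t := Num.min r s / 2 / cabs h.
  have m0 : 0 < Num.min r s by rewrite lt_min r0.
  have t0 : 0 < t by rewrite /t !divr_gt0.
  have ct : cabs (t%:C%C * h) = Num.min r s / 2.
    by rewrite cabsM cabsR gtr0_norm// /t; field; lra.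
  have lt1 : cabs (t%:C%C * h) < Num.min r s by rewrite ct; lra.
  have := lt1; rewrite lt_min => /andP[/F H1 /G H2].
  have E : t%:C%C * ((a - a') * h + (b - b') * conjc h) =
    (f (z + t%:C%C * h) - f z - (a' * (t%:C%C * h) + b' * conjc (t%:C%C * h))) -
    (f (z + t%:C%C * h) - f z - (a * (t%:C%C * h) + b * conjc (t%:C%C * h))).
    by rewrite conjcM conjc_real; ring.
  have := cabsB (f (z + t%:C%C * h) - f z - (a' * (t%:C%C * h) + b' * conjc (t%:C%C * h)))
    (f (z + t%:C%C * h) - f z - (a * (t%:C%C * h) + b * conjc (t%:C%C * h))).
  rewrite -E cabsM cabsR gtr0_norm// => H3.
  have H4 : t * cabs ((a - a') * h + (b - b') * conjc h) <= e / cabs h * cabs (t%:C%C * h).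
    apply: (le_trans H3); apply: (le_trans (lerD H2 H1)).
    by rewrite -mulrDl ler_wpM2r ?cabs_ge0// -mulrDl -splitr.
  have E2 : e / cabs h * cabs (t%:C%C * h) = t * e.
    by rewrite cabsM cabsR gtr0_norm//; field; lra.
  by rewrite E2 ler_pM2l in H4.
have k1 := key 1; have k2 := key ('i%C).
have E : (a - a') + (b - b') = 0 by rewrite -[RHS]k1 conjc1 !mulr1.
have E' : (a - a') - (b - b') = 0.
  have i0 : ('i%C : R[i]) != 0 by rewrite eq_complex /= oner_eq0 andbF.
  apply: (mulIf i0); rewrite mul0r -[RHS]k2.
  have -> : conjc ('i%C : R[i]) = - 'i%C by simpc.
  ring.
split; apply/eqP; rewrite -subr_eq0; apply/eqP.
  have -> : a - a' = ((a - a' + (b - b')) + (a - a' - (b - b'))) / 2 by field.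
  by rewrite E E' addr0 mul0r.
have -> : b - b' = ((a - a' + (b - b')) - (a - a' - (b - b'))) / 2 by field.
by rewrite E E' subr0 mul0r.
Qed.

Definition cder f z a := wder f z a 0.

Lemma cder_eq f z a a' : cder f z a -> a = a' -> cder f z a'.
Proof. by move=> H <-. Qed.
Lemma cder_cst c z : cder (fun=> c) z 0. Proof. exact: wder_cst. Qed.
Lemma cder_id z : cder id z 1. Proof. exact: wder_id. Qed.
Lemma cder_add f g z a c : cder f z a -> cder g z c -> cder (fun w => f w + g w) z (a + c).
Proof. by move=> df dg; apply: wder_eq (wder_add df dg) _ _; ring. Qed.
Lemma cder_scale f c z a : cder f z a -> cder (fun w => c * f w) z (c * a).
Proof. by move=> df; apply: wder_eq (wder_scale c df) _ _; ring. Qed.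
Lemma cder_opp f z a : cder f z a -> cder (fun w => - f w) z (- a).
Proof.
move=> df; have -> : (fun w => - f w) = (fun w => -1 * f w).
  by apply/funext => w; ring.
by apply: cder_eq (cder_scale _ df) _; ring.
Qed.
Lemma cder_mul f g z a c : cder f z a -> cder g z c ->
  cder (fun w => f w * g w) z (a * g z + f z * c).
Proof. by move=> df dg; apply: wder_eq (wder_mul df dg) _ _; ring. Qed.
Lemma cder_inv f z a : f z != 0 -> cder f z a ->
  cder (fun w => (f w)^-1) z (- a / f z ^+ 2).
Proof. by move=> f0 df; apply: wder_eq (wder_inv f0 df) _ _; ring. Qed.
Lemma cder_comp f g z a c : cder g z a -> cder f (g z) c -> cder (f \o g) z (c * a).
Proof. by move=> dg df; apply: wder_eq (wder_comp dg df) _ _; rewrite ?conjc0; ring. Qed.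
Lemma cder_unique f z a a' : cder f z a -> cder f z a' -> a = a'.
Proof. by move=> h1 h2; have [] := wder_unique h1 h2. Qed.

End Wirtinger.

(** * Wirtinger derivatives against library derivatives and neighbourhoods *)

Section Links.
Context {R : realType}.
Implicit Types (z w h a b : R[i]) (f g F : R[i] -> R[i]).

(** Balls of [R[i]] have radii in [R[i]]; a positive element of [R[i]] is real, so real radii are
    enough. *)
Lemma nbhs_cabsP z (P : set R[i]) :
  nbhs z P <-> exists2 r : R, 0 < r & forall w, cabs (w - z) < r -> P w.
Proof.
split=> [/nbhs_ballP[e /= e0 H]|[r r0 H]].
  have er : e = (complex.Re e)%:C%C by rewrite RRe_real// gtr0_real.
  rewrite er ltcR in e0.
  exists (complex.Re e) => // w hw; apply: H; rewrite /ball /=.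
  by rewrite distrC normr_cabs er ltcR.
apply/nbhs_ballP; exists r%:C%C => /=; first by rewrite ltcR.
by move=> w; rewrite /ball /= distrC normr_cabs ltcR; exact: H.
Qed.

Lemma cder_derivable f z a : cder f z a -> is_derive z 1 f a.
Proof.
move=> df.
suff H : (fun h => h^-1 *: ((f \o shift z) (h *: 1) - f z)) @ 0^' --> a.
  apply: DeriveDef; first by apply/cvg_ex; exists a.
  by apply/cvg_lim.
apply/cvgrPdist_le => e e0.
have er : e = (complex.Re e)%:C%C by rewrite RRe_real// gtr0_real.
rewrite er ltcR in e0.
have [r r0 H] := df _ e0.
apply/nbhs_cabsP; exists r => // h; rewrite subr0 => hr /eqP h0 /=.
have := H _ hr.
move=> H1; rewrite distrC normr_cabs [leRHS]er lecR -(ler_pM2r (_ : 0 < cabs h)) ?cabs_gt0 -?cabsM//; last exact/eqP.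
apply: le_trans H1; rewrite le_eqVlt; apply/orP; left; apply/eqP; congr cabs.
rewrite (_ : h *: (1 : R[i]) = h)//; last by rewrite /GRing.scale /= mulr1.
rewrite /GRing.scale /= mulrBl mulrAC mulVf ?mul1r ?mul0r ?addr0 ?(addrC h)//; exact/eqP.
Qed.

Lemma derivable_cder f z : derivable f z 1 -> cder f z (derive1 f z).
Proof.
move=> df e e0; rewrite derive1E.
have /cvgrPdist_le : (fun h => h^-1 *: ((f \o shift z) (h *: 1) - f z)) @ 0^' --> 'D_1 f z.
  exact: df.
have ec : 0 < e%:C%C by rewrite ltcR.
move=> /(_ _ ec)/nbhs_cabsP[r r0 H]; exists r => // h hr.
have [->|h0] := eqVneq h 0.
  by rewrite addr0 subrr conjc0 !mulr0 addr0 subr0 cabs0 mulr0.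
have := H h; rewrite subr0 => /(_ hr) /(_ h0).
rewrite distrC normr_cabs lecR -(ler_pM2r (_ : 0 < cabs h)) ?cabs_gt0 -?cabsM//.
move=> H1.
apply: le_trans H1; rewrite le_eqVlt; apply/orP; left; apply/eqP; congr cabs.
rewrite (_ : h *: (1 : R[i]) = h)//; last by rewrite /GRing.scale /= mulr1.
rewrite /= /GRing.scale /= mulrBl mulrAC mulVf ?mul1r ?mul0r ?addr0 ?(addrC h)//.
Qed.

Lemma cabs_to_plane z : `|to_plane z| <= cabs z.
Proof. by rewrite prod_normE /= ge_max cabs_Re cabs_Im. Qed.

Lemma cabs_of_plane (p : R * R) : cabs (of_plane p) <= 2 * `|p|.
Proof.
apply: (le_trans (cabs_ReIm _)); rewrite prod_normE /=.
have h1 : `|p.1| <= Num.max `|p.1| `|p.2| by rewrite le_max lexx.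
have h2 : `|p.2| <= Num.max `|p.1| `|p.2| by rewrite le_max lexx orbT.
lra.
Qed.

Lemma to_planeD z w : to_plane (z + w) = to_plane z + to_plane w.
Proof. by case: z; case: w. Qed.
Lemma to_planeN z : to_plane (- z) = - to_plane z.
Proof. by case: z. Qed.
Lemma to_planeB z w : to_plane (z - w) = to_plane z - to_plane w.
Proof. by rewrite to_planeD to_planeN. Qed.
Lemma to_planeZ (t : R) z : to_plane (t%:C%C * z) = t *: to_plane z.
Proof. by case: z => a b; rewrite /to_plane /=; congr pair; rewrite mul0r ?subr0 ?addr0. Qed.
Lemma of_planeD (p q : R * R) : of_plane (p + q) = of_plane p + of_plane q.
Proof. by []. Qed.
Lemma of_planeB (p q : R * R) : of_plane (p - q) = of_plane p - of_plane q.
Proof. by []. Qed.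
Lemma of_planeZ (t : R) (p : R * R) : of_plane (t *: p) = t%:C%C * of_plane p.
Proof. by rewrite /of_plane /=; simpc. Qed.
Lemma to_planeK z : of_plane (to_plane z) = z. Proof. by case: z. Qed.
Lemma of_planeK (p : R * R) : to_plane (of_plane p) = p. Proof. by case: p. Qed.

Lemma plane_nbhsP (p : R * R) (P : set (R * R)) :
  nbhs p P <-> exists2 r : R, 0 < r & forall q, cabs (of_plane (q - p)) < r -> P q.
Proof.
split=> [/(@nbhs_ballP _ (R * R)%type)[e /= e0 H]|[r r0 H]].
  exists e => // q hq; apply: H; rewrite prod_norm_ball /ball_ /= distrC.
  by apply: le_lt_trans hq; rewrite -{1}(of_planeK (q - p)) cabs_to_plane.
apply/(@nbhs_ballP _ (R * R)%type); exists (r / 2) => /=; first by rewrite divr_gt0.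
move=> q; rewrite prod_norm_ball /ball_ /= distrC => hq; apply: H.
by apply: (le_lt_trans (cabs_of_plane _)); lra.
Qed.

(** The passage to the directional derivatives on [R * R], in which [smooth_on] and [jacobian_det]
    are phrased. *)
Lemma wder_real_map F (p : R * R) a b : wder F (of_plane p) a b ->
  (forall v : R * R, is_derive p v (real_map F)
     (to_plane (of_plane v * a + conjc (of_plane v) * b))) /\
  {for p, continuous (real_map F)}.
Proof.
move=> dF; split=> [v|].
  set l := of_plane v * a + conjc (of_plane v) * b.
  suff H : (fun h : R => h^-1 *: ((real_map F \o shift p) (h *: v) - real_map F p)) @ (0:R)^'
      --> to_plane l.
    apply: DeriveDef; first by apply/cvg_ex; exists (to_plane l).
    by apply/cvg_lim.
  apply/cvgrPdist_le => e e0.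
  have K0 : 0 < cabs (of_plane v) + 1 by have := cabs_ge0 (of_plane v); lra.
  have [r r0 H] := dF _ (divr_gt0 e0 K0).
  apply/nbhs_ballP; exists (r / (cabs (of_plane v) + 1)) => /=; first by rewrite divr_gt0.
  move=> h; rewrite /ball /= sub0r normrN => hr h0.
  have nh : 0 < `|h| by rewrite normr_gt0.
  rewrite -(ler_pM2l nh) -normrZ scalerBr scalerA mulfV// scale1r distrC.
  rewrite /real_map /= of_planeD of_planeZ (addrC (h%:C%C * _)).
  rewrite -to_planeB -to_planeZ -to_planeB.
  apply: (le_trans (cabs_to_plane _)).
  have hv : cabs (h%:C%C * of_plane v) < r.
    rewrite cabsM cabsR.
    move: hr; rewrite ltr_pdivlMr// => hr; apply: le_lt_trans hr.
    by rewrite ler_pM2l//; lra.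
  have := H _ hv.
  rewrite (_ : a * (h%:C%C * of_plane v) + b * conjc (h%:C%C * of_plane v) = h%:C%C * l); last first.
    by rewrite /l conjcM conjc_real; ring.
  move=> /le_trans; apply; rewrite cabsM cabsR.
  rewrite (_ : `|h| * e = e / (cabs (of_plane v) + 1) * (`|h| * (cabs (of_plane v) + 1))); last first.
    by field; lra.
  rewrite ler_wpM2l// ?divr_ge0// ?ltW//.
  by rewrite ltr_pM2l//; lra.
have [r r0 H] := wder_lip dF.
set K := cabs a + cabs b + 1 in H.
have K0 : 0 < K by rewrite /K; have := cabs_ge0 a; have := cabs_ge0 b; lra.
apply/cvgrPdist_lt => e e0.
apply/plane_nbhsP; exists (Num.min r (e / K)); first by rewrite lt_min r0 divr_gt0.
move=> q hq'; rewrite distrC /real_map /= -to_planeB; apply: (le_lt_trans (cabs_to_plane _)).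
move: hq'; rewrite lt_min => /andP[/H H1 H2].
rewrite [in F _]addrC [in of_plane (q - p) + _]of_planeB subrK in H1.
apply: (le_lt_trans H1); rewrite mulrC -ltr_pdivlMr// -of_planeB //.
Qed.

Lemma real_is_derive (r : R -> R) (t l : R) :
  (forall e : R, 0 < e -> exists2 d : R, 0 < d & forall h : R, `|h| < d ->
     `|r (t + h) - r t - l * h| <= e * `|h|) -> is_derive t 1 r l.
Proof.
move=> H.
suff K : (fun h : R => h^-1 *: ((r \o shift t) (h *: 1) - r t)) @ (0:R)^' --> l.
  apply: DeriveDef; first by apply/cvg_ex; exists l.
  by apply/cvg_lim.
apply/cvgrPdist_le => e e0; have [d d0 Hd] := H _ e0.
apply/nbhs_ballP; exists d => //= h; rewrite /ball /= sub0r normrN => hd h0.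
have nh : 0 < `|h| by rewrite normr_gt0.
rewrite distrC -(ler_pM2r nh) -normrM mulrBl.
rewrite /GRing.scale /= mulr1 mulrAC mulVf// mul1r (addrC h).
exact: Hd.
Qed.

(** Pairing with a fixed [u] along a segment produces a real function of a real variable, to which
    the real mean value theorem applies. *)
Lemma wder_line F z v a b (u : R[i]) (t : R) : wder F (z + t%:C%C * v) a b ->
  is_derive t 1 (fun s : R => complex.Re (u * F (z + s%:C%C * v)))
     (complex.Re (u * (a * v + b * conjc v))).
Proof.
move=> dF; apply: real_is_derive => e e0.
have K0 : 0 < (cabs u + 1) * (cabs v + 1).
  by have := cabs_ge0 u; have := cabs_ge0 v; nra.
have v0 : 0 < cabs v + 1 by have := cabs_ge0 v; lra.
have [r r0 H] := dF _ (divr_gt0 e0 K0).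
exists (r / (cabs v + 1)); first by rewrite divr_gt0.
move=> h; rewrite ltr_pdivlMr// => hr.
have hv : cabs (h%:C%C * v) < r.
  by rewrite cabsM cabsR; apply: le_lt_trans hr; rewrite ler_wpM2l//; lra.
have H1 := H _ hv.
have -> : complex.Re (u * F (z + (t + h)%:C%C * v)) - complex.Re (u * F (z + t%:C%C * v)) -
   complex.Re (u * (a * v + b * conjc v)) * h =
   complex.Re (u * (F (z + t%:C%C * v + h%:C%C * v) - F (z + t%:C%C * v) -
     (a * (h%:C%C * v) + b * conjc (h%:C%C * v)))).
  have -> : z + (t + h)%:C%C * v = z + t%:C%C * v + h%:C%C * v by rewrite rmorphD /=; ring.
  have -> : complex.Re (u * (a * v + b * conjc v)) * h =
     complex.Re (h%:C%C * (u * (a * v + b * conjc v))).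
    by rewrite ReZ mulrC.
  rewrite -!ReN -!ReD conjcM conjc_real; congr complex.Re; ring.
apply: (le_trans (cabs_Re _)); rewrite cabsM.
have H2 : cabs u * cabs (F (z + t%:C%C * v + h%:C%C * v) - F (z + t%:C%C * v) -
     (a * (h%:C%C * v) + b * conjc (h%:C%C * v))) <=
   (cabs u + 1) * (e / ((cabs u + 1) * (cabs v + 1)) * (`|h| * (cabs v + 1))).
  apply: ler_pM; rewrite ?cabs_ge0//; first lra.
  apply: (le_trans H1); rewrite (ler_wpM2l (ltW (divr_gt0 e0 K0)))//.
  by rewrite cabsM cabsR ler_wpM2l//; lra.
apply: (le_trans H2); rewrite le_eqVlt; apply/orP; left; apply/eqP; field.
by rewrite !gt_eqF//; have := cabs_ge0 u; lra.
Qed.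

End Links.

(** * Mean value inequality and the complex exponential *)

Section MeanValue.
Context {R : realType}.
Implicit Types (z w a b : R[i]) (f g F : R[i] -> R[i]).

(** The real mean value theorem is applied to [f] paired with [u = conj (f w - f z)]: the increment
    of the pairing is [|f w - f z|^2], and one factor cancels. The bound is attached to a single
    point of the segment, so a strict pointwise bound on the derivatives stays strict. *)
Lemma wder_mvt f (A B : R[i] -> R[i]) z w :
  (forall t : R, 0 <= t <= 1 ->
     wder f (z + t%:C%C * (w - z)) (A (z + t%:C%C * (w - z))) (B (z + t%:C%C * (w - z)))) ->
  exists2 t : R, 0 <= t <= 1 &
    cabs (f w - f z) <=
    (cabs (A (z + t%:C%C * (w - z))) + cabs (B (z + t%:C%C * (w - z)))) * cabs (w - z).
Proof.
move=> df; set v := w - z in df *.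
have [fz|fz] := eqVneq (f w - f z) 0.
  exists 0; first by rewrite lexx ler01.
  by rewrite fz cabs0 mulr_ge0 ?addr_ge0 ?cabs_ge0.
set u := conjc (f w - f z).
pose r (s : R) := complex.Re (u * f (z + s%:C%C * v)).
pose dr (s : R) := complex.Re (u * (A (z + s%:C%C * v) * v + B (z + s%:C%C * v) * conjc v)).
have dr_r (s : R) : 0 <= s <= 1 -> is_derive s 1 r (dr s).
  by move=> s01; apply: wder_line; exact: df.
have M1 (s : R) : s \in `]0, 1[ -> is_derive s 1 r (dr s).
  by rewrite in_itv /= => /andP[s0 s1]; apply: dr_r; rewrite !ltW.
have M2 : {within `[0, 1], continuous r}.
  apply: derivable_within_continuous => x; rewrite in_itv /= => x01.
  by have [] := dr_r _ x01.
have [c c01 E] := @MVT_segment _ r dr 0 1 ler01 M1 M2.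
rewrite in_itv /= in c01; exists c => //.
move: E; rewrite subr0 mulr1 /r /dr mul0r addr0 mul1r -ReN -ReD -mulrBr.
rewrite (_ : z + v = w); last by rewrite /v addrC subrK.
rewrite /u mulrC mulcJ /= => E.
have d0 : 0 < cabs (f w - f z) by rewrite cabs_gt0.
rewrite -(ler_pM2l d0) -expr2 E.
apply: (le_trans (ler_norm _)); apply: (le_trans (cabs_Re _)); rewrite cabsM cabsJ ler_pM2l//.
by apply: (le_trans (cabsD _ _)); rewrite !cabsM cabsJ; lra.
Qed.

Lemma is_derive_eps (r : R -> R) (t l : R) : is_derive t 1 r l ->
  forall e : R, 0 < e -> exists2 d : R, 0 < d & forall h : R, `|h| < d ->
     `|r (t + h) - r t - l * h| <= e * `|h|.
Proof.
move=> [df dl] e e0.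
have /cvgrPdist_le : (fun h : R => h^-1 *: ((r \o shift t) (h *: 1) - r t)) @ (0:R)^' --> 'D_1 r t.
  exact: df.
rewrite dl => /(_ _ e0)/nbhs_ballP[d /= d0 H]; exists d => // h hr.
have [->|h0] := eqVneq h 0; first by rewrite addr0 subrr mulr0 subr0 normr0 mulr0.
have := H h; rewrite /ball /= sub0r normrN => /(_ hr h0).
have nh : 0 < `|h| by rewrite normr_gt0.
rewrite distrC -(ler_pM2r nh) -normrM mulrBl.
by rewrite /GRing.scale /= mulr1 mulrAC mulVf// mul1r (addrC h).
Qed.

Lemma wder_ofRe (r : R -> R) z (l : R) : is_derive (complex.Re z) 1 r l ->
  wder (fun w => (r (complex.Re w))%:C%C) z (l / 2)%:C%C (l / 2)%:C%C.
Proof.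
move=> /is_derive_eps dr e e0; have [d d0 H] := dr _ e0; exists d => // h hd.
have hx : `|complex.Re h| < d by apply: le_lt_trans hd; exact: cabs_Re.
have -> : (l / 2)%:C%C * h + (l / 2)%:C%C * conjc h = (l * complex.Re h)%:C%C.
  by case: h {hd hx} => x y; simpc; congr Complex => /=; field.
rewrite -!rmorphB cabsR ReD; apply: (le_trans (H _ hx)).
by rewrite ler_pM2l// cabs_Re.
Qed.

Lemma wder_ofIm (r : R -> R) z (l : R) : is_derive (complex.Im z) 1 r l ->
  wder (fun w => (r (complex.Im w))%:C%C) z (Complex 0 (- l / 2)) (Complex 0 (l / 2)).
Proof.
move=> /is_derive_eps dr e e0; have [d d0 H] := dr _ e0; exists d => // h hd.
have hx : `|complex.Im h| < d by apply: le_lt_trans hd; exact: cabs_Im.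
have -> : Complex 0 (- l / 2) * h + Complex 0 (l / 2) * conjc h = (l * complex.Im h)%:C%C.
  by case: h {hd hx} => x y; simpc; congr Complex => /=; field.
rewrite -!rmorphB cabsR ImD; apply: (le_trans (H _ hx)).
by rewrite ler_pM2l// cabs_Im.
Qed.

(** The complex exponential, assembled from real functions so that [wder_ofRe] and [wder_ofIm] yield
    its derivative. *)
Definition cexp z : R[i] := (expR (complex.Re z))%:C%C *
  ((cos (complex.Im z))%:C%C + 'i%C * (sin (complex.Im z))%:C%C).

Lemma cder_cexp z : cder cexp z (cexp z).
Proof.
have d1 := wder_ofRe (is_derive_expR (complex.Re z)).
have d2 := wder_ofIm (is_derive_cos (complex.Im z)).
have d3 := wder_scale 'i%C (wder_ofIm (is_derive_sin (complex.Im z))).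
by apply: wder_eq (wder_mul d1 (wder_add d2 d3)) _ _; rewrite /cexp; simpc; congr Complex; field.
Qed.

Lemma cexp_neq0 z : cexp z != 0.
Proof.
rewrite /cexp mulf_neq0//; first by rewrite eq_complex /= eqxx andbT gt_eqF// expR_gt0.
rewrite -cabs_eq0 -sqrf_eq0 cabs_sqr; simpc => /=.
by rewrite cos2Dsin2 oner_eq0.
Qed.

Lemma cabs_cexp z : cabs (cexp z) = expR (complex.Re z).
Proof.
rewrite /cexp cabsM cabsR ger0_norm ?expR_ge0//.
rewrite (_ : cabs _ = 1) ?mulr1//.
apply/eqP; rewrite -(@eqrXn2 _ 2)// ?cabs_ge0// cabs_sqr; simpc => /=.
by rewrite cos2Dsin2 expr1n.
Qed.

End MeanValue.

(** * Smoothness through classes stable under differentiation *)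

Section Smooth.
Context {R : realType}.

Lemma Cn_on_eq (V W : normedModType R) n (U : set V) (F G : V -> W) :
  open U -> (forall x, U x -> F x = G x) -> Cn_on n U F -> Cn_on n U G.
Proof.
move=> oU; elim: n F G => [|n IH] F G FG /= [cF dF].
  split=> // x Ux.
  have nFG : \forall y \near x, F y = G y by near=> y; apply: FG; near: y; exact: open_nbhs_nbhs.
  have := cF _ Ux; rewrite /prop_for /continuous_at (FG _ Ux).
  by apply: cvg_trans; apply: near_eq_cvg; apply: filterS nFG => y ->.
have nFG x : U x -> \forall y \near x, F y = G y.
  by move=> Ux; near=> y; apply: FG; near: y; exact: open_nbhs_nbhs.
split=> [x Ux|v].
  have := cF _ Ux; rewrite /prop_for /continuous_at (FG _ Ux).
  by apply: cvg_trans; apply: near_eq_cvg; apply: filterS (nFG _ Ux) => y ->.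
have [dFv cFv] := dF v; split=> [x Ux|].
  exact: near_eq_derivable (nFG _ Ux) (dFv _ Ux).
apply: IH cFv => x Ux; exact: near_eq_derive (nFG _ Ux).
Unshelve. all: by end_near. Qed.

(** Induction on the order needs all directional derivatives of a member to lie again in one class;
    [S] is that class, and the direction [v] enters as a constant coefficient. *)
Lemma smooth_wirtinger (S : (R[i] -> R[i]) -> Prop) (U : set R[i]) :
  open (@of_plane R @^-1` U) ->
  (forall F, S F -> exists A B, (forall z, U z -> wder F z (A z) (B z)) /\
     forall v, S (fun z => v * A z + conjc v * B z)) ->
  forall F, S F -> smooth_on (@of_plane R @^-1` U) (real_map F).
Proof.
move=> oU HS F SF n; elim: n F SF => [|n IH] F SF.
  split=> // p Up; have [A [B [dF _]]] := HS _ SF.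
  by have [] := wder_real_map (dF _ Up).
have [A [B [dF Sv]]] := HS _ SF; split.
  by move=> p Up; have [] := wder_real_map (dF _ Up).
move=> v; split=> [p Up|].
  by have [/(_ v)[]] := wder_real_map (dF _ Up).
apply: Cn_on_eq (IH _ (Sv (of_plane v))) => // p Up.
by have [/(_ v)[]] := wder_real_map (dF _ Up).
Qed.

End Smooth.

(** * Area integrals *)

Section PlaneMeasure.
Context {R : realType}.
Local Notation plane := (measurableTypeR R * measurableTypeR R)%type.
Local Notation leb := (@lebesgue_measure R).
Local Notation mu2 := (@lebesgue_measure R \x @lebesgue_measure R)%E.
Local Notation area := (@area_measure R).

(** Openness refers to the product topology, measurability to the product sigma-algebra: an open set
    is the countable union of the boxes it contains that have rational centres and radii
    [1 / (n + 1)]. *)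
Lemma open_measurable_plane (A : set (R * R)) : open A -> measurable (A : set plane).
Proof.
move=> oA.
pose box (i : rat * rat * nat) : set (R * R) :=
  ball (ratr i.1.1 : R) (i.2.+1%:R^-1) `*` ball (ratr i.1.2 : R) (i.2.+1%:R^-1).
pose F i : set plane := if `[< box i `<=` A >] then box i else set0.
have -> : A = \bigcup_i F i.
  apply/seteqP; split => [p Ap|p [i _]]; last first.
    by rewrite /F; case: ifPn => // /asboolP; apply.
  have /nbhs_ballP[e /= e0 H] : nbhs p A by exact: open_nbhs_nbhs.
  have [n] := ltr_add_invr (divr_gt0 e0 (ltr0Sn R 1)); rewrite add0r => ne.
  have n0 : 0 < n.+1%:R^-1 :> R by rewrite invr_gt0.
  have key (x y q d : R) : d < e / 2 -> y < q -> q < y + d -> - d < q - x ->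
      q - x < d -> `|y - x| < e.
    by move=> h1 h2 h3 h4 h5; rewrite ltr_norml; apply/andP; split; lra.
  have [q1] : exists q : rat, ratr q \in `]p.1, p.1 + n.+1%:R^-1[.
    by apply: rat_in_itvoo; rewrite ltrDl.
  have [q2] : exists q : rat, ratr q \in `]p.2, p.2 + n.+1%:R^-1[.
    by apply: rat_in_itvoo; rewrite ltrDl.
  rewrite !in_itv /= => /andP[q2l q2r] /andP[q1l q1r].
  have sub : box (q1, q2, n) `<=` A.
    move=> x [/= x1 x2]; apply: H; move: x1 x2; rewrite /ball /= !ltr_norml.
    move=> /andP[x1l x1r] /andP[x2l x2r].
    by split; rewrite /ball /=; [apply: (key _ _ _ _ ne q1l)|apply: (key _ _ _ _ ne q2l)].
  exists (q1, q2, n) => //; rewrite /F asboolT//.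
  have key2 (y q d : R) : 0 < d -> y < q -> q < y + d -> `|q - y| < d.
    by move=> h1 h2 h3; rewrite ltr_norml; apply/andP; split; lra.
  by split; apply: key2.
apply: countable_bigcupT_measurable => // i; rewrite /F; case: ifPn => // _.
by apply: measurableX; exact: measurable_ball.
Qed.

Lemma continuous_measurable_plane (D : set (R * R)) (f : R * R -> R) : open D ->
  (forall p, D p -> {for p, continuous f}) -> measurable_fun (D : set plane) f.
Proof.
move=> oD cf; apply: (measurability _ (measurable_realfun.RGenOpens.measurableE R)).
move=> _ [_ [a [b ->] <-]]; apply: open_measurable_plane.
rewrite openE => p [Dp fp].
have H1 : nbhs p D by exact: open_nbhs_nbhs.
have H2 : nbhs p (f @^-1` `]a, b[).
  by apply: (cf _ Dp); apply: open_nbhs_nbhs; split => //; exact: interval_open.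
exact: filterI H1 H2.
Qed.

(** By uniqueness of Lebesgue measure it is enough to compare half-open intervals; in the plane,
    rectangles play the same role. *)
Lemma lebesgue_measure_shift (a : R) (A : set R) : measurable A ->
  pushforward leb ((fun x => x + a) : _ -> measurableTypeR R) A = leb A.
Proof.
move=> mA; apply/esym.
apply: lebesgue_measure_unique => //; first exact: measurable_funD.
move=> mf _ [[u v]] _ <-.
rewrite -[RHS]/(leb ((fun x => x + a) @^-1` `]u, v]%classic)).
rewrite (_ : _ @^-1` _ = `](u - a), (v - a)]%classic); last first.
  by apply/seteqP; split => x /=; rewrite !in_itv /= ltrBlDr lerBrDr.
rewrite !lebesgue_measure_itv /= !lte_fin ltrD2r; case: ifPn => // _.
by rewrite -!EFinB; congr EFin; lra.
Qed.

Lemma area_measure_shift (a : R * R) (A : set plane) : measurable A ->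
  pushforward area ((fun p : plane => (p.1 + a.1, p.2 + a.2)) : _ -> plane) A = area A.
Proof.
move=> mA; rewrite /pushforward /= /area_measure /mscale /=; congr (_ * _)%E.
have mf1 : measurable_fun setT (fun x : measurableTypeR R => x + a.1 : measurableTypeR R).
  exact: measurable_funD.
have mf2 : measurable_fun setT (fun x : measurableTypeR R => x + a.2 : measurableTypeR R).
  exact: measurable_funD.
have mf : measurable_fun setT ((fun p : plane => (p.1 + a.1, p.2 + a.2)) : _ -> plane).
  apply: measurable_fun_pair.
    by apply: (measurableT_comp mf1); exact: measurable_fst.
  by apply: (measurableT_comp mf2); exact: measurable_snd.
apply/esym.
apply: (@product_measure_unique _ _ _ _ _ leb leb (pushforward mu2 _)) => // X Y mX mY.
rewrite /pushforward /= -(lebesgue_measure_shift a.1 mX) -(lebesgue_measure_shift a.2 mY).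
rewrite /pushforward -product_measure1E.
- by congr (_ _); apply/seteqP; split => p.
- by rewrite -[X in measurable X]setTI; exact: mf1.
- by rewrite -[X in measurable X]setTI; exact: mf2.
Qed.

End PlaneMeasure.

(** * Complex-valued integrals over the plane *)

Section ComplexIntegral.
Context {R : realType}.
Local Notation plane := (measurableTypeR R * measurableTypeR R)%type.
Local Notation area := (@area_measure R).
Implicit Types (F G : R[i] -> R[i]) (z w : R[i]).

Definition rpart F : plane -> R := fun p => complex.Re (F (of_plane p)).
Definition ipart F : plane -> R := fun p => complex.Im (F (of_plane p)).

Definition cmeasurable F := measurable_fun setT (rpart F) /\ measurable_fun setT (ipart F).

(** One constant bounds both the values and the radius of the support. Such functions are
    integrable, and the class is stable under translation, which is what summation by parts uses. *)
Definition bddsupp F := cmeasurable F /\ exists M : R, forall z, cabs (F z) <= M /\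
  (M < cabs z -> F z = 0).

Lemma cmeasurable_cst c : cmeasurable (fun=> c).
Proof. by split; exact: measurable_cst. Qed.

Lemma cmeasurableD F G : cmeasurable F -> cmeasurable G -> cmeasurable (fun z => F z + G z).
Proof.
move=> [rF iF] [rG iG]; split.
  have -> : rpart (fun z => F z + G z) = (rpart F \+ rpart G).
    by apply/funext => p; rewrite /rpart /= ReD.
  exact: measurable_funD.
have -> : ipart (fun z => F z + G z) = (ipart F \+ ipart G).
  by apply/funext => p; rewrite /ipart /= ImD.
exact: measurable_funD.
Qed.

Lemma cmeasurableM F G : cmeasurable F -> cmeasurable G -> cmeasurable (fun z => F z * G z).
Proof.
move=> [rF iF] [rG iG]; split.
  have -> : rpart (fun z => F z * G z) = (rpart F \* rpart G) \- (ipart F \* ipart G).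
    by apply/funext => p; rewrite /rpart /= ReM.
  by apply: measurable_funB; exact: measurable_funM.
have -> : ipart (fun z => F z * G z) = (rpart F \* ipart G) \+ (ipart F \* rpart G).
  by apply/funext => p; rewrite /ipart /= ImM.
by apply: measurable_funD; exact: measurable_funM.
Qed.

Lemma cmeasurable_shift F a : cmeasurable F -> cmeasurable (fun z => F (z + a)).
Proof.
move=> [rF iF].
have mf : measurable_fun setT ((fun p : plane => (p.1 + complex.Re a, p.2 + complex.Im a)) : _ -> plane).
  apply: measurable_fun_pair.
    by apply: measurable_funD => //; exact: measurable_fst.
  by apply: measurable_funD => //; exact: measurable_snd.
split.
  have -> : rpart (fun z => F (z + a)) = rpart F \o (fun p => (p.1 + complex.Re a, p.2 + complex.Im a)).
    by apply/funext => p; rewrite /rpart /=; congr (complex.Re (F _)); case: (a).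
  exact: (measurableT_comp rF mf).
have -> : ipart (fun z => F (z + a)) = ipart F \o (fun p => (p.1 + complex.Re a, p.2 + complex.Im a)).
  by apply/funext => p; rewrite /ipart /=; congr (complex.Im (F _)); case: (a).
exact: (measurableT_comp iF mf).
Qed.

Definition ccont F z := forall e : R, 0 < e -> exists2 d : R, 0 < d &
  forall h, cabs h < d -> cabs (F (z + h) - F z) <= e.

Lemma wder_ccont F z a b : wder F z a b -> ccont F z.
Proof.
move=> /wder_lip[r r0 H] e e0.
set K := cabs a + cabs b + 1 in H.
have K0 : 0 < K by rewrite /K; have := cabs_ge0 a; have := cabs_ge0 b; lra.
exists (Num.min r (e / K)); first by rewrite lt_min r0 divr_gt0.
move=> h; rewrite lt_min => /andP[/H h1 h2]; apply: (le_trans h1).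
by rewrite mulrC -ler_pdivlMr// ltW.
Qed.

(** Extension by zero turns an integral over the disk into one over the plane, where translations
    act. *)
Definition cut (r : R) F z := if cabs z < r then F z else 0.

Definition pball (r : R) : set (R * R) := [set p | cabs (of_plane p) < r].

Lemma open_pball (r : R) : open (pball r).
Proof.
rewrite openE => p /= pr; apply/plane_nbhsP; exists (r - cabs (of_plane p)).
  by rewrite subr_gt0.
move=> q; rewrite of_planeB /pball /= => h.
have := cabsD (of_plane q - of_plane p) (of_plane p); rewrite subrK; lra.
Qed.

Lemma measurable_pball (r : R) : measurable (pball r : set plane).
Proof. by apply: open_measurable_plane; exact: open_pball. Qed.

Lemma cmeasurable_cut (r : R) F : (forall z, cabs z < r -> ccont F z) -> cmeasurable (cut r F).
Proof.
move=> cF.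
have key (P : R[i] -> R) : P 0 = 0 -> (forall z w, `|P z - P w| <= cabs (z - w)) ->
    measurable_fun setT ((fun p => P (cut r F (of_plane p))) : plane -> R).
  move=> P0 PL.
  have -> : (fun p => P (cut r F (of_plane p))) =
     ((fun p => P (F (of_plane p))) \_ (pball r : set plane)).
    apply/funext => p; rewrite /patch /cut; case: ifPn => h.
      by rewrite mem_set.
    by rewrite memNset //; exact/negP.
  apply/(measurable_restrictT _ (measurable_pball r)).
  apply: continuous_measurable_plane; first exact: open_pball.
  move=> p pr; apply/cvgrPdist_le => e e0; have [d d0 H] := cF _ pr _ e0.
  apply/plane_nbhsP; exists d => // q qd; rewrite distrC.
  apply: (le_trans (PL _ _)).
  by have := H _ qd; rewrite of_planeB (addrC (of_plane p)) subrK.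
split; apply: key => // z w.
  by rewrite -ReN -ReD cabs_Re.
by rewrite -ImN -ImD cabs_Im.
Qed.

Lemma cmeasurable_cvg (Fn : nat -> R[i] -> R[i]) F : (forall n, cmeasurable (Fn n)) ->
  (forall z (e : R), 0 < e -> exists N, forall n, (N <= n)%N -> cabs (Fn n z - F z) <= e) ->
  cmeasurable F.
Proof.
move=> mF cF.
split.
  apply: (@measurable_fun_cvg _ _ _ setT (fun n => rpart (Fn n))) => [m|p _].
    by have [] := mF m.
  apply/cvgrPdist_le => e e0; have [N HN] := cF (of_plane p) _ e0.
  exists N => // n /= Nn; rewrite distrC /rpart -ReN -ReD.
  exact: le_trans (cabs_Re _) (HN _ Nn).
apply: (@measurable_fun_cvg _ _ _ setT (fun n => ipart (Fn n))) => [m|p _].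
  by have [] := mF m.
apply/cvgrPdist_le => e e0; have [N HN] := cF (of_plane p) _ e0.
exists N => // n /= Nn; rewrite distrC /ipart -ImN -ImD.
exact: le_trans (cabs_Im _) (HN _ Nn).
Qed.

(** Supports are enclosed in squares rather than disks because the product measure of a square is
    immediate. *)
Definition box (M : R) : set plane := `]-M, M[%classic `*` `]-M, M[%classic.

Lemma measurable_box M : measurable (box M).
Proof. by apply: measurableX; exact: measurable_itv. Qed.

Lemma area_box_fin M : (area (box M) < +oo)%E.
Proof.
have -> : area (box M) = ((pi : R)^-1%:E * (@lebesgue_measure R \x @lebesgue_measure R) (box M))%E by [].
rewrite product_measure1E; [|exact: measurable_itv..].
suff : ((pi : R)^-1%:E * (@lebesgue_measure R `](- M)%R, M[%classic *
    @lebesgue_measure R `](- M)%R, M[%classic) < +oo)%E by [].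
by rewrite !lebesgue_measure_itv /=; case: ifPn => _; rewrite ?mule0 -?EFinB -?EFinM ltry.
Qed.

Lemma box_out (M : R) (p : R * R) : ~ box M p -> M <= cabs (of_plane p).
Proof.
move=> nb; rewrite leNgt; apply/negP => h; apply: nb.
have h1 := le_lt_trans (cabs_Re (of_plane p)) h.
have h2 := le_lt_trans (cabs_Im (of_plane p)) h.
by split; rewrite /= in_itv /=; rewrite -ltr_norml.
Qed.

Lemma integrable_box M : area.-integrable setT (EFin \o (fun p : plane => M * \1_(box `|M|) p)).
Proof.
have mb := measurable_box `|M|.
apply/(@eq_integrable _ _ _ area setT _ (EFin \o (cst M \_ (box `|M|)))) => //.
  by move=> p _ /=; rewrite /patch indicE; case: ifPn => //=; rewrite ?mulr1 ?mulr0.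
rewrite -restrict_EFin; apply/integrable_restrict => //; rewrite setTI.
apply: measurable_bounded_integrable => //; first exact: area_box_fin.
exact: bounded_cst.
Qed.

Lemma bddsupp_integrable F : bddsupp F ->
  area.-integrable setT (EFin \o rpart F) /\ area.-integrable setT (EFin \o ipart F).
Proof.
move=> [[rF iF] [M HM]].
have M0 : 0 <= M by apply: le_trans (HM 0).1; exact: cabs_ge0.
(* Outside the box [box_out] gives only [M + 1 <= cabs]; the extra [1] makes this the strict
   inequality under which [F] vanishes. *)
have dom (p : plane) : cabs (F (of_plane p)) <= (M + 1) * \1_(box `|M + 1|) p.
  have [pb|/box_out] := pselect (box `|M + 1| p).
    rewrite indicE mem_set// mulr1; have := (HM (of_plane p)).1; lra.
  rewrite ger0_norm; last lra.
  move=> h; rewrite (HM (of_plane p)).2; last lra.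
  by rewrite cabs0 mulr_ge0//; lra.
split; apply: (le_integrable _ _ _ (integrable_box (M + 1))) => //.
- exact/measurable_EFinP.
- move=> p _ /=; rewrite lee_fin [leRHS]ger0_norm; last first.
    by apply: le_trans (dom p); exact: cabs_ge0.
  exact: le_trans (cabs_Re _) (dom p).
- exact/measurable_EFinP.
- move=> p _ /=; rewrite lee_fin [leRHS]ger0_norm; last first.
    by apply: le_trans (dom p); exact: cabs_ge0.
  exact: le_trans (cabs_Im _) (dom p).
Qed.

Definition plane_int F : R[i] := area_integral setT F.

Lemma plane_intE F : plane_int F = Complex (\int[area]_p rpart F p) (\int[area]_p ipart F p).
Proof. by rewrite /plane_int /area_integral preimage_setT. Qed.

Lemma plane_int_cut F : area_integral disk F = plane_int (cut 1 F).
Proof.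
rewrite plane_intE /area_integral; congr Complex; rewrite Rintegral_mkcond.
  apply: eq_Rintegral => p _; rewrite /rpart /cut /patch.
  case: ifPn => [|h]; first by rewrite inE /= diskE => ->.
  case: ifPn => // h'; move: h; rewrite mem_set//= diskE //.
apply: eq_Rintegral => p _; rewrite /ipart /cut /patch.
case: ifPn => [|h]; first by rewrite inE /= diskE => ->.
case: ifPn => // h'; move: h; rewrite mem_set//= diskE //.
Qed.

Lemma bddsuppD F G : bddsupp F -> bddsupp G -> bddsupp (fun z => F z + G z).
Proof.
move=> [mF [M HM]] [mG [N HN]]; split; first exact: cmeasurableD.
have M0 : 0 <= M by apply: le_trans (HM 0).1; exact: cabs_ge0.
have N0 : 0 <= N by apply: le_trans (HN 0).1; exact: cabs_ge0.
exists (M + N) => z; split.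
  by apply: (le_trans (cabsD _ _)); apply: lerD; [exact: (HM z).1|exact: (HN z).1].
by move=> h; rewrite (HM z).2 ?(HN z).2 ?addr0//; lra.
Qed.

Lemma bddsuppZ c F : bddsupp F -> bddsupp (fun z => c * F z).
Proof.
move=> [mF [M HM]]; split; first by apply: cmeasurableM => //; exact: cmeasurable_cst.
have M0 : 0 <= M by apply: le_trans (HM 0).1; exact: cabs_ge0.
exists ((cabs c + 1) * M) => z; have c0 := cabs_ge0 c; split.
  rewrite cabsM; apply: ler_pM; rewrite ?cabs_ge0//; [lra|exact: (HM z).1].
by move=> h; rewrite (HM z).2 ?mulr0//; nra.
Qed.

Lemma bddsuppM F G : bddsupp F -> cmeasurable G -> (exists N : R, forall z, cabs (G z) <= N) ->
  bddsupp (fun z => F z * G z).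
Proof.
move=> [mF [M HM]] mG [N HN]; split; first exact: cmeasurableM.
have M0 : 0 <= M by apply: le_trans (HM 0).1; exact: cabs_ge0.
have N0 : 0 <= N by apply: le_trans (HN 0); exact: cabs_ge0.
exists (M * (N + 1)) => z; split.
  rewrite cabsM; apply: ler_pM; rewrite ?cabs_ge0//; first exact: (HM z).1.
  by apply: (le_trans (HN z)); lra.
by move=> h; rewrite (HM z).2 ?mul0r//; nra.
Qed.

Lemma bddsupp_shift F a : bddsupp F -> bddsupp (fun z => F (z + a)).
Proof.
move=> [mF [M HM]]; split; first exact: cmeasurable_shift.
have a0 := cabs_ge0 a.
exists (M + cabs a) => z; split; first by have := (HM (z + a)).1; lra.
move=> h; apply: (HM (z + a)).2.
by have := cabsB (z + a) a; rewrite addrK; lra.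
Qed.

Lemma plane_int_D F G : bddsupp F -> bddsupp G -> plane_int (fun z => F z + G z) = plane_int F + plane_int G.
Proof.
move=> /bddsupp_integrable[rF iF] /bddsupp_integrable[rG iG]; rewrite !plane_intE.
transitivity (Complex (\int[area]_p (rpart F p + rpart G p)) (\int[area]_p (ipart F p + ipart G p))).
  by congr Complex; apply: eq_Rintegral => p _; rewrite /rpart /ipart ?ReD ?ImD.
by rewrite !RintegralD.
Qed.

Lemma plane_int_Z c F : bddsupp F -> plane_int (fun z => c * F z) = c * plane_int F.
Proof.
move=> /bddsupp_integrable[rF iF]; rewrite !plane_intE.
have iZ (k : R) (f : plane -> R) : area.-integrable setT (EFin \o f) ->
    area.-integrable setT (EFin \o (fun p => k * f p)).
  move=> hf; have := integrableZl measurableT k hf.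
  by apply: eq_integrable => // p _ /=; rewrite EFinM.
case: c => a b.
transitivity (Complex (\int[area]_p (a * rpart F p - b * ipart F p))
   (\int[area]_p (a * ipart F p + b * rpart F p))).
  by congr Complex; apply: eq_Rintegral => p _; rewrite /rpart /ipart; case: (F _).
rewrite RintegralB ?RintegralD//; try exact: iZ.
rewrite !RintegralZl//.
Qed.

(** The factor 2 comes from bounding real and imaginary parts separately. The later estimates
    exploit the linear dependence on [B]. *)
Lemma plane_int_bound F (M B : R) : cmeasurable F -> 0 < M -> (forall z, cabs (F z) <= B) ->
  (forall z, M < cabs z -> F z = 0) ->
  cabs (plane_int F) <= 2 * (B * fine (area (box (M + 1)))).
Proof.
move=> mF M0 FB FM.
have B0 : 0 <= B by apply: le_trans (FB 0); exact: cabs_ge0.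
have bF : bddsupp F.
  split=> //; exists (M + B) => z; split; first by have := FB z; lra.
  by move=> h; apply: FM; lra.
have [rF iF] := bddsupp_integrable bF.
have mb := measurable_box (M + 1).
have key (f : plane -> R) : area.-integrable setT (EFin \o f) ->
    (forall p, `|f p| <= cabs (F (of_plane p))) ->
    `|\int[area]_p f p| <= B * fine (area (box (M + 1))).
  move=> intf fF.
  have -> : \int[area]_p f p = \int[area]_(p in box (M + 1)) f p.
    rewrite [RHS]Rintegral_mkcond; apply: eq_Rintegral => p _; rewrite /patch.
    case: ifPn => // /negP h; apply/normr0_eq0/le_anti; rewrite normr_ge0 andbT.
    apply: (le_trans (fF p)); rewrite FM ?cabs0//.
    have /box_out : ~ box (M + 1) p by move=> hb; apply: h; rewrite inE.
    lra.
  have intb : area.-integrable (box (M + 1)) (EFin \o f).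
    exact: (integrableS measurableT).
  apply: (le_trans (le_normr_Rintegral _ intb)) => //.
  rewrite -Rintegral_cst//; apply: le_Rintegral => //.
  - exact: (integrable_norm intb).
  - apply: measurable_bounded_integrable => //; first exact: area_box_fin.
    exact: bounded_cst.
  - by move=> p _; apply: (le_trans (fF p)); exact: FB.
apply: (le_trans (cabs_ReIm _)); rewrite plane_intE /=.
rewrite mulr_natl mulr2n; apply: lerD; apply: key => // p.
  exact: cabs_Re.
exact: cabs_Im.
Qed.

Lemma plane_int_shift F a : bddsupp F -> plane_int (fun z => F (z + a)) = plane_int F.
Proof.
move=> bF; have [rF iF] := bddsupp_integrable bF.
have [rFa iFa] := bddsupp_integrable (bddsupp_shift a bF).
have mf : measurable_fun setT ((fun p : plane => (p.1 + complex.Re a, p.2 + complex.Im a)) : _ -> plane).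
  apply: measurable_fun_pair.
    by apply: measurable_funD => //; exact: measurable_fst.
  by apply: measurable_funD => //; exact: measurable_snd.
have key (f : plane -> R) : area.-integrable setT (EFin \o f) ->
   area.-integrable setT (EFin \o (f \o (fun p => (p.1 + complex.Re a, p.2 + complex.Im a)))) ->
   \int[area]_p f (p.1 + complex.Re a, p.2 + complex.Im a) = \int[area]_p f p.
  move=> intf intfa; rewrite /Rintegral; congr fine.
  have mff : measurable_fun [set: plane] (EFin \o f) by exact: (measurable_int area).
  have := integral_pushforward mf mff intfa measurableT.
  rewrite preimage_setT /= => <-.
  by apply: eq_measure_integral => A mA _; apply: (area_measure_shift (complex.Re a, complex.Im a)).
have E (p : plane) : of_plane p + a = of_plane (p.1 + complex.Re a, p.2 + complex.Im a).
  by case: (a).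
rewrite !plane_intE; congr Complex.
  rewrite -[RHS]key//; first by apply: eq_Rintegral => p _; rewrite /rpart E.
  by apply: eq_integrable rFa => // p _ /=; rewrite /rpart E.
rewrite -[RHS]key//; first by apply: eq_Rintegral => p _; rewrite /ipart E.
by apply: eq_integrable iFa => // p _ /=; rewrite /ipart E.
Qed.

End ComplexIntegral.

(** * Area of the disk and of the circle *)

Section DiskArea.
Context {R : realType}.
Local Notation plane := (measurableTypeR R * measurableTypeR R)%type.
Local Notation leb := (@lebesgue_measure R).
Local Notation area := (@area_measure R).
Local Notation mu2 := (@lebesgue_measure R \x @lebesgue_measure R)%E.

Lemma area_measureE (A : set plane) : area A = ((pi : R)^-1%:E * mu2 A)%E.
Proof. by []. Qed.

Definition circle : set plane := [set p : R * R | cabs (of_plane p) = 1].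

Lemma measurable_circle : measurable circle.
Proof.
have mf : measurable_fun setT ((fun p : plane => p.1 ^+ 2 + p.2 ^+ 2) : _ -> R).
  apply: measurable_funD; apply: measurable_funX; [exact: measurable_fst|exact: measurable_snd].
have -> : circle = setT `&` (fun p : plane => p.1 ^+ 2 + p.2 ^+ 2) @^-1` [set 1].
  rewrite setTI; apply/seteqP; split => p; rewrite /circle /=.
    by move=> h; have := cabs_sqr (of_plane p); rewrite h expr1n.
  move=> h; have := cabs_sqr (of_plane p); rewrite /= h => /eqP.
  by rewrite sqrf_eq1 => /orP[/eqP//|/eqP hN]; have := cabs_ge0 (of_plane p); rewrite hN oppr_ge0 ler10.
by apply: mf => //; exact: measurable_set1.
Qed.

(** Each vertical section has at most two points. The circle is the exceptional set of the
    convergence theorem below: functions cut at radius 1 may jump there. *)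
Lemma area_circle : area circle = 0%E.
Proof.
rewrite area_measureE (_ : mu2 circle = 0%E) ?mule0//.
rewrite /product_measure1 integral0_eq// => x _ /=.
apply: countable_lebesgue_measure0; apply: finite_set_countable.
apply: (@sub_finite_set _ _ [set Num.sqrt (1 - x ^+ 2); - Num.sqrt (1 - x ^+ 2)]); last first.
  by rewrite finite_setU; split; exact: finite_set1.
move=> y; rewrite /xsection /= inE /circle /= => h.
have := cabs_sqr (of_plane (x, y)); rewrite h expr1n /= => E.
have -> : 1 - x ^+ 2 = y ^+ 2 by rewrite E; ring.
rewrite sqrtr_sqr; have [y0|y0] := lerP 0 (y : R); first by left; rewrite ger0_norm.
by right; rewrite ltr0_norm// opprK.
Qed.

(** The substitution [x = sin t] on [[-pi/2, pi/2]] leads to the integrand [2 cos^2 t], with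
    primitive [t + sin t cos t]. *)
Lemma integral_half_circle :
  (\int[leb]_(x in `[(-1)%R, 1%R]) (2 * Num.sqrt (1 - x ^+ 2))%:E = (pi : R)%:E)%E.
Proof.
pose a : R := - (pi / 2); pose b : R := pi / 2.
have ab : a < b by have := pi_gt0 R; rewrite /a /b; lra.
pose G (x : R) : R := 2 * Num.sqrt (1 - x ^+ 2).
have cG : continuous G.
  move=> x; apply: cvgM; first exact: cvg_cst.
  apply: (continuous_comp (f := fun x : R => 1 - x ^+ 2)); last exact: sqrt_continuous.
  apply: cvgB; first exact: cvg_cst.
  exact: exprn_continuous.
have dsin (x : R) : derive1 sin x = cos x by rewrite derive1E; apply: derive_val.
have dsinE : derive1 sin = @cos R by apply/funext.
have sa : sin a = -1 :> R by rewrite /a sinN sin_pihalf.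
have sb : sin b = 1 :> R by rewrite /b sin_pihalf.
have := @integration_by_substitution_increasing R sin G a b (ltW ab).
rewrite sa sb dsinE => ->.
- pose F (t : R) := t + sin t * cos t.
  have dF (t : R) : is_derive t 1 F (2 * cos t ^+ 2).
    apply: (is_derive_eq (is_deriveD (is_derive_id t 1) (is_deriveM (is_derive_sin t) (is_derive_cos t)))).
    rewrite /GRing.scale /=; have := cos2Dsin2 t; lra.
  have E : (pi : R)%:E = (F b - F a)%:E.
    by rewrite /F /a /b sinN cosN cos_pihalf; congr EFin; field.
  rewrite E EFinB.
  rewrite -(@continuous_FTC2 R (fun t => 2 * cos t ^+ 2) F a b ab).
  + apply: eq_integral => t; rewrite inE /= in_itv /= => tab; congr EFin.
    rewrite -[LHS]/(2 * Num.sqrt (1 - sin t ^+ 2) * cos t) -cos2sin2 sqrtr_sqr ger0_norm; first by rewrite expr2 mulrA.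
    by apply: cos_ge0_pihalf.
  + apply: continuous_subspaceT => t; apply: cvgM; first exact: cvg_cst.
    apply: (continuous_comp (f := cos) (g := fun x => x ^+ 2)); first exact: continuous_cos.
    exact: exprn_continuous.
  + have cF (t : R) : {for t, continuous F}.
      by apply: differentiable_continuous; apply/derivable1_diffP; have [] := dF t.
    split.
    * by move=> t _; have [] := dF t.
    * by apply: cvg_at_right_filter; exact: cF.
    * by apply: cvg_at_left_filter; exact: cF.
  + by move=> t _; rewrite derive1E; apply: derive_val.
- move=> x y xab yab; rewrite ltr_sin//.
- by move=> x _; exact: continuous_cos.
- by apply/cvg_ex; exists (cos a); apply: cvg_at_right_filter; exact: continuous_cos.
- by apply/cvg_ex; exists (cos b); apply: cvg_at_left_filter; exact: continuous_cos.
- split.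
  + by move=> t _; exact: derivable_sin.
  + by apply: cvg_at_right_filter; exact: continuous_sin.
  + by apply: cvg_at_left_filter; exact: continuous_sin.
- exact: continuous_subspaceT.
Qed.

(** Vertical sections are intervals of half-length [Num.sqrt (1 - x ^+ 2)]. As [Num.sqrt] is 0 on
    negative numbers, the same formula gives the empty section when [|x| >= 1]. *)
Lemma area_disk : area (@of_plane R @^-1` disk) = 1%E.
Proof.
rewrite area_measureE (_ : mu2 _ = (pi : R)%:E); last first.
  rewrite /product_measure1 -integral_half_circle.
  rewrite [RHS]integral_mkcond; apply: eq_integral => x _ /=; rewrite /patch.
  have -> : xsection (@of_plane R @^-1` disk) x =
     `](- Num.sqrt (1 - x ^+ 2)), (Num.sqrt (1 - x ^+ 2))[%classic.
    apply/seteqP; split => y; rewrite /xsection /= inE /= diskE in_itv /= -ltr_norml.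
      rewrite cabs_def /= => h.
      have h1 : x ^+ 2 + y ^+ 2 < 1.
        rewrite -(ltr_sqrt (x ^+ 2 + y ^+ 2)) ?sqrtr1//.
      by rewrite -sqrtr_sqr ltr_sqrt; nra.
    move=> h; rewrite cabs_def /=.
    have h0 : 0 < Num.sqrt (1 - x ^+ 2) by apply: le_lt_trans h.
    have h1 : y ^+ 2 < 1 - x ^+ 2.
      by rewrite -(ltr_sqrt (y ^+ 2)) ?sqrtr_sqr// -sqrtr_gt0.
    by rewrite -[ltRHS]sqrtr1 ltr_sqrt//; lra.
  rewrite lebesgue_measure_itv /= lte_fin.
  case: ifPn => h.
    have h0 : 0 < Num.sqrt (1 - x ^+ 2) by lra.
    rewrite sqrtr_gt0 in h0.
    rewrite mem_set; first by rewrite -EFinB; congr EFin; ring.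
    by rewrite /= in_itv /=; apply/andP; split; nra.
  have h0 : Num.sqrt (1 - x ^+ 2) = 0.
    apply: le_anti; rewrite sqrtr_ge0 andbT; have := sqrtr_ge0 (1 - x ^+ 2); lra.
  by rewrite h0 mulr0; case: ifPn.
by rewrite -EFinM mulVf// gt_eqF// pi_gt0.
Qed.

End DiskArea.

Section BoundedConvergence.
Context {R : realType}.
Local Notation plane := (measurableTypeR R * measurableTypeR R)%type.
Local Notation area := (@area_measure R).
Implicit Types (F G : R[i] -> R[i]) (z w : R[i]).

Lemma plane_int_cut1 : plane_int (cut 1 (fun=> 1)) = 1 :> R[i].
Proof.
have mD : measurable (@of_plane R @^-1` disk : set plane).
  have -> : @of_plane R @^-1` disk = pball 1.
    by apply/seteqP; split => p; rewrite /pball /= diskE.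
  exact: measurable_pball.
rewrite -plane_int_cut /area_integral !Rintegral_cst// area_disk /= mul0r mul1r //.
Qed.

(** Dominated convergence against a multiple of the indicator of a square, applied to real and
    imaginary parts; the unit circle may be left out because it is a null set. *)
Lemma plane_int_cvg (Fn : nat -> R[i] -> R[i]) F (M : R) :
  (forall n, cmeasurable (Fn n)) -> cmeasurable F -> (forall n z, cabs (Fn n z) <= M) ->
  (forall n z, M < cabs z -> Fn n z = 0) ->
  (forall z, cabs z != 1 -> forall e : R, 0 < e ->
     exists N, forall n, (N <= n)%N -> cabs (Fn n z - F z) <= e) ->
  forall e : R, 0 < e -> exists N, forall n, (N <= n)%N -> cabs (plane_int (Fn n) - plane_int F) <= e.
Proof.
move=> mFn mF FnM FnS cF.
have M0 : 0 <= M by apply: le_trans (FnM 0%N 0); exact: cabs_ge0.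
have dom n (p : plane) : cabs (Fn n (of_plane p)) <= (M + 1) * \1_(box `|M + 1|) p.
  have [pb|/box_out] := pselect (box `|M + 1| p).
    rewrite indicE mem_set// mulr1; have := FnM n (of_plane p); lra.
  rewrite ger0_norm; last lra.
  move=> h; rewrite FnS; last lra.
  by rewrite cabs0 mulr_ge0//; lra.
have key (P : R[i] -> R) : (forall z w, `|P z - P w| <= cabs (z - w)) ->
   (forall z, `|P z| <= cabs z) ->
   (forall n, measurable_fun setT ((fun p => P (Fn n (of_plane p))) : plane -> R)) ->
   measurable_fun setT ((fun p => P (F (of_plane p))) : plane -> R) ->
   forall e : R, 0 < e -> exists N, forall n, (N <= n)%N ->
     `|\int[area]_p P (Fn n (of_plane p)) - \int[area]_p P (F (of_plane p))| <= e.
  move=> PL PB mPn mP e e0.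
  have [] := @dominated_convergence _ plane R area setT measurableT
     (fun n p => (P (Fn n (of_plane p)))%:E) (fun p => (P (F (of_plane p)))%:E)
     (EFin \o (fun p : plane => (M + 1) * \1_(box `|M + 1|) p)) _ _ _ (integrable_box (M + 1)) _.
  - by move=> n; apply/measurable_EFinP; exact: mPn.
  - by apply/measurable_EFinP; exact: mP.
  - exists circle; split; [exact: measurable_circle|exact: area_circle|].
    move=> p /=; apply: contra_notP => pc _.
    apply/cvg_EFin; first exact: nearW.
    apply/cvgrPdist_le => d d0.
    have [N HN] := cF (of_plane p) (introN eqP pc) d d0.
    exists N => // n /= Nn; rewrite distrC.
    exact: le_trans (PL _ _) (HN _ Nn).
  - apply: aeW => p n _ /=; rewrite lee_fin.
    exact: le_trans (PB _) (dom n p).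
  move=> intF _ cv.
  have fF : (\int[area]_p (P (F (of_plane p)))%:E)%E \is a fin_num.
    exact: integrable_fin_num.
  rewrite -(fineK fF) in cv.
  have := fine_cvg cv; move=> /(_ _)/cvgrPdist_le/(_ _ e0)[N _ HN].
  by exists N => n Nn; rewrite distrC; exact: HN.
move=> e e0.
have e20 : 0 < e / 2 by lra.
have kR : forall e : R, 0 < e -> exists N, forall n, (N <= n)%N ->
    `|\int[area]_p rpart (Fn n) p - \int[area]_p rpart F p| <= e.
  apply: key => [z w|z|n|]; rewrite ?cabs_Re//; first by rewrite -ReN -ReD cabs_Re.
    by have [] := mFn n.
  by have [] := mF.
have kI : forall e : R, 0 < e -> exists N, forall n, (N <= n)%N ->
    `|\int[area]_p ipart (Fn n) p - \int[area]_p ipart F p| <= e.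
  apply: key => [z w|z|n|]; rewrite ?cabs_Im//; first by rewrite -ImN -ImD cabs_Im.
    by have [] := mFn n.
  by have [] := mF.
have [N1 H1] := kR _ e20; have [N2 H2] := kI _ e20.
exists (maxn N1 N2) => n; rewrite geq_max => /andP[/H1 h1 /H2 h2].
apply: (le_trans (cabs_ReIm _)).
rewrite ReD ImD ReN ImN !plane_intE /=; lra.
Qed.

End BoundedConvergence.

(** * Vanishing of the Jacobian integral *)

Section Jacobian.
Context {R : realType}.
Implicit Types (z w v a b : R[i]) (f g W : R[i] -> R[i]).

Definition ccvg (u : nat -> R[i]) (l : R[i]) := forall e : R, 0 < e ->
  exists N, forall n, (N <= n)%N -> cabs (u n - l) <= e.

Lemma ccvgB u1 u2 l1 l2 : ccvg u1 l1 -> ccvg u2 l2 -> ccvg (fun n => u1 n - u2 n) (l1 - l2).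
Proof.
move=> c1 c2 e e0; have e20 : 0 < e / 2 by lra.
have [N1 H1] := c1 _ e20; have [N2 H2] := c2 _ e20.
exists (maxn N1 N2) => n; rewrite geq_max => /andP[/H1 h1 /H2 h2].
have -> : u1 n - u2 n - (l1 - l2) = (u1 n - l1) - (u2 n - l2) by ring.
apply: (le_trans (cabsB _ _)); lra.
Qed.

Lemma ccvgM u1 u2 l1 l2 : ccvg u1 l1 -> ccvg u2 l2 -> ccvg (fun n => u1 n * u2 n) (l1 * l2).
Proof.
move=> c1 c2 e e0.
have p1 := cabs_ge0 l1; have p2 := cabs_ge0 l2.
have K0 : 0 < cabs l1 + cabs l2 + 1 by lra.
have e10 : 0 < Num.min 1 (e / (cabs l1 + cabs l2 + 1)) by rewrite lt_min ltr01 divr_gt0.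
have [N1 H1] := c1 _ e10; have [N2 H2] := c2 _ e10.
exists (maxn N1 N2) => n; rewrite geq_max => /andP[/H1 + /H2].
rewrite !le_min => /andP[h1 h1'] /andP[h2 h2'].
have -> : u1 n * u2 n - l1 * l2 = (u1 n - l1) * (u2 n - l2) + ((u1 n - l1) * l2 + l1 * (u2 n - l2)).
  by ring.
apply: (le_trans (cabsD _ _)); rewrite cabsM.
apply: (le_trans (lerD (lexx _) (cabsD _ _))); rewrite !cabsM.
set x := cabs (u1 n - l1) in h1 h1' *; set y := cabs (u2 n - l2) in h2 h2' *.
have x0 : 0 <= x by exact: cabs_ge0.
have y0 : 0 <= y by exact: cabs_ge0.
have E : e = e / (cabs l1 + cabs l2 + 1) * (cabs l1 + cabs l2 + 1) by field; lra.
set t := e / _ in h1' h2' E.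
have q1 : x * y <= t by have : x * y <= x * 1 by [apply: ler_wpM2l]; lra.
have q2 : x * cabs l2 <= t * cabs l2 by apply: ler_wpM2r.
have q3 : cabs l1 * y <= cabs l1 * t by apply: ler_wpM2l.
rewrite E; lra.
Qed.

Lemma ccvg_eq u1 u2 l : (exists N, forall n, (N <= n)%N -> u1 n = u2 n) -> ccvg u1 l -> ccvg u2 l.
Proof.
move=> [N0 E] c1 e e0; have [N1 H1] := c1 _ e0.
exists (maxn N0 N1) => n; rewrite geq_max => /andP[/E <- /H1]//.
Qed.

Lemma ccvg_cst l : ccvg (fun=> l) l.
Proof. by move=> e e0; exists 0%N => n _; rewrite subrr cabs0 ltW. Qed.

Lemma small_inv (c d : R) : 0 < c -> 0 < d -> exists N, forall n, (N <= n)%N -> c / n.+1%:R < d.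
Proof.
move=> c0 d0; have [k] := ltr_add_invr (divr_gt0 d0 c0); rewrite add0r => hk.
exists k => n kn.
have h : n.+1%:R^-1 <= k.+1%:R^-1 :> R by rewrite lef_pV2 ?posrE ?ltr0n// ler_nat.
by rewrite mulrC -ltr_pdivlMr//; apply: le_lt_trans hk.
Qed.

Lemma wder_ccvg f z a b v (c : R) : 0 < c -> wder f z a b ->
  ccvg (fun n => ((c / n.+1%:R)^-1)%:C%C * (f (z + (c / n.+1%:R)%:C%C * v) - f z))
    (a * v + b * conjc v).
Proof.
move=> c0 df e e0.
have v0 : 0 < cabs v + 1 by have := cabs_ge0 v; lra.
have [r r0 H] := df _ (divr_gt0 e0 v0).
have [N HN] := small_inv c0 (divr_gt0 r0 v0).
exists N => n /HN; rewrite ltr_pdivlMr//.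
set h := c / n.+1%:R => hr.
have h0 : 0 < h by rewrite /h divr_gt0.
have hv : cabs (h%:C%C * v) < r.
  rewrite cabsM cabsR gtr0_norm//; apply: le_lt_trans hr; apply: ler_wpM2l; [exact: ltW|lra].
have hC : h%:C%C != 0 by rewrite eq_complex /= eqxx andbT gt_eqF.
have -> : (h^-1)%:C%C * (f (z + h%:C%C * v) - f z) - (a * v + b * conjc v) =
   (h^-1)%:C%C * (f (z + h%:C%C * v) - f z - (a * (h%:C%C * v) + b * conjc (h%:C%C * v))).
  by rewrite conjcM conjc_real fmorphV; field.
rewrite cabsM cabsR gtr0_norm ?invr_gt0// mulrC ler_pdivrMr//.
apply: (le_trans (H _ hv)); rewrite cabsM cabsR gtr0_norm//.
have -> : e * h = e / (cabs v + 1) * (h * (cabs v + 1)) by field; lra.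
apply: ler_wpM2l; first by rewrite divr_ge0// ltW.
apply: ler_wpM2l; [exact: ltW|lra].
Qed.

Lemma cmeasurable_cutm (r : R) F : cmeasurable F -> cmeasurable (cut r F : R[i] -> R[i]).
Proof.
move=> mF; have -> : cut r F = (fun z => F z * cut r (fun=> 1) z).
  by apply/funext => z; rewrite /cut; case: ifP; rewrite ?mulr1 ?mulr0.
apply: cmeasurableM => //; apply: cmeasurable_cut => z _.
exact: wder_ccont (wder_cst 1 z).
Qed.

Lemma lip_ccont f z (r K : R) : cabs z < r ->
  (forall w w', cabs w < r -> cabs w' < r -> cabs (f w - f w') <= K * cabs (w - w')) ->
  ccont f z.
Proof.
move=> zr H e e0.
exists (Num.min (r - cabs z) (e / (`|K| + 1))).
  by rewrite lt_min subr_gt0 zr divr_gt0// ltr_wpDl.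
move=> h; rewrite lt_min => /andP[h1 h2].
have := H (z + h) z _ zr => /(_ _)/le_trans; apply.
  by apply: (le_lt_trans (cabsD _ _)); lra.
rewrite addrC addKr; rewrite ltr_pdivlMr in h2; last by rewrite ltr_wpDl.
have : K * cabs h <= (`|K| + 1) * cabs h.
  by rewrite ler_wpM2r ?cabs_ge0//; have := ler_norm K; lra.
lra.
Qed.

Lemma lip_cut_bddsupp f (r K : R) : 0 < r ->
  (forall w w', cabs w < r -> cabs w' < r -> cabs (f w - f w') <= K * cabs (w - w')) ->
  bddsupp (cut r f).
Proof.
move=> r0 H; split; first by apply: cmeasurable_cut => z zr; exact: lip_ccont zr H.
exists (cabs (f 0) + `|K| * r + r) => z.
have n0 := normr_ge0 K; have f0 := cabs_ge0 (f 0).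
have B0 : 0 <= `|K| * r by rewrite mulr_ge0// ltW.
split; rewrite /cut; case: ifPn => // zr; last 2 first.
- by rewrite cabs0; lra.
- by move=> h; exfalso; lra.
have := H z 0 zr; rewrite cabs0 subr0 => /(_ r0) h.
have := cabsD (f z - f 0) (f 0); rewrite subrK.
have : K * cabs z <= `|K| * r.
  by apply: le_trans (ler_wpM2r (cabs_ge0 z) (ler_norm K)) _; apply: ler_wpM2l => //; exact: ltW.
lra.
Qed.

(* Summation by parts: both sides expand into the same four terms up to
   translations. *)
Lemma plane_int_diff_swap g W a b : bddsupp g -> bddsupp W ->
  plane_int (fun z => (g (z + a) - g z) * (W (z + b) - W z)) =
  plane_int (fun z => (g (z - b) - g z) * (W (z - a) - W z)).
Proof.
move=> bg bW.
have P F G : bddsupp F -> bddsupp G -> bddsupp (fun z => F z * G z).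
  move=> bF [mG [M HM]]; apply: bddsuppM => //; exists M => z; exact: (HM z).1.
have exp (c d : R[i]) : plane_int (fun z => (g (z + c) - g z) * (W (z + d) - W z)) =
   plane_int (fun z => g (z + c) * W (z + d)) - plane_int (fun z => g (z + c) * W z)
   - plane_int (fun z => g z * W (z + d)) + plane_int (fun z => g z * W z).
  have b1 := P _ _ (bddsupp_shift c bg) (bddsupp_shift d bW).
  have b2 := P _ _ (bddsupp_shift c bg) bW.
  have b3 := P _ _ bg (bddsupp_shift d bW).
  have b4 := P _ _ bg bW.
  rewrite -(mulN1r (plane_int (fun z => g (z + c) * W z))) -(mulN1r (plane_int (fun z => g z * W (z + d)))).
  rewrite -!plane_int_Z// -!plane_int_D//; try by do ?[exact: bddsuppZ|apply: bddsuppD].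
  by congr plane_int; apply/funext => z; ring.
rewrite !exp.
rewrite (_ : plane_int (fun z => g (z + a) * W (z + b)) = plane_int (fun z => g (z - b) * W (z - a))); last first.
  rewrite -(plane_int_shift (a + b) (P _ _ (bddsupp_shift (- b) bg) (bddsupp_shift (- a) bW))).
  by congr plane_int; apply/funext => z; congr (g _ * W _); ring.
rewrite (_ : plane_int (fun z => g (z + a) * W z) = plane_int (fun z => g z * W (z - a))); last first.
  rewrite -(plane_int_shift a (P _ _ bg (bddsupp_shift (- a) bW))).
  by congr plane_int; apply/funext => z; congr (g _ * W _); ring.
rewrite (_ : plane_int (fun z => g z * W (z + b)) = plane_int (fun z => g (z - b) * W z)); last first.
  rewrite -(plane_int_shift b (P _ _ (bddsupp_shift (- b) bg) bW)).
  by congr plane_int; apply/funext => z; congr (g _ * W _); ring.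
by ring.
Qed.

(** The discrete Jacobian takes forward differences in its first product and backward differences in
    its second, so that [plane_int_diff_swap] makes its integral exactly 0 at every step size. The
    Lipschitz constants dominate the quotients, and pointwise differentiability identifies the
    limit. *)
Lemma jacobian_integral g W (gz gw Wz Ww : R[i] -> R[i]) (eta L K : R) : 0 < eta ->
  (forall z w, cabs z < 1 + eta -> cabs w < 1 + eta -> cabs (g z - g w) <= L * cabs (z - w)) ->
  (forall z w, cabs (W z - W w) <= K * cabs (z - w)) ->
  (forall z, 1 <= cabs z -> W z = 0) ->
  (forall z, cabs z < 1 -> wder g z (gz z) (gw z)) ->
  (forall z, cabs z < 1 -> wder W z (Wz z) (Ww z)) ->
  plane_int (cut 1 (fun z => gz z * Ww z - gw z * Wz z)) = 0.
Proof.
move=> eta0 gL WL W0 dg dW.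
have r0 : 0 < 1 + eta by lra.
have L0 : 0 <= L.
  have := gL 1 0; rewrite cabs1 cabs0 subr0 cabs1 mulr1 => /(_ _ _)/(le_trans (cabs_ge0 _)).
  by apply; lra.
have K0 : 0 <= K.
  by have := WL 1 0; rewrite subr0 cabs1 mulr1; apply: le_trans; exact: cabs_ge0.
(* The cut at the larger radius gives bounded support without affecting [g] at the points reached
   from the disk by small translations. *)
pose g0 := cut (1 + eta) g.
have bg : bddsupp g0 by exact: lip_cut_bddsupp gL.
have bW : bddsupp W.
  have -> : W = cut 2 W.
    apply/funext => z; rewrite /cut; case: ifPn => //; rewrite -leNgt => h.
    by apply: W0; lra.
  by apply: (@lip_cut_bddsupp _ _ K) => // *; exact: WL.
(* With [c <= eta / 4] the points within a step of the disk of radius [1 + h n] stay in the domain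
   of the Lipschitz bound on [g]; with [c <= 1 / 4] the supports stay within radius 2. *)
have [c [c0 c1 ce]] : exists c : R, [/\ 0 < c, c <= 4^-1 & c <= eta / 4].
  have [h|h] := lerP 1 eta; first by exists 4^-1; split=> //; lra.
  by exists (eta / 4); split; lra.
pose h n : R := c / n.+1%:R.
have h0 n : 0 < h n by rewrite /h divr_gt0.
have hc n : h n <= c.
  by rewrite /h ler_pdivrMr// ler_peMr ?ler1n//; exact: ltW.
pose hx n : R[i] := (h n)%:C%C.
pose hy n : R[i] := (h n)%:C%C * 'i%C.
have ci : cabs ('i%C : R[i]) = 1.
  by rewrite cabs_def /= expr0n expr1n /= add0r sqrtr1.
have chx n : cabs (hx n) = h n by rewrite cabsR gtr0_norm.
have chy n : cabs (hy n) = h n by rewrite cabsM ci mulr1 chx.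
pose s n : R[i] := ((h n)^-1)%:C%C.
pose D a b z := (g0 (z + a) - g0 z) * (W (z + b) - W z).
pose F n z := s n * s n * (D (hx n) (hy n) z - D (- hy n) (- hx n) z).
have bD a b : bddsupp (D a b).
  have P F1 F2 : bddsupp F1 -> bddsupp F2 -> bddsupp (fun z => F1 z * F2 z).
    move=> bF [mG [M HM]]; apply: bddsuppM => //; exists M => z; exact: (HM z).1.
  have B F1 F2 : bddsupp F1 -> bddsupp F2 -> bddsupp (fun z => F1 z - F2 z).
    move=> b1 b2; have -> : (fun z => F1 z - F2 z) = (fun z => F1 z + (-1) * F2 z).
      by apply/funext => z; rewrite mulN1r.
    by apply: bddsuppD => //; exact: bddsuppZ.
  by apply: P; apply: B => //; exact: bddsupp_shift.
have D00 n a b z : cabs a = h n -> cabs b = h n -> 1 + h n <= cabs z -> D a b z = 0.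
  move=> ca cb hz; rewrite /D (W0 z) ?(W0 (z + b)) ?subrr ?mulr0//.
    by have := cabsB (z + b) b; rewrite addrK cb; lra.
  by have := h0 n; lra.
have DK n a b z : cabs a = h n -> cabs b = h n -> cabs (D a b z) <= L * K * (h n * h n).
  move=> ca cb; have hn := h0 n; have hn' := hc n.
  have [hz|hz] := lerP (1 + h n) (cabs z).
    rewrite (D00 n)// cabs0 mulr_ge0 ?mulr_ge0// ltW//.
  have za : cabs (z + a) < 1 + eta by apply: (le_lt_trans (cabsD _ _)); rewrite ca; lra.
  have zz : cabs z < 1 + eta by lra.
  rewrite /D /g0 /cut za zz cabsM.
  have -> : L * K * (h n * h n) = (L * h n) * (K * h n) by ring.
  apply: ler_pM; rewrite ?cabs_ge0//.
    by apply: (le_trans (gL _ _ za zz)); rewrite addrC addKr ca.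
  by apply: (le_trans (WL _ _)); rewrite addrC addKr cb.
have PF n : plane_int (F n) = 0.
  have -> : F n = (fun z => s n * s n * D (hx n) (hy n) z +
      (- (s n * s n)) * D (- hy n) (- hx n) z).
    by apply/funext => z; rewrite /F mulrBr mulNr.
  rewrite plane_int_D ?plane_int_Z//; try exact: bddsuppZ.
  by rewrite /D (plane_int_diff_swap _ _ bg bW) mulNr subrr.
(* The directions [1] and [i] come from the forward product, [- i] and [- 1] from the backward
   one. *)
pose F0 := cut 1 (fun z => (gz z * 1 + gw z * conjc 1) * (Wz z * 'i%C + Ww z * conjc 'i%C)
   - (gz z * - 'i%C + gw z * conjc (- 'i%C)) * (Wz z * - 1 + Ww z * conjc (- 1))).
have FF z : cabs z != 1 -> ccvg (fun n => F n z) (F0 z).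
  rewrite neq_lt => /orP[z1|z1].
    have dg0 : wder g0 z (gz z) (gw z).
      apply: (wder_ext (f := g) (r := 1 - cabs z)); last exact: dg.
        by rewrite subr_gt0.
      move=> w hw; rewrite /g0 /cut ifT//.
      by have := cabsD (w - z) z; rewrite subrK; lra.
    rewrite /F0 /cut z1.
    have C := ccvgB (ccvgM (wder_ccvg 1 c0 dg0) (wder_ccvg 'i%C c0 (dW _ z1)))
       (ccvgM (wder_ccvg (- 'i%C) c0 dg0) (wder_ccvg (- 1) c0 (dW _ z1))).
    apply: ccvg_eq C; exists 0%N => n _.
    rewrite /F /D /s /hx /hy /h -!(mulrN _ 'i%C) mulr1 mulrN1; ring.
  (* Outside the closed disk the quotients vanish as soon as [1 + h n <= |z|]. *)
  rewrite /F0 /cut ltNge (ltW z1) /=.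
  have z0 : 0 < cabs z - 1 by lra.
  have [N HN] := small_inv c0 z0.
  apply: ccvg_eq (ccvg_cst 0); exists N => n /HN hn.
  by rewrite -/(h n) in hn; rewrite /F !(D00 n) ?subrr ?mulr0 ?cabsN//; lra.
have Fm n : cmeasurable (F n).
  have [mD1 _] := bD (hx n) (hy n); have [mD2 _] := bD (- hy n) (- hx n).
  have -> : F n = (fun z => s n * s n * (D (hx n) (hy n) z + (-1) * D (- hy n) (- hx n) z)).
    by apply/funext => z; rewrite /F mulN1r.
  apply: cmeasurableM; first exact: cmeasurable_cst.
  by apply: cmeasurableD => //; apply: cmeasurableM => //; exact: cmeasurable_cst.
have F0m : cmeasurable F0.
  apply: (@cmeasurable_cvg _ (fun n => cut 1 (F n))) => [n|z]; first exact: cmeasurable_cutm.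
  rewrite /cut; have [z1|z1] := ltP (cabs z) 1.
    by have := FF z; rewrite /F0 /cut z1; apply; rewrite lt_eqF.
  by move=> e e0; exists 0%N => n _; rewrite /F0 /cut ltNge z1 /= subrr cabs0 ltW.
have FK n z : cabs (F n z) <= 2 * (L * K).
  rewrite /F !cabsM -mulrA; have hn := h0 n.
  have -> : cabs (s n) = (h n)^-1 by rewrite cabsR gtr0_norm ?invr_gt0.
  have d1 : cabs (D (hx n) (hy n) z) <= L * K * (h n * h n) by exact: DK.
  have d2 : cabs (D (- hy n) (- hx n) z) <= L * K * (h n * h n) by apply: DK; rewrite cabsN.
  rewrite mulrA -invfM ler_pdivrMl ?mulr_gt0//.
  by apply: (le_trans (cabsB _ _)); lra.
have FS n z : 2 < cabs z -> F n z = 0.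
  move=> z2; have hn := hc n.
  by rewrite /F !(D00 n) ?subrr ?mulr0 ?cabsN//; lra.
(* Large enough to serve both as the bound [2 L K] and as the support radius 2. *)
pose M := 2 * (L * K) + 2.
have LK0 : 0 <= L * K by exact: mulr_ge0.
have P0 : plane_int F0 = 0.
  apply/eqP; rewrite -cabs_eq0; apply/eqP/le_anti; rewrite cabs_ge0 andbT.
  apply/ler_addgt0Pl => e e0; rewrite addr0.
  have [||N HN] := @plane_int_cvg _ F F0 M Fm F0m _ _ FF e e0.
  - by move=> n z; apply: (le_trans (FK n z)); rewrite /M; lra.
  - by move=> n z hz; apply: FS; move: hz; rewrite /M; lra.
  - by have := HN N (leqnn _); rewrite PF sub0r cabsN.
have F0b : bddsupp F0.
  split=> //; exists (2 * (L * K) + 2) => z; split.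
    have [z1|z1] := ltP (cabs z) 1; last by rewrite /F0 /cut ltNge z1 /= cabs0; lra.
    have [N HN] := FF z (negbT (lt_eqF z1)) 1 ltr01.
    have := HN N (leqnn _); have := FK N z; have := cabsB (F N z) (F N z - F0 z).
    by rewrite opprB addrC subrK; lra.
  by move=> hz; rewrite /F0 /cut ifF//; apply/negbTE; rewrite -leNgt; lra.
have i2 : ('i%C : R[i]) * 'i%C = -1 by rewrite -expr2 sqr_i.
have ic : conjc ('i%C : R[i]) = - 'i%C by simpc.
(* The real Jacobian is [- 2 i] times the Wirtinger expression. *)
have -> : cut 1 (fun z => gz z * Ww z - gw z * Wz z) = (fun z => ('i%C / 2) * F0 z).
  apply/funext => z; rewrite /F0 /cut; case: ifP => _; last by rewrite mulr0.
  rewrite !conjcN conjc1 ic.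
  have -> : 'i%C / 2 * ((gz z * 1 + gw z * 1) * (Wz z * 'i%C + Ww z * - 'i%C) -
     (gz z * - 'i%C + gw z * - - 'i%C) * (Wz z * -1 + Ww z * -1)) =
     ('i%C * 'i%C) * (gw z * Wz z - gz z * Ww z) by field.
  by rewrite i2; ring.
by rewrite plane_int_Z// P0 mulr0.
Qed.

End Jacobian.

(** * Bounded Lipschitz functions and the weighted Jacobian integral *)

Section BoundedLipschitz.
Context {R : realType}.
Implicit Types (z w v a b : R[i]) (f g F G B : R[i] -> R[i]).

(** The sup bound is carried with the Lipschitz bound so that the class is closed under products. *)
Definition bddlip F := exists2 M : R, 0 <= M & forall z w, cabs z < 1 -> cabs w < 1 ->
  cabs (F z) <= M /\ cabs (F z - F w) <= M * cabs (z - w).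

Lemma bddlip_cst c : bddlip (fun=> c).
Proof.
exists (cabs c); first exact: cabs_ge0.
by move=> z w _ _; split => //; rewrite subrr cabs0 mulr_ge0 ?cabs_ge0.
Qed.

Lemma bddlip_id : bddlip id.
Proof. by exists 1 => // z w z1 _; split; [exact: ltW|rewrite mul1r]. Qed.

Lemma bddlip_conj F : bddlip F -> bddlip (fun w => conjc (F w)).
Proof.
by move=> [M M0 H]; exists M => // z w z1 w1; rewrite -conjcB !cabsJ; exact: H.
Qed.

Lemma bddlipD F G : bddlip F -> bddlip G -> bddlip (fun w => F w + G w).
Proof.
move=> [M M0 H] [N N0 K]; exists (M + N); first lra.
move=> z w z1 w1; have [h1 h2] := H _ _ z1 w1; have [k1 k2] := K _ _ z1 w1; split.
  by apply: (le_trans (cabsD _ _)); lra.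
have -> : F z + G z - (F w + G w) = (F z - F w) + (G z - G w) by ring.
by apply: (le_trans (cabsD _ _)); lra.
Qed.

Lemma bddlipM F G : bddlip F -> bddlip G -> bddlip (fun w => F w * G w).
Proof.
move=> [M M0 H] [N N0 K]; exists (2 * M * N); first by rewrite !mulr_ge0.
move=> z w z1 w1; have [h1 h2] := H _ _ z1 w1; have [k1 k2] := K _ _ z1 w1.
have [h3 _] := H _ _ w1 z1.
have c1 := cabs_ge0 (F z); have c2 := cabs_ge0 (G z); have c3 := cabs_ge0 (F w).
split.
  have : cabs (F z) * cabs (G z) <= M * N by exact: ler_pM.
  have : 0 <= M * N by exact: mulr_ge0.
  by rewrite cabsM; lra.
have -> : F z * G z - F w * G w = (F z - F w) * G z + F w * (G z - G w) by ring.
apply: (le_trans (cabsD _ _)); rewrite !cabsM.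
have : cabs (F z - F w) * cabs (G z) <= (M * cabs (z - w)) * N.
  by apply: ler_pM => //; exact: cabs_ge0.
have : cabs (F w) * cabs (G z - G w) <= M * (N * cabs (z - w)).
  by apply: ler_pM => //; exact: cabs_ge0.
lra.
Qed.

Lemma bddlipN F : bddlip F -> bddlip (fun w => - F w).
Proof.
move=> bF; have -> : (fun w => - F w) = (fun w => -1 * F w).
  by apply/funext => w; rewrite mulN1r.
by apply: bddlipM => //; exact: bddlip_cst.
Qed.

Lemma bddlipB F G : bddlip F -> bddlip G -> bddlip (fun w => F w - G w).
Proof. by move=> bF bG; apply: bddlipD => //; exact: bddlipN. Qed.

Lemma bddlipX F n : bddlip F -> bddlip (fun w => F w ^+ n).
Proof.
move=> bF; elim: n => [|n IH].
  have -> : (fun w => F w ^+ 0) = (fun=> 1) by apply/funext => w; rewrite expr0.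
  exact: bddlip_cst.
have -> : (fun w => F w ^+ n.+1) = (fun w => F w * F w ^+ n).
  by apply/funext => w; rewrite exprS.
exact: bddlipM.
Qed.

Lemma bddlipV F (d : R) : 0 < d -> (forall z, cabs z < 1 -> d <= cabs (F z)) ->
  bddlip F -> bddlip (fun w => (F w)^-1).
Proof.
move=> d0 Fd [M M0 H]; exists (d^-1 + M / d ^+ 2).
  by rewrite addr_ge0 ?divr_ge0 ?invr_ge0 ?sqr_ge0// ltW.
have dM : 0 <= M / d ^+ 2 by rewrite divr_ge0 ?sqr_ge0.
have di : 0 <= d^-1 by rewrite invr_ge0 ltW.
move=> z w z1 w1; have [_ h2] := H _ _ z1 w1.
have Fz := Fd _ z1; have Fw := Fd _ w1; split.
  rewrite cabsV; have : (cabs (F z))^-1 <= d^-1 by rewrite lef_pV2 ?posrE//; lra.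
  lra.
have z0 : F z != 0 by rewrite -cabs_gt0; lra.
have w0 : F w != 0 by rewrite -cabs_gt0; lra.
have -> : (F z)^-1 - (F w)^-1 = - ((F z - F w) / (F z * F w)) by field; rewrite w0.
rewrite cabsN cabsM cabsV cabsM.
have p : d ^+ 2 <= cabs (F z) * cabs (F w) by rewrite expr2; apply: ler_pM => //; exact: ltW.
have p2 : (cabs (F z) * cabs (F w))^-1 <= (d ^+ 2)^-1.
  by rewrite lef_pV2 ?posrE ?exprn_gt0//; apply: lt_le_trans p; rewrite exprn_gt0.
have : cabs (F z - F w) / (cabs (F z) * cabs (F w)) <= (M * cabs (z - w)) / d ^+ 2.
  apply: ler_pM => //; first exact: cabs_ge0.
  by rewrite invr_ge0 mulr_ge0 ?cabs_ge0.
move=> /le_trans; apply.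
have : 0 <= d^-1 * cabs (z - w) by rewrite mulr_ge0 ?cabs_ge0.
by rewrite mulrDl; lra.
Qed.

Lemma disk_convex z w (t : R) (r : R) : 0 <= t <= 1 -> cabs z < r -> cabs w < r ->
  cabs (z + t%:C%C * (w - z)) < r.
Proof.
move=> /andP[t0 t1] hz hw.
have -> : z + t%:C%C * (w - z) = (1 - t)%:C%C * z + t%:C%C * w by rewrite rmorphB rmorph1; ring.
apply: (le_lt_trans (cabsD _ _)); rewrite !cabsM !cabsR !ger0_norm//; last lra.
have [t'|t'] := lerP t (1/2).
  have : (1 - t) * cabs z < (1 - t) * r by rewrite ltr_pM2l//; lra.
  have : t * cabs w <= t * r by apply: ler_wpM2l => //; exact: ltW.
  lra.
have : (1 - t) * cabs z <= (1 - t) * r by apply: ler_wpM2l; [lra|exact: ltW].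
have : t * cabs w < t * r by rewrite ltr_pM2l//; lra.
lra.
Qed.

Lemma cder_lip f f' (M r : R) : (forall z, cabs z < r -> cder f z (f' z)) ->
  (forall z, cabs z < r -> cabs (f' z) <= M) ->
  forall z w, cabs z < r -> cabs w < r -> cabs (f z - f w) <= M * cabs (z - w).
Proof.
move=> df f'M z w z1 w1; rewrite cabsBC (cabsBC z).
have [|t t01] := @wder_mvt R f f' (fun=> 0) z w.
  by move=> t t01; apply: df; exact: disk_convex.
rewrite cabs0 addr0 => /le_trans; apply; apply: ler_wpM2r; first exact: cabs_ge0.
by apply: f'M; exact: disk_convex.
Qed.

Lemma cder_bddlip f f' (M : R) : (forall z, cabs z < 1 -> cder f z (f' z)) ->
  (forall z, cabs z < 1 -> cabs (f' z) <= M) -> bddlip f.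
Proof.
move=> df f'M.
have c0 : cabs (0 : R[i]) < 1 by rewrite cabs0.
have M0 : 0 <= M by apply: le_trans (f'M 0 c0); exact: cabs_ge0.
have f0 := cabs_ge0 (f 0).
exists (cabs (f 0) + M); first lra.
move=> z w z1 w1; split.
  have := cder_lip df f'M z1 c0; rewrite subr0.
  have := cabsD (f z - f 0) (f 0); rewrite subrK.
  have : M * cabs z <= M * 1 by apply: ler_wpM2l => //; exact: ltW.
  lra.
have := cder_lip df f'M z1 w1.
have : 0 <= cabs (f 0) * cabs (z - w) by rewrite mulr_ge0 ?cabs_ge0.
by rewrite mulrDl; lra.
Qed.

Lemma bddlip_bddsupp F : bddlip F -> bddsupp (cut 1 F).
Proof.
move=> [M M0 H]; apply: (@lip_cut_bddsupp _ _ _ M) => // z w z1 w1.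
by have [] := H _ _ z1 w1.
Qed.

(** This is [1 - |z|^2], a polynomial in [z] and its conjugate that vanishes on the unit circle. *)
Definition weight z : R[i] := 1 - z * conjc z.

Lemma weighted_lip B : bddlip B -> exists K : R,
  forall z w, cabs (cut 1 (fun z => weight z * B z) z - cut 1 (fun z => weight z * B z) w)
    <= K * cabs (z - w).
Proof.
(* Inside the disk [3 = 1 + 2]: the weight is at most 1 and is 2-Lipschitz there. *)
move=> [M M0 H]; exists (3 * M).
have wE z : weight z = (1 - cabs z ^+ 2)%:C%C by rewrite /weight mulcJ rmorphB rmorph1.
(* Across the circle, [1 - |z|^2 <= 2 (1 - |z|) <= 2 |z - w|]. *)
have out z w : cabs z < 1 -> 1 <= cabs w -> cabs (weight z * B z) <= 3 * M * cabs (z - w).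
  move=> z1 w1; have [h1 _] := H _ _ z1 z1; have z0 := cabs_ge0 z.
  rewrite cabsM wE cabsR ger0_norm; last by nra.
  have h2 : 1 - cabs z ^+ 2 <= 2 * cabs (z - w).
    have := cabs_dist z w; rewrite ler_norml => /andP[h _].
    have : 0 <= (1 - cabs z) ^+ 2 by exact: sqr_ge0.
    by rewrite !expr2; nra.
  have : (1 - cabs z ^+ 2) * cabs (B z) <= (2 * cabs (z - w)) * M.
    by apply: ler_pM => //; [nra|exact: cabs_ge0].
  have : 0 <= M * cabs (z - w) by rewrite mulr_ge0 ?cabs_ge0.
  lra.
move=> z w; rewrite /cut; case: ifPn => [z1|]; case: ifPn => [w1|].
- have [h1 h2] := H _ _ z1 w1; have [h3 _] := H _ _ w1 z1.
  have z0 := cabs_ge0 z; have w0 := cabs_ge0 w.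
  have -> : weight z * B z - weight w * B w =
     weight z * (B z - B w) + (weight z - weight w) * B w by ring.
  apply: (le_trans (cabsD _ _)); rewrite !cabsM.
  have p1 : cabs (weight z) <= 1.
    by rewrite wE cabsR ger0_norm; nra.
  have p2 : cabs (weight z - weight w) <= 2 * cabs (z - w).
    rewrite !wE -rmorphB cabsR.
    have -> : 1 - cabs z ^+ 2 - (1 - cabs w ^+ 2) = - ((cabs z - cabs w) * (cabs z + cabs w)) by ring.
    rewrite normrN normrM mulrC; apply: ler_pM => //; last exact: cabs_dist.
    by rewrite ger0_norm; lra.
  have : cabs (weight z) * cabs (B z - B w) <= 1 * (M * cabs (z - w)).
    by apply: ler_pM => //; exact: cabs_ge0.
  have : cabs (weight z - weight w) * cabs (B w) <= (2 * cabs (z - w)) * M.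
    by apply: ler_pM => //; exact: cabs_ge0.
  lra.
- by rewrite -leNgt subr0 => w1; exact: out.
- by rewrite -leNgt sub0r cabsN cabsBC => z1; exact: out.
- by rewrite subrr cabs0 !mulr_ge0 ?cabs_ge0.
Qed.

Lemma wder_cut F z a b : cabs z < 1 -> wder F z a b -> wder (cut 1 F) z a b.
Proof.
move=> z1; apply: (wder_ext (r := 1 - cabs z)); first by rewrite subr_gt0.
move=> w hw; rewrite /cut ifT//.
by have := cabsD (w - z) z; rewrite subrK; lra.
Qed.

Lemma wder_weight z : wder weight z (- conjc z) (- z).
Proof.
have -> : weight = (fun z => 1 + -1 * (z * conjc z)).
  by apply/funext => w; rewrite /weight mulN1r.
apply: wder_eq (wder_add (wder_cst 1 z) (wder_scale (-1) (wder_mul (wder_id z) (wder_conj z)))) _ _;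
  ring.
Qed.

(** Used twice: with [B = kern z] and [g] a dilated analytic function for the reproducing formula,
    and with [B = G kern^2] and [g] the conjugation for the Toeplitz operator. *)
Lemma weighted_integral g gz gw B Bz Bw (eta L : R) : 0 < eta ->
  (forall z w, cabs z < 1 + eta -> cabs w < 1 + eta -> cabs (g z - g w) <= L * cabs (z - w)) ->
  (forall z, cabs z < 1 -> wder g z (gz z) (gw z)) ->
  bddlip B -> (forall z, cabs z < 1 -> wder B z (Bz z) (Bw z)) ->
  plane_int (cut 1 (fun z => gz z * (- z * B z + weight z * Bw z)
    - gw z * (- conjc z * B z + weight z * Bz z))) = 0.
Proof.
move=> eta0 gL dg bB dB; have [K WL] := weighted_lip bB.
apply: (jacobian_integral eta0 gL WL _ dg) => [z z1|z z1].
  by rewrite /cut ltNge z1.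
by apply: wder_cut => //; apply: wder_mul; [exact: wder_weight|exact: dB].
Qed.

End BoundedLipschitz.

(** * The Bergman reproducing formula *)

Section Reproducing.
Context {R : realType}.
Implicit Types (z w v a b : R[i]) (f g F G B : R[i] -> R[i]).

(** The Szego kernel of the disk; its square is the Bergman kernel occurring in [bergman_proj]. *)
Definition kern z w : R[i] := (1 - conjc w * z)^-1.

Lemma kern_low z w : cabs z < 1 -> cabs w < 1 -> 1 - cabs z <= cabs (1 - conjc w * z).
Proof.
move=> z1 w1; have := cabsD (1 - conjc w * z) (conjc w * z); rewrite subrK cabs1 cabsM cabsJ.
have : cabs w * cabs z <= 1 * cabs z by apply: ler_wpM2r; [exact: cabs_ge0|exact: ltW].
lra.
Qed.

Lemma kern_neq0 z w : cabs z < 1 -> cabs w < 1 -> 1 - conjc w * z != 0.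
Proof. by move=> z1 w1; rewrite -cabs_gt0; have := kern_low z1 w1; lra. Qed.

Lemma kern_bddlip z : cabs z < 1 -> bddlip (kern z).
Proof.
move=> z1; apply: (bddlipV (d := 1 - cabs z)); first by lra.
  by move=> w w1; exact: kern_low.
apply: bddlipB; first exact: bddlip_cst.
by apply: bddlipM; [apply: bddlip_conj; exact: bddlip_id|exact: bddlip_cst].
Qed.

Lemma wder_kern z w : cabs z < 1 -> cabs w < 1 -> wder (kern z) w 0 (z * kern z w ^+ 2).
Proof.
move=> z1 w1; have n0 := kern_neq0 z1 w1.
have d : wder (fun w => 1 - conjc w * z) w 0 (- z).
  have -> : (fun w => 1 - conjc w * z) = (fun w => 1 + (- z) * conjc w).
    by apply/funext => v; ring.
  by apply: wder_eq (wder_add (wder_cst 1 w) (wder_scale (- z) (wder_conj w))) _ _; ring.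
have -> : kern z = (fun w => (1 - conjc w * z)^-1) by [].
apply: wder_eq (wder_inv (f := fun w => 1 - conjc w * z) n0 d) _ _; first by rewrite oppr0 mul0r.
by rewrite opprK exprVn.
Qed.

Lemma plane_int_conj F : bddsupp F -> plane_int (fun z => conjc (F z)) = conjc (plane_int F).
Proof.
move=> bF; have [rF iF] := bddsupp_integrable bF; rewrite !plane_intE.
transitivity (Complex (\int[@area_measure R]_p rpart F p) (\int[@area_measure R]_p (-1 * ipart F p))).
  by congr Complex; apply: eq_Rintegral => p _; rewrite /rpart /ipart; case: (F _) => x y //=; rewrite mulN1r.
by rewrite RintegralZl// mulN1r.
Qed.

Lemma cder_affine f f' z w (s : R) : cder f (z + s%:C%C * (w - z)) (f' (z + s%:C%C * (w - z))) ->
  cder (fun w => f (z + s%:C%C * (w - z))) w (s%:C%C * f' (z + s%:C%C * (w - z))).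
Proof.
move=> df.
have da : cder (fun w => z + s%:C%C * (w - z)) w s%:C%C.
  apply: cder_eq (cder_add (cder_cst z w)
    (cder_scale s%:C%C (cder_add (cder_id w) (cder_cst (- z) w)))) _.
  by rewrite add0r addr0 mulr1.
by apply: cder_eq (cder_comp da df) _; rewrite mulrC.
Qed.

(** The derivative vanishes on the open interval only, since at [t = 1] the dilation leaves no
    margin around the disk; the Lipschitz bound carries constancy to the endpoints. [P] stands for
    the real or the imaginary part. *)
Lemma flat_lip_cst (phi : R -> R[i]) (C : R) (P : R[i] -> R) :
  0 <= C ->
  (forall s t : R, 0 <= s <= 1 -> 0 <= t <= 1 -> cabs (phi s - phi t) <= C * `|s - t|) ->
  (forall t : R, 0 < t < 1 -> forall e : R, 0 < e -> exists2 d : R, 0 < d &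
    forall h : R, `|h| < d -> cabs (phi (t + h) - phi t) <= e * `|h|) ->
  (forall u v, P (u - v) = P u - P v) -> (forall u, `|P u| <= cabs u) ->
  P (phi 1) = P (phi 0).
Proof.
move=> C0 HC phi_flat PB PL.
have dP (t : R) : 0 < t < 1 -> is_derive t 1 (fun s => P (phi s)) 0.
  move=> t01; apply: real_is_derive => e e0; have [d d0 H] := phi_flat _ t01 _ e0.
  exists d => // h hd; rewrite mul0r subr0 -PB; apply: (le_trans (PL _)); exact: H.
have cP (a b : R) : 0 < a -> a < b -> b < 1 -> P (phi b) = P (phi a).
  move=> a0 ab b1.
  have M1 (s : R) : s \in `]a, b[ -> is_derive s 1 (fun s => P (phi s)) 0.
    by rewrite in_itv /= => /andP[s0 s1]; apply: dP; apply/andP; split; lra.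
  have M2 : {within `[a, b], continuous (fun s => P (phi s))}.
    apply: derivable_within_continuous => x; rewrite in_itv /= => /andP[x0 x1].
    by have [] : is_derive x 1 (fun s => P (phi s)) 0 by apply: dP; apply/andP; split; lra.
  have [c _ E] := MVT_segment (ltW ab) M1 M2.
  by move/eqP: E; rewrite mul0r subr_eq0 => /eqP.
apply/eqP; rewrite -subr_eq0; apply/eqP/normr0_eq0/le_anti; rewrite normr_ge0 andbT.
apply/ler_addgt0Pl => e e0; rewrite addr0.
(* Each end gap costs at most [C d <= e / 2]; [C + 1] avoids a zero denominator, and [1 / 4] keeps
   [d < 1 - d]. *)
pose d := Num.min (4^-1) (e / (2 * (C + 1))).
have [d0 d1 d2] : [/\ 0 < d, d <= 4^-1 & d <= e / (2 * (C + 1))].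
  rewrite /d; split; rewrite ?ge_min ?lexx ?orbT// lt_min divr_gt0 ?mulr_gt0//; lra.
have E : P (phi (1 - d)) = P (phi d) by apply: cP; lra.
have -> : P (phi 1) - P (phi 0) = P (phi 1 - phi (1 - d)) + P (phi d - phi 0).
  by rewrite !PB E; ring.
apply: (le_trans (ler_normD _ _)).
have h1 : `|P (phi 1 - phi (1 - d))| <= C * d.
  apply: (le_trans (PL _)); have := HC 1 (1 - d); rewrite opprB addrCA subrr addr0 (gtr0_norm d0).
  by apply; apply/andP; split; lra.
have h2 : `|P (phi d - phi 0)| <= C * d.
  apply: (le_trans (PL _)); have := HC d 0; rewrite subr0 (gtr0_norm d0).
  by apply; apply/andP; split; lra.
have h3 : C * d <= (C + 1) * (e / (2 * (C + 1))) by apply: ler_pM => //; lra.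
have E3 : (C + 1) * (e / (2 * (C + 1))) = e / 2 by field; lra.
lra.
Qed.

Section Dilation.
Variables (f f' : R[i] -> R[i]) (M : R) (z : R[i]).
Hypothesis df : forall z, cabs z < 1 -> cder f z (f' z).
Hypothesis f'M : forall z, cabs z < 1 -> cabs (f' z) <= M.
Hypothesis z1 : cabs z < 1.

Let dil (s : R) w := z + s%:C%C * (w - z).
(* [phi] interpolates between the two sides of the formula, from the constant
   [f z] at [s = 0] to [f] at [s = 1]; its derivative is a Jacobian integral. *)
Let phi (s : R) := plane_int (cut 1 (fun w => f (dil s w) * kern z w ^+ 2)).

Let M0 : 0 <= M.
Proof. by apply: le_trans (f'M z1); exact: cabs_ge0. Qed.

Let dil1 s w : 0 <= s <= 1 -> cabs w < 1 -> cabs (dil s w) < 1.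
Proof. by move=> s01 w1; exact: disk_convex. Qed.

Let bddlip_dil (s : R) : 0 <= s <= 1 -> bddlip (fun w => f (dil s w)).
Proof.
move=> s01; apply: (@cder_bddlip _ _ (fun w => s%:C%C * f' (dil s w)) M) => w w1.
  by apply: cder_affine; apply: df; exact: dil1.
rewrite cabsM cabsR; move: (s01) => /andP[s0 s1]; rewrite ger0_norm//.
have : s * cabs (f' (dil s w)) <= 1 * M.
  by apply: ler_pM => //; [exact: cabs_ge0|apply: f'M; exact: dil1].
by rewrite mul1r.
Qed.

Let bddlip_phi (s : R) : 0 <= s <= 1 -> bddlip (fun w => f (dil s w) * kern z w ^+ 2).
Proof. by move=> s01; apply: bddlipM; [exact: bddlip_dil|apply: bddlipX; exact: kern_bddlip]. Qed.

(** The integrand is [- t] times the [t]-derivative of the integrand of [phi t]. It is a Jacobian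
    for the weight and the kernel because [- w k + (1 - w conj w) z k^2 = k^2 (z - w)] with
    [k = kern z w]. *)
Let phi0 (t : R) : 0 < t < 1 ->
  plane_int (cut 1 (fun w => t%:C%C * f' (dil t w) * (kern z w ^+ 2 * (z - w)))) = 0.
Proof.
move=> /andP[t0 t1].
(* Chosen so that [(1 - t) |z| + t + eta = 1]: the dilation then maps the disk of radius [1 + eta]
   into the unit disk. *)
pose eta := (1 - t) * (1 - cabs z).
have z1' := z1.
have eta0 : 0 < eta by rewrite /eta mulr_gt0//; lra.
have inD w : cabs w < 1 + eta -> cabs (dil t w) < 1.
  move=> hw; have -> : dil t w = (1 - t)%:C%C * z + t%:C%C * w by rewrite /dil rmorphB rmorph1; ring.
  apply: (le_lt_trans (cabsD _ _)); rewrite !cabsM !cabsR !ger0_norm; [|lra..].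
  have h1 : t * cabs w < t * (1 + eta) by rewrite ltr_pM2l.
  have h2 : t * eta <= 1 * eta by apply: ler_wpM2r; lra.
  have h3 : (1 - t) * cabs z + t + eta = 1 by rewrite /eta; ring.
  lra.
have := @weighted_integral R (fun w => f (dil t w)) (fun w => t%:C%C * f' (dil t w)) (fun=> 0)
  (kern z) (fun=> 0) (fun w => z * kern z w ^+ 2) eta M eta0 _ _ (kern_bddlip z1) _.
have -> : cut 1 (fun w => t%:C%C * f' (dil t w) * (- w * kern z w + weight w * (z * kern z w ^+ 2)) -
   0 * (- conjc w * kern z w + weight w * 0)) =
   cut 1 (fun w => t%:C%C * f' (dil t w) * (kern z w ^+ 2 * (z - w))).
  apply/funext => w; rewrite /cut; case: ifP => // w1.
  have n0 := kern_neq0 z1 w1.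
  by rewrite /weight /kern; field.
apply=> //.
- apply: (@cder_lip _ _ (fun w => t%:C%C * f' (dil t w))) => w w1.
    by apply: cder_affine; apply: df; exact: inD.
  rewrite cabsM cabsR gtr0_norm//.
  have : t * cabs (f' (dil t w)) <= 1 * M.
    by apply: ler_pM => //; [exact: ltW|exact: cabs_ge0|exact: ltW|apply: f'M; exact: inD].
  by rewrite mul1r.
- move=> w w1; apply: cder_affine; apply: df; apply: dil1 => //; lra.
- by move=> w w1; exact: wder_kern.
Qed.

Let dil_lip (s t : R) w : 0 <= s <= 1 -> 0 <= t <= 1 -> cabs w < 1 ->
  cabs (f (dil s w) - f (dil t w)) <= 2 * M * `|s - t|.
Proof.
move=> s01 t01 w1.
have z1' := z1.
apply: (le_trans (cder_lip df f'M (dil1 s01 w1) (dil1 t01 w1))).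
have -> : dil s w - dil t w = (s - t)%:C%C * (w - z) by rewrite /dil rmorphB; ring.
rewrite cabsM cabsR -mulrA (mulrCA 2); apply: ler_wpM2l => //.
rewrite mulrC; apply: ler_wpM2r => //.
by apply: (le_trans (cabsB _ _)); lra.
Qed.

Let phiB (s t : R) : 0 <= s <= 1 -> 0 <= t <= 1 ->
  phi s - phi t = plane_int (cut 1 (fun w => (f (dil s w) - f (dil t w)) * kern z w ^+ 2)).
Proof.
move=> s01 t01; rewrite /phi -[X in _ - X]mul1r -mulNr.
have b1 := bddlip_bddsupp (bddlip_phi s01); have b2 := bddlip_bddsupp (bddlip_phi t01).
rewrite -plane_int_Z// -plane_int_D//; last exact: bddsuppZ.
by congr plane_int; apply/funext => w; rewrite /cut; case: ifP => _; ring.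
Qed.

Let N0 : exists2 N : R, 0 <= N & forall w, cabs w < 1 -> cabs (kern z w ^+ 2) <= N.
Proof.
have [N N0 H] := bddlipX 2 (kern_bddlip z1); exists N => // w w1.
by have [] := H _ _ w1 w1.
Qed.

Let phi_lip : exists2 C : R, 0 <= C & forall s t : R, 0 <= s <= 1 -> 0 <= t <= 1 ->
  cabs (phi s - phi t) <= C * `|s - t|.
Proof.
have [N N0' HN] := N0.
set A := fine (@area_measure R (box (1 + 1))).
have A0 : 0 <= A by apply: fine_ge0; exact: measure_ge0.
exists (2 * (2 * M * N * A)); first by rewrite !mulr_ge0.
move=> s t s01 t01; rewrite phiB//.
have : cabs (plane_int (cut 1 (fun w => (f (dil s w) - f (dil t w)) * kern z w ^+ 2))) <=
    2 * ((2 * M * `|s - t| * N) * A).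
  apply: plane_int_bound => //.
  - by have [] := bddlip_bddsupp (bddlipM (bddlipB (bddlip_dil s01) (bddlip_dil t01)) (bddlipX 2 (kern_bddlip z1))).
  - move=> w; rewrite /cut; case: ifPn => w1; last by rewrite cabs0 !mulr_ge0.
    rewrite cabsM; apply: ler_pM; rewrite ?cabs_ge0//; [exact: dil_lip|exact: HN].
  - by move=> w w1; rewrite /cut ltNge (ltW w1).
move=> /le_trans; apply; rewrite le_eqVlt; apply/orP; left; apply/eqP; ring.
Qed.

(** Dominated convergence is sequential, so the argument is by contradiction: choice gives steps
    [h n] tending to 0 that violate the bound, while the integrals of the corresponding quotients
    tend to 0 by [phi0]. *)
Let phi_flat (t : R) : 0 < t < 1 -> forall e : R, 0 < e -> exists2 d : R, 0 < d &
  forall h : R, `|h| < d -> cabs (phi (t + h) - phi t) <= e * `|h|.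
Proof.
move=> t01 e e0; have [t0 t1] := andP t01.
apply: contrapT => nex.
(* Steps shorter than [m] keep [t + h] in [[0, 1]]. *)
have [m [m0 m1 m2]] : exists m : R, [/\ 0 < m, m <= t & m <= 1 - t].
  have [h|h] := lerP t (1 - t); [exists t|exists (1 - t)]; split; lra.
have step n : exists h : R, `|h| < m / n.+1%:R /\ e * `|h| < cabs (phi (t + h) - phi t).
  apply: contrapT => nh; apply: nex; exists (m / n.+1%:R); first by rewrite divr_gt0.
  move=> h hm; rewrite leNgt; apply/negP => hh; apply: nh; by exists h.
have [h hP] := choice step; have z1' := z1.
have hm n : `|h n| < m.
  have [h1 _] := hP n; apply: (lt_le_trans h1).
  by rewrite ler_pdivrMr// ler_peMr ?ler1n//; exact: ltW.
have h_neq n : h n != 0.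
  have [_ +] := hP n; apply: contraTneq => ->.
  by rewrite addr0 subrr cabs0 normr0 mulr0 ltxx.
have th n : 0 <= t + h n <= 1.
  by have := hm n; rewrite ltr_norml => /andP[? ?]; apply/andP; split; lra.
have t01' : 0 <= t <= 1 by rewrite !ltW.
(* The factor [- t] makes the quotients converge to the integrand of [phi0] itself. *)
pose c n : R[i] := (- (t / h n))%:C%C.
pose F n := cut 1 (fun w => c n * ((f (dil (t + h n) w) - f (dil t w)) * kern z w ^+ 2)).
pose F0 := cut 1 (fun w => t%:C%C * f' (dil t w) * (kern z w ^+ 2 * (z - w))).
have [N N0' HN] := N0.
have bF n : bddsupp (F n).
  apply: bddlip_bddsupp; apply: bddlipM; first exact: bddlip_cst.
  by apply: bddlipM; [apply: bddlipB; exact: bddlip_dil|apply: bddlipX; exact: kern_bddlip].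
have PF n : plane_int (F n) = c n * (phi (t + h n) - phi t).
  rewrite phiB// -plane_int_Z; last first.
    by apply: bddlip_bddsupp; apply: bddlipM; [apply: bddlipB; exact: bddlip_dil|apply: bddlipX; exact: kern_bddlip].
  by congr plane_int; apply/funext => w; rewrite /F /cut; case: ifP; rewrite ?mulr0.
have FF w : ccvg (fun n => F n w) (F0 w).
  rewrite /F /F0 /cut; case: ifPn => [w1|_]; last exact: ccvg_cst.
  move=> d d0.
  have K0 : 0 < t * 2 * (N + 1) by rewrite !mulr_gt0//; lra.
  have [r r0 H] := df (dil1 t01' w1) (divr_gt0 d0 K0).
  have [n0 Hn0] := small_inv m0 (divr_gt0 r0 (ltr0Sn R 1)).
  exists n0 => n /Hn0 hn; have [h1 _] := hP n.
  have hr := lt_trans h1 hn.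
  have wz : cabs (w - z) <= 2 by apply: (le_trans (cabsB _ _)); lra.
  have hv : cabs ((h n)%:C%C * (w - z)) <= `|h n| * 2.
    by rewrite cabsM cabsR; apply: ler_wpM2l.
  have hC : (h n)%:C%C != 0 :> R[i] by rewrite eq_complex /= eqxx andbT.
  have -> : dil (t + h n) w = dil t w + (h n)%:C%C * (w - z).
    by rewrite /dil rmorphD; ring.
  have -> : c n * ((f (dil t w + (h n)%:C%C * (w - z)) - f (dil t w)) * kern z w ^+ 2) -
     t%:C%C * f' (dil t w) * (kern z w ^+ 2 * (z - w)) =
     c n * kern z w ^+ 2 * (f (dil t w + (h n)%:C%C * (w - z)) - f (dil t w) -
       (f' (dil t w) * ((h n)%:C%C * (w - z)) + 0 * conjc ((h n)%:C%C * (w - z)))).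
    by rewrite /c rmorphN rmorphM fmorphV /=; field.
  have hv' : cabs ((h n)%:C%C * (w - z)) < r by lra.
  have := H _ hv'; move=> H'.
  rewrite !cabsM cabsR normrN normrM normfV (gtr0_norm t0).
  set X := cabs (f _ - _ - _) in H' *.
  have hn0 : 0 < `|h n| by rewrite normr_gt0.
  have X2 : X <= d / (t * 2 * (N + 1)) * (`|h n| * 2).
    by apply: (le_trans H'); apply: ler_wpM2l => //; rewrite divr_ge0// ltW.
  have P1 : t / `|h n| * cabs (kern z w ^+ 2) <= t / `|h n| * (N + 1).
    apply: ler_wpM2l; first by rewrite divr_ge0// ltW.
    by have := HN _ w1; lra.
  have : t / `|h n| * cabs (kern z w ^+ 2) * X <=
     t / `|h n| * (N + 1) * (d / (t * 2 * (N + 1)) * (`|h n| * 2)).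
    apply: ler_pM => //; last exact: cabs_ge0.
    by rewrite mulr_ge0 ?cabs_ge0// divr_ge0// ltW.
  have -> : t / `|h n| * (N + 1) * (d / (t * 2 * (N + 1)) * (`|h n| * 2)) = d.
    by field; rewrite !gt_eqF//; lra.
  by rewrite cabsX expr2.
have F0m : cmeasurable F0.
  by apply: (@cmeasurable_cvg _ F) => [n|w]; [have [] := bF n|exact: FF].
have P0 : plane_int F0 = 0 by exact: phi0.
have Kp : 0 <= 2 * M * N by rewrite !mulr_ge0.
have FK n w : cabs (F n w) <= 2 * M * N.
  rewrite /F /cut; case: ifPn => [w1|_]; last by rewrite cabs0.
  rewrite 2!cabsM cabsR normrN normrM normfV (gtr0_norm t0).
  have hn0 : 0 < `|h n| by rewrite normr_gt0.
  have L := dil_lip (th n) t01' w1.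
  rewrite (_ : t + h n - t = h n) in L; last by ring.
  have -> : 2 * M * N = `|h n|^-1 * ((2 * M * `|h n|) * N) by field; rewrite gt_eqF.
  apply: ler_pM; rewrite ?mulr_ge0 ?cabs_ge0 ?invr_ge0// ?(ltW t0)//.
    by rewrite ler_piMl ?invr_ge0// ltW.
  by apply: ler_pM; rewrite ?cabs_ge0//; exact: HN.
(* The violated bound forces the integral of [F n] to exceed [e t] in modulus, so half of it as
   tolerance gives the contradiction. *)
have et : 0 < e * t / 2 by rewrite divr_gt0// mulr_gt0.
(* The [+ 1] makes the constant cover the support radius 1 besides the bound [2 M N]. *)
have [|||n0 Hn] := @plane_int_cvg _ F F0 (2 * M * N + 1) (fun n => (bF n).1) F0m _ _ _ _ et.
- by move=> n w; apply: (le_trans (FK n w)); lra.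
- by move=> n w hw; rewrite /F /cut ifF//; apply/negbTE; rewrite -leNgt; lra.
- by move=> w _; exact: FF.
have := Hn n0 (leqnn _); rewrite P0 subr0 PF cabsM /c cabsR normrN normrM normfV (gtr0_norm t0).
have [_ h2] := hP n0; have hn0 : 0 < `|h n0| by rewrite normr_gt0.
have : t / `|h n0| * (e * `|h n0|) < t / `|h n0| * cabs (phi (t + h n0) - phi t).
  by rewrite ltr_pM2l// divr_gt0.
have -> : t / `|h n0| * (e * `|h n0|) = e * t by field; rewrite gt_eqF.
have : 0 < e * t by exact: mulr_gt0.
lra.
Qed.

Lemma reproducing_kern : plane_int (cut 1 (fun w => f w * kern z w ^+ 2)) = f z * plane_int (cut 1 (fun w => kern z w ^+ 2)).
Proof.
have -> : plane_int (cut 1 (fun w => f w * kern z w ^+ 2)) = phi 1.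
  by congr plane_int; apply/funext => w; rewrite /cut /dil rmorph1 mul1r (addrC z) subrK.
have -> : f z * plane_int (cut 1 (fun w => kern z w ^+ 2)) = phi 0.
  rewrite -plane_int_Z; last by apply: bddlip_bddsupp; apply: bddlipX; exact: kern_bddlip.
  by congr plane_int; apply/funext => w; rewrite /cut /dil rmorph0 mul0r addr0; case: ifP; rewrite ?mulr0.
have [C C0 HC] := phi_lip.
have E1 : complex.Re (phi 1) = complex.Re (phi 0).
  by apply: (flat_lip_cst C0 HC phi_flat) => [u v|u]; [rewrite ReD ReN|exact: cabs_Re].
have E2 : complex.Im (phi 1) = complex.Im (phi 0).
  by apply: (flat_lip_cst C0 HC phi_flat) => [u v|u]; [rewrite ImD ImN|exact: cabs_Im].
by move: E1 E2; case: (phi 1) => a b; case: (phi 0) => c d /= -> ->.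
Qed.

End Dilation.

(** The conjugate [q] of [kern z ^+ 2] is analytic in [w]. At the centre 0 the kernel is constantly
    1 and the disk has area 1, so [reproducing_kern] there gives the integral of [q] as
    [q 0 = 1]. *)
Lemma kern_integral z : cabs z < 1 -> plane_int (cut 1 (fun w => kern z w ^+ 2)) = 1.
Proof.
move=> z1; have c0 : cabs (0 : R[i]) < 1 by rewrite cabs0.
have zc : cabs (conjc z) < 1 by rewrite cabsJ.
pose q w : R[i] := ((1 - z ^* * w) ^-1) ^+ 2.
have q0 w : cabs w < 1 -> 1 - conjc z * w != 0.
  by move=> w1; rewrite mulrC -[w]conjcK; apply: kern_neq0 => //; rewrite cabsJ.
have bddlip_q : bddlip (fun w => (1 - conjc z * w)^-1).
  apply: (bddlipV (d := 1 - cabs z)); first by lra.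
    move=> w w1; have wc : cabs (conjc w) < 1 by rewrite cabsJ.
    by have := kern_low zc wc; rewrite conjcK cabsJ (mulrC w).
  by apply: bddlipB; [exact: bddlip_cst|apply: bddlipM; [exact: bddlip_cst|exact: bddlip_id]].
have dq w : cabs w < 1 -> cder q w (2 * conjc z * ((1 - conjc z * w)^-1) ^+ 3).
  move=> w1; have n0 := q0 w w1.
  have d : cder (fun w => 1 - conjc z * w) w (- conjc z).
    have -> : (fun w => 1 - conjc z * w) = (fun w => 1 + (- conjc z) * w).
      by apply/funext => v; rewrite mulNr.
    by apply: cder_eq (cder_add (cder_cst 1 w) (cder_scale (- conjc z) (cder_id w))) _; ring.
  have d' := cder_inv (f := fun w => 1 - conjc z * w) n0 d.
  have -> : q = (fun w => (1 - conjc z * w)^-1 * (1 - conjc z * w)^-1).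
    by apply/funext => v; rewrite /q expr2.
  by apply: cder_eq (cder_mul d' d') _; field.
have bq' : bddlip (fun w => 2 * conjc z * ((1 - conjc z * w)^-1) ^+ 3).
  by apply: bddlipM; [exact: bddlip_cst|exact: bddlipX].
have [M M0 HM] := bq'.
have HM' w : cabs w < 1 -> cabs (2 * conjc z * ((1 - conjc z * w)^-1) ^+ 3) <= M.
  by move=> w1; have [] := HM w w w1 w1.
have K := reproducing_kern dq HM' c0.
have kern0 : cut 1 (fun w => kern 0 w ^+ 2) = cut 1 (fun=> 1) :> (R[i] -> R[i]).
  by apply/funext => w; rewrite /cut /kern mulr0 subr0 invr1 expr1n.
rewrite kern0 plane_int_cut1 mulr1 in K.
have -> : cut 1 (fun w => kern z w ^+ 2) = (fun w => conjc (cut 1 (fun w => q w * kern 0 w ^+ 2) w)).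
  apply/funext => w; rewrite /cut; case: ifP => _; last by rewrite conjc0.
  rewrite /kern mulr0 subr0 invr1 expr1n mulr1 /q !expr2 conjcM conjc_inv conjcB conjc1 conjcM conjcK.
  by rewrite (mulrC z).
rewrite plane_int_conj; last first.
  apply: bddlip_bddsupp; apply: bddlipM; first exact: bddlipX.
  by apply: bddlipX; exact: kern_bddlip.
by rewrite K /q mulr0 subr0 invr1 expr1n conjc1.
Qed.

Theorem bergman_reproducing f f' (M : R) z :
  (forall z, cabs z < 1 -> cder f z (f' z)) ->
  (forall z, cabs z < 1 -> cabs (f' z) <= M) -> cabs z < 1 ->
  plane_int (cut 1 (fun w => f w * kern z w ^+ 2)) = f z.
Proof. by move=> df f'M z1; rewrite (reproducing_kern df f'M z1) kern_integral ?mulr1. Qed.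

End Reproducing.

(** * Derivatives and primitives by differentiating and integrating the kernel *)

Section KernelDerivatives.
Context {R : realType}.
Implicit Types (z w h v : R[i]) (f g a : R[i] -> R[i]) (K : R[i] -> R[i] -> R[i]).

(* Complex differentiability in the first variable at [z], with a remainder
   that is uniform over the disk in the second one. *)
Definition unif_cder K K' z := exists r C : R, [/\ 0 < r, 0 <= C &
  forall w h, cabs w < 1 -> cabs h < r ->
  [/\ cabs (K (z + h) w) <= C, cabs (K' z w) <= C &
      cabs (K (z + h) w - K z w - h * K' z w) <= C * cabs h ^+ 2]].

Lemma unif_cderM K1 K1' K2 K2' z : unif_cder K1 K1' z -> unif_cder K2 K2' z ->
  unif_cder (fun z w => K1 z w * K2 z w) (fun z w => K1' z w * K2 z w + K1 z w * K2' z w) z.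
Proof.
move=> [r [C [r0 C0 H]]] [s [D [s0 D0 G]]].
(* The three remainder terms add up to at most [4 C D |h|^2] and the derivative to [2 C D]; the
   radius is capped at 1 so that [|h|^2 <= |h|]. *)
exists (Num.min 1 (Num.min r s)), (5 * C * D); split.
- by rewrite !lt_min ltr01 r0.
- by rewrite !mulr_ge0.
move=> w h w1; rewrite !lt_min => /andP[h1 /andP[hr hs]].
have [p1 p2 p3] := H _ _ w1 hr; have [q1 q2 q3] := G _ _ w1 hs.
have c0 t : 0 < t -> cabs (0 : R[i]) < t by rewrite cabs0.
have [p1' _ _] := H w 0 w1 (c0 _ r0); have [q1' _ _] := G w 0 w1 (c0 _ s0).
rewrite addr0 in p1' q1'.
have CD : 0 <= C * D by exact: mulr_ge0.
have hh := cabs_ge0 h.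
have h2 : cabs h ^+ 2 <= cabs h by rewrite expr2 -[leRHS]mulr1; apply: ler_wpM2l => //; exact: ltW.
have h20 : 0 <= cabs h ^+ 2 by exact: sqr_ge0.
have M x y (X Y : R) : cabs x <= X -> cabs y <= Y -> cabs (x * y) <= X * Y.
  by move=> hx hy; rewrite cabsM; apply: ler_pM => //; exact: cabs_ge0.
split.
- by have := M _ _ _ _ p1 q1; lra.
- by apply: (le_trans (cabsD _ _)); have := M _ _ _ _ p2 q1'; have := M _ _ _ _ p1' q2; lra.
set R1 := K1 (z + h) w - K1 z w - h * K1' z w in p3.
set R2 := K2 (z + h) w - K2 z w - h * K2' z w in q3.
have -> : K1 (z + h) w * K2 (z + h) w - K1 z w * K2 z w -
    h * (K1' z w * K2 z w + K1 z w * K2' z w) =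
    R1 * K2 (z + h) w + (K1 z w * R2 + h * (K1' z w * (R2 + h * K2' z w))).
  by rewrite /R1 /R2; ring.
have R2b : cabs (R2 + h * K2' z w) <= 2 * D * cabs h.
  apply: (le_trans (cabsD _ _)); have := M _ _ _ _ (lexx (cabs h)) q2.
  have : D * cabs h ^+ 2 <= D * cabs h by apply: ler_wpM2l.
  lra.
have t1 := M _ _ _ _ p3 q1; have t2 := M _ _ _ _ p1' q3.
have t3 := M _ _ _ _ (lexx (cabs h)) (M _ _ _ _ p2 R2b).
apply: (le_trans (cabsD _ _)); apply: (le_trans (lerD t1 (cabsD _ _))).
have E : cabs h * (C * (2 * D * cabs h)) = 2 * (C * D * cabs h ^+ 2) by rewrite expr2; ring.
have E1 : C * cabs h ^+ 2 * D = C * D * cabs h ^+ 2 by ring.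
have E2 : C * (D * cabs h ^+ 2) = C * D * cabs h ^+ 2 by ring.
have E3 : 5 * C * D * cabs h ^+ 2 = 5 * (C * D * cabs h ^+ 2) by ring.
have : 0 <= C * D * cabs h ^+ 2 by exact: mulr_ge0.
rewrite E in t3; rewrite E1 E3; lra.
Qed.

Lemma unif_cder_kern z : cabs z < 1 ->
  unif_cder (@kern R) (fun z w => conjc w * kern z w ^+ 2) z.
Proof.
(* Half the distance to the circle: for [|h| < d] the denominator at [z + h] stays at least [d]
   uniformly in [w]. *)
move=> z1; pose d := (1 - cabs z) / 2.
have d0 : 0 < d by rewrite /d; lra.
(* The three terms bound the kernel, its derivative and the remainder [h^2 (conj w)^2 kern z w ^+ 2
   * kern (z + h) w]. *)
pose C := d^-1 + d^-1 ^+ 2 + d^-1 ^+ 3.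
have di : 0 < d^-1 by rewrite invr_gt0.
have di2 : 0 < d^-1 ^+ 2 by rewrite exprn_gt0.
have di3 : 0 < d^-1 ^+ 3 by rewrite exprn_gt0.
exists d, C; split => //; first by rewrite /C; lra.
have low z' w : cabs z' <= 1 - d -> cabs w < 1 -> cabs (kern z' w) <= d^-1.
  move=> z'd w1; have z'1 : cabs z' < 1 by lra.
  by rewrite /kern cabsV lef_pV2 ?posrE//; have := kern_low z'1 w1; lra.
move=> w h w1 hd.
have zh : cabs (z + h) <= 1 - d by apply: (le_trans (cabsD _ _)); move: hd; rewrite /d; lra.
have zd : cabs z <= 1 - d by rewrite /d; lra.
have k1 := low _ _ zh w1; have k2 := low _ _ zd w1.
have w0 := cabs_ge0 w.
have k22 : cabs (kern z w ^+ 2) <= d^-1 ^+ 2 by rewrite cabsX lerXn2r ?nnegrE ?cabs_ge0// ltW.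
split.
- by apply: (le_trans k1); rewrite /C; lra.
- rewrite cabsM cabsJ; have : cabs w * cabs (kern z w ^+ 2) <= 1 * d^-1 ^+ 2.
    by apply: ler_pM; rewrite ?cabs_ge0//; exact: ltW.
  by rewrite /C; lra.
have n0 : 1 - conjc w * z != 0 by exact: kern_neq0.
have n1 : 1 - conjc w * (z + h) != 0 by apply: kern_neq0 => //; lra.
have -> : kern (z + h) w - kern z w - h * (conjc w * kern z w ^+ 2) =
   (h ^+ 2 * conjc w ^+ 2) * (kern z w ^+ 2 * kern (z + h) w).
  by rewrite /kern; field; rewrite n1 n0.
rewrite (cabsM (h ^+ 2 * _)) (cabsM (h ^+ 2)) (cabsM (kern z w ^+ 2)) (cabsX h) (cabsX (conjc w)) cabsJ.
have a1 : cabs (kern z w ^+ 2) * cabs (kern (z + h) w) <= d^-1 ^+ 2 * d^-1.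
  by apply: ler_pM; rewrite ?cabs_ge0.
have a2 : cabs h ^+ 2 * cabs w ^+ 2 <= cabs h ^+ 2 * 1.
  by apply: ler_wpM2l; rewrite ?sqr_ge0// expr_le1// ltW.
have : cabs h ^+ 2 * cabs w ^+ 2 * (cabs (kern z w ^+ 2) * cabs (kern (z + h) w)) <=
  (cabs h ^+ 2 * 1) * (d^-1 ^+ 2 * d^-1).
  by apply: ler_pM => //; rewrite ?mulr_ge0 ?sqr_ge0 ?cabs_ge0.
move=> /le_trans; apply; rewrite mulr1 mulrC -exprSr; apply: ler_wpM2r; rewrite ?sqr_ge0//.
by rewrite /C; lra.
Qed.

Lemma unif_cder_kernX z m : cabs z < 1 ->
  unif_cder (fun z w => kern z w ^+ m) (fun z w => m%:R * conjc w * kern z w ^+ m.+1) z.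
Proof.
move=> z1; elim: m => [|m IH].
  exists 1, 1; split => // w h w1 h1; rewrite !expr0 !mul0r cabs1 cabs0 subrr mulr0 subr0 cabs0.
  by split => //; rewrite mul1r sqr_ge0.
have [r [C [r0 C0 H]]] := unif_cderM (unif_cder_kern z1) IH.
exists r, C; split => // w h w1 hr; have := H w h w1 hr.
rewrite -!exprS (_ : conjc w * kern z w ^+ 2 * kern z w ^+ m +
  kern z w * (m%:R * conjc w * kern z w ^+ m.+1) = m.+1%:R * conjc w * kern z w ^+ m.+2)//.
by rewrite -natr1 !exprS expr0; ring.
Qed.

(** Differentiation under the integral sign: the quadratic remainder of [unif_cder_kernX] is uniform
    in [w], hence survives integration over a set of finite area. *)
Lemma cder_kern_integral a z m : bddlip a -> cabs z < 1 ->
  cder (fun z => plane_int (cut 1 (fun w => a w * kern z w ^+ m))) z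
    (plane_int (cut 1 (fun w => (m%:R * conjc w * a w) * kern z w ^+ m.+1))).
Proof.
move=> ba z1 e e0.
have [r [C [r0 C0 H]]] := unif_cder_kernX m z1.
have [M M0 HM] := ba.
set A := fine (@area_measure R (box (1 + 1))).
have A0 : 0 <= A by apply: fine_ge0; exact: measure_ge0.
have K0 : 0 < 2 * (M * C * A) + 1 by have := mulr_ge0 (mulr_ge0 M0 C0) A0; lra.
exists (Num.min (Num.min r (1 - cabs z)) (e / (2 * (M * C * A) + 1))).
  by rewrite !lt_min r0 subr_gt0 z1 divr_gt0.
move=> h; rewrite !lt_min => /andP[/andP[hr hz] he].
have zh1 : cabs (z + h) < 1 by apply: (le_lt_trans (cabsD _ _)); lra.
have bk z' : cabs z' < 1 -> bddlip (fun w => a w * kern z' w ^+ m).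
  by move=> z'1; apply: bddlipM => //; apply: bddlipX; exact: kern_bddlip.
have bk' : bddlip (fun w => (m%:R * conjc w * a w) * kern z w ^+ m.+1).
  apply: bddlipM; last by apply: bddlipX; exact: kern_bddlip.
  apply: bddlipM => //; apply: bddlipM; first exact: bddlip_cst.
  exact: bddlip_conj bddlip_id.
have b1 := bddlip_bddsupp (bk _ zh1); have b2 := bddlip_bddsupp (bk _ z1); have b3 := bddlip_bddsupp bk'.
rewrite mul0r addr0.
set P' := plane_int (cut 1 (fun w => _ * _ * a w * _)).
have -> : plane_int (cut 1 (fun w => a w * kern (z + h) w ^+ m)) - plane_int (cut 1 (fun w => a w * kern z w ^+ m)) -
    P' * h = plane_int (cut 1 (fun w => a w * (kern (z + h) w ^+ m - kern z w ^+ m -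
       h * (m%:R * conjc w * kern z w ^+ m.+1)))).
  rewrite /P' (mulrC _ h) -(mulN1r (plane_int _)) -mulNr -!plane_int_Z// -!plane_int_D//; try exact: bddsuppZ; last first.
    by apply: bddsuppD => //; exact: bddsuppZ.
  by congr plane_int; apply/funext => w; rewrite /cut; case: ifP => _; ring.
have bR : bddlip (fun w => a w * (kern (z + h) w ^+ m - kern z w ^+ m -
       h * (m%:R * conjc w * kern z w ^+ m.+1))).
  apply: bddlipM => //; apply: bddlipB; first by apply: bddlipB; apply: bddlipX; exact: kern_bddlip.
  apply: bddlipM; first exact: bddlip_cst.
  apply: bddlipM; last by apply: bddlipX; exact: kern_bddlip.
  by apply: bddlipM; [exact: bddlip_cst|exact: bddlip_conj bddlip_id].
have : cabs (plane_int (cut 1 (fun w => a w * (kern (z + h) w ^+ m - kern z w ^+ m -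
       h * (m%:R * conjc w * kern z w ^+ m.+1))))) <= 2 * ((M * (C * cabs h ^+ 2)) * A).
  apply: plane_int_bound => //; first by have [] := bddlip_bddsupp bR.
    move=> w; rewrite /cut; case: ifPn => w1; last by rewrite cabs0 !mulr_ge0 ?cabs_ge0.
    rewrite cabsM; apply: ler_pM; rewrite ?cabs_ge0//; first by have [] := HM w w w1 w1.
    by have [] := H w h w1 hr.
  by move=> w w1; rewrite /cut ltNge (ltW w1).
move=> /le_trans; apply.
have -> : 2 * (M * (C * cabs h ^+ 2) * A) = 2 * (M * C * A) * cabs h * cabs h by ring.
apply: ler_wpM2r; first exact: cabs_ge0.
rewrite ltr_pdivlMr// in he.
have := cabs_ge0 h; lra.
Qed.

(* On the disk, [D n] is the [n]-th derivative of [D 0]. *)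
Definition holo_tower (D : nat -> R[i] -> R[i]) := forall n z, cabs z < 1 -> cder (D n) z (D n.+1 z).

Lemma holo_tower_exists f f' (M : R) : (forall z, cabs z < 1 -> cder f z (f' z)) ->
  (forall z, cabs z < 1 -> cabs (f' z) <= M) ->
  exists D, holo_tower D /\ forall z, cabs z < 1 -> D 0%N z = f z.
Proof.
move=> df f'M; have bf := cder_bddlip df f'M.
(* Differentiating [kern ^+ n'.+2] brings down [n'.+2 * conj w]; the exponent starts at 2, that of
   the Bergman kernel. *)
pose a := fix a n w := if n is n'.+1 then n'.+2%:R * conjc w * a n' w else f w.
have ba n : bddlip (a n).
  elim: n => [//|n IH]; apply: bddlipM => //.
  by apply: bddlipM; [exact: bddlip_cst|exact: bddlip_conj bddlip_id].
exists (fun n z => plane_int (cut 1 (fun w => a n w * kern z w ^+ n.+2))); split.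
  by move=> n z z1; exact: (cder_kern_integral n.+2 (ba n) z1).
by move=> z z1; exact: bergman_reproducing df f'M z1.
Qed.

(** In the variable [z], the function [z * kern z w] is a primitive of [kern z w ^+ 2], since
    [k + z conj w k^2 = k^2]. *)
Lemma primitive_exists f f' (M : R) : (forall z, cabs z < 1 -> cder f z (f' z)) ->
  (forall z, cabs z < 1 -> cabs (f' z) <= M) ->
  exists F, forall z, cabs z < 1 -> cder F z (f z).
Proof.
move=> df f'M; have bf := cder_bddlip df f'M.
exists (fun z => z * plane_int (cut 1 (fun w => f w * kern z w ^+ 1))) => z z1.
have d1 := cder_kern_integral 1 bf z1.
apply: cder_eq (cder_mul (cder_id z) d1) _.
rewrite mul1r -plane_int_Z; last first.
  apply: bddlip_bddsupp; apply: bddlipM; last by apply: bddlipX; exact: kern_bddlip.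
  by apply: bddlipM => //; apply: bddlipM; [exact: bddlip_cst|exact: bddlip_conj bddlip_id].
rewrite -plane_int_D; last 2 first.
- by apply: bddlip_bddsupp; apply: bddlipM => //; apply: bddlipX; exact: kern_bddlip.
- apply: bddsuppZ; apply: bddlip_bddsupp; apply: bddlipM; last by apply: bddlipX; exact: kern_bddlip.
  by apply: bddlipM => //; apply: bddlipM; [exact: bddlip_cst|exact: bddlip_conj bddlip_id].
rewrite -(bergman_reproducing df f'M z1); congr plane_int; apply/funext => w; rewrite /cut.
case: ifPn => w1; last by rewrite mulr0 addr0.
by have n0 := kern_neq0 z1 w1; rewrite /kern; field.
Qed.

End KernelDerivatives.

(** * Eigenfunctions *)

Section ClosedDisk.
Context {R : realType}.
Implicit Types (z w h v c : R[i]) (F : R[i] -> R[i]).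

Lemma closure_diskE z : closure disk z <-> cabs z <= 1.
Proof.
split=> [cz|z1 B /nbhs_cabsP[r r0 HB]].
  apply/ler_addgt0Pl => e e0.
  have [w []] : (disk `&` [set w | cabs (w - z) < e]) !=set0.
    by apply: cz; apply/nbhs_cabsP; exists e.
  rewrite diskE /= => w1 we.
  by have := cabsB w (w - z); rewrite opprB addrC subrK; lra.
pose s : R := Num.min (1 / 2) (r / 2).
have [s0 s1 s2] : [/\ 0 < s, s <= 1 / 2 & s <= r / 2].
  by rewrite /s; split; rewrite ?ge_min ?lexx ?orbT// lt_min !divr_gt0.
exists ((1 - s)%:C%C * z); split.
  rewrite diskE cabsM cabsR ger0_norm; last lra.
  have : (1 - s) * cabs z <= (1 - s) * 1 by apply: ler_wpM2l => //; lra.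
  lra.
apply: HB; have -> : (1 - s)%:C%C * z - z = - (s%:C%C * z) by rewrite rmorphB rmorph1; ring.
rewrite cabsN cabsM cabsR gtr0_norm//.
have : s * cabs z <= s * 1 by apply: ler_wpM2l => //; lra.
lra.
Qed.

Lemma closed_disk_convex z w (t : R) : 0 <= t <= 1 -> cabs z <= 1 -> cabs w <= 1 ->
  cabs (z + t%:C%C * (w - z)) <= 1.
Proof.
move=> t01 hz hw; apply/ler_addgt0Pl => e e0; apply: ltW; apply: disk_convex => //; lra.
Qed.

Lemma closed_pball (c : R[i]) (r : R) : closed [set p : R * R | cabs (of_plane p - c) <= r].
Proof.
have -> : [set p : R * R | cabs (of_plane p - c) <= r] = ~` [set p | r < cabs (of_plane p - c)].
  by apply/seteqP; split => p /=; rewrite leNgt => /negP.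
apply: open_closedC; rewrite openE => p /= pr; apply/plane_nbhsP.
exists (cabs (of_plane p - c) - r); first by rewrite subr_gt0.
move=> q; rewrite of_planeB => hq /=.
have := cabsB (of_plane q - c) (of_plane q - of_plane p).
have -> : of_plane q - c - (of_plane q - of_plane p) = of_plane p - c by ring.
lra.
Qed.

Lemma compact_pball (c : R[i]) (r : R) : compact [set p : R * R | cabs (of_plane p - c) <= r].
Proof.
apply: (@subclosed_compact _ _ (`[complex.Re c - r, complex.Re c + r]%classic `*`
   `[complex.Im c - r, complex.Im c + r]%classic)).
- exact: closed_pball.
- by apply: compact_setX; exact: segment_compact.
move=> p /= hp; have := cabs_Re (of_plane p - c); have := cabs_Im (of_plane p - c).
rewrite ReD ImD ReN ImN /= !ler_norml !in_itv /=.
by move=> /andP[h1 h2] /andP[h3 h4]; split; apply/andP; split; lra.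
Qed.

(** Compactness is taken in [R * R]. It provides the positive lower bound of [|N|] on the closed
    disk and the minimum point from which openness of [Psi] is proved. *)
Lemma ccont_min F c (r : R) : 0 <= r -> (forall z, cabs (z - c) <= r -> ccont F z) ->
  exists2 z1, cabs (z1 - c) <= r & forall z, cabs (z - c) <= r -> cabs (F z1) <= cabs (F z).
Proof.
move=> r0 cF.
have [||p] := @compact_EVT_min _ R (fun p => cabs (F (of_plane p))) _ _ (@compact_pball c r).
- by exists (to_plane c); rewrite /= to_planeK subrr cabs0.
- apply: continuous_in_subspaceT => p; rewrite inE /= => hp.
  apply/cvgrPdist_le => e e0; have [d d0 H] := cF _ hp _ e0.
  apply/plane_nbhsP; exists d => // q qd; rewrite distrC.
  apply: (le_trans (cabs_dist _ _)).
  by have := H _ qd; rewrite of_planeB (addrC (of_plane p)) subrK.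
rewrite inE /= => hp H; exists (of_plane p) => // z hz.
by have := H (to_plane z); rewrite inE /= to_planeK; exact.
Qed.

End ClosedDisk.

Section Bounded.
Context {R : realType}.
Implicit Types (z w : R[i]) (F G : R[i] -> R[i]).

(** Meant for derivatives such as [psi'], for which a bound is known but no Lipschitz estimate. *)
Definition diskbdd F := exists M : R, forall z, cabs z < 1 -> cabs (F z) <= M.

Lemma bddlip_diskbdd F : bddlip F -> diskbdd F.
Proof. by move=> [M M0 H]; exists M => z z1; have [] := H z z z1 z1. Qed.

Lemma diskbddD F G : diskbdd F -> diskbdd G -> diskbdd (fun w => F w + G w).
Proof.
move=> [M H] [N K]; exists (M + N) => z z1; apply: (le_trans (cabsD _ _)).
by have := H z z1; have := K z z1; lra.
Qed.

Lemma diskbddM F G : diskbdd F -> diskbdd G -> diskbdd (fun w => F w * G w).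
Proof.
move=> [M H] [N K]; exists (M * N) => z z1; rewrite cabsM.
by apply: ler_pM; rewrite ?cabs_ge0//; [exact: H|exact: K].
Qed.

Lemma diskbddN F : diskbdd F -> diskbdd (fun w => - F w).
Proof. by move=> [M H]; exists M => z z1; rewrite cabsN; exact: H. Qed.

End Bounded.

Section Eigenfunction.
Context {R : realType}.
Implicit Types (z w : R[i]).
Variables (gamma : R[i]) (psi psi' : R[i] -> R[i]).
Hypothesis gamma0 : gamma != 0.
Hypothesis dpsi : forall z, cabs z <= 1 -> cder psi z (psi' z).
Hypothesis psi'_lt : forall z, cabs z <= 1 -> cabs (psi' z) < cabs gamma.

(** The segment stays in the convex closed disk, and [wder_mvt] evaluates [psi'] at one of its
    points, where the bound by [|gamma|] is strict. *)
Lemma strict_contraction z w : cabs z <= 1 -> cabs w <= 1 -> z != w ->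
  cabs (psi z - psi w) < cabs gamma * cabs (z - w).
Proof.
move=> z1 w1 zw.
have [|t t01] := @wder_mvt R psi psi' (fun=> 0) w z.
  by move=> t t01; apply: dpsi; exact: closed_disk_convex.
rewrite cabs0 addr0 => /le_lt_trans; apply; rewrite ltr_pM2r ?cabs_gt0 ?subr_eq0//.
by apply: psi'_lt; exact: closed_disk_convex.
Qed.

(** The pseudo-hyperbolic distance is at most 1. *)
Lemma mobius_ge z w : cabs z <= 1 -> cabs w <= 1 -> cabs (z - w) <= cabs (1 - z * conjc w).
Proof.
move=> z1 w1; rewrite -(@ler_pXn2r _ 2)// ?nnegrE ?cabs_ge0//.
suff E : cabs (1 - z * conjc w) ^+ 2 - cabs (z - w) ^+ 2 = (1 - cabs z ^+ 2) * (1 - cabs w ^+ 2).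
  have : 0 <= (1 - cabs z ^+ 2) * (1 - cabs w ^+ 2).
    by apply: mulr_ge0; rewrite subr_ge0 expr_le1 ?cabs_ge0.
  lra.
by rewrite !cabs_sqr; case: z {z1} => a b; case: w {w1} => c d /=; ring.
Qed.

Section Symbol.
Variable z0 : R[i].
Hypothesis z01 : cabs z0 < 1.

Let lam := harmonic_symbol gamma psi z0.
Let N z := gamma + z * (psi z - lam).

(** Inserting [lam = Psi z0] splits [N z] into [gamma (1 - z conj z0)] and [z (psi z - psi z0)]; the
    first term dominates strictly. The point [z = z0] is separate because the contraction is strict
    only off the diagonal. *)
Lemma denominator_neq0 z : cabs z <= 1 -> N z != 0.
Proof.
move=> z1.
have E : N z = gamma * (1 - z * conjc z0) + z * (psi z - psi z0).
  by rewrite /N /lam /harmonic_symbol; ring.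
have g0 : 0 < cabs gamma by rewrite cabs_gt0.
suff lt : cabs (z * (psi z - psi z0)) < cabs (gamma * (1 - z * conjc z0)).
  rewrite -cabs_gt0 E; have := cabsB (gamma * (1 - z * conjc z0) + z * (psi z - psi z0))
    (z * (psi z - psi z0)); rewrite addrK; lra.
rewrite !cabsM; have [->|zz] := eqVneq z z0.
  rewrite subrr cabs0 mulr0 mulr_gt0// cabs_gt0 mulcJ -cabs_eq0.
  have -> : 1 - (cabs z0 ^+ 2)%:C%C = (1 - cabs z0 ^+ 2)%:C%C by rewrite rmorphB rmorph1.
  rewrite cabsR normr_eq0 subr_eq0 eq_sym lt_eqF// expr_lt1 ?cabs_ge0//.
have h1 := strict_contraction z1 (ltW z01) zz.
have h2 := mobius_ge z1 (ltW z01).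
have h3 : cabs gamma * cabs (z - z0) <= cabs gamma * cabs (1 - z * conjc z0) by rewrite ler_pM2l.
have h4 : cabs z * cabs (psi z - psi z0) <= 1 * cabs (psi z - psi z0).
  by apply: ler_wpM2r; rewrite ?cabs_ge0.
lra.
Qed.

(** Away from the pole, [N z] is [z] times the difference between the meromorphic symbol and
    [lam]. *)
Lemma meromorphic_symbol_neq z : cabs z <= 1 -> z != 0 -> meromorphic_symbol gamma psi z <> lam.
Proof.
move=> z1 zn0 E; have /eqP := denominator_neq0 z1; apply.
by rewrite /N -E /meromorphic_symbol; field.
Qed.

Let dN z : cabs z <= 1 -> cder N z (psi z - lam + z * psi' z).
Proof.
move=> z1.
apply: cder_eq (cder_add (cder_cst gamma z) (cder_mul (cder_id z)
  (cder_add (dpsi z1) (cder_cst (- lam) z)))) _.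
ring.
Qed.

(** The bounds on [G'] and [f'] are part of the conclusion because the reproducing formula and the
    Jacobian integral both need them; they all descend from the lower bound of [|N|]. *)
Lemma eigenfunction_exists : exists G G' f f' : R[i] -> R[i], [/\
  forall z, cabs z < 1 -> cder G z (G' z) /\ cder f z (f' z),
  diskbdd G' /\ diskbdd f',
  forall z, cabs z < 1 -> f z = G z + z * G' z,
  forall z, cabs z < 1 -> gamma * G' z + psi z * f z = lam * f z &
  f 0 != 0].
Proof.
(* Nonvanishing on the closed disk becomes a uniform lower bound, which makes [1 / N] bounded and
   Lipschitz on the open disk. *)
have [zm zm1 Nmin] : exists2 zm, cabs (zm - 0) <= 1 & forall z, cabs (z - 0) <= 1 -> cabs (N zm) <= cabs (N z).
  by apply: ccont_min => // z; rewrite subr0 => z1; apply: wder_ccont (dN z1).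
rewrite subr0 in zm1.
have d0 : 0 < cabs (N zm) by rewrite cabs_gt0; exact: denominator_neq0.
have Nd z : cabs z < 1 -> cabs (N zm) <= cabs (N z).
  by move=> z1; apply: Nmin; rewrite subr0 ltW.
have dpsi1 z : cabs z < 1 -> cder psi z (psi' z) by move=> /ltW; exact: dpsi.
have bpsi' : diskbdd psi'.
  by exists (cabs gamma) => z /ltW z1; apply: ltW; exact: psi'_lt.
have blpsi : bddlip psi.
  by apply: (cder_bddlip dpsi1 (M := cabs gamma)) => z /ltW z1; apply: ltW; exact: psi'_lt.
have blid : bddlip (@id R[i]) by exact: bddlip_id.
have blN : bddlip N.
  apply: bddlipD; first exact: bddlip_cst.
  by apply: bddlipM => //; apply: bddlipB => //; exact: bddlip_cst.
have blNi : bddlip (fun z => (N z)^-1) by exact: (bddlipV d0).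
pose N' z := psi z - lam + z * psi' z.
have bN' : diskbdd N'.
  apply: diskbddD; first by apply: bddlip_diskbdd; apply: bddlipB => //; exact: bddlip_cst.
  by apply: diskbddM => //; exact: bddlip_diskbdd.
have dNi z : cabs z < 1 -> cder (fun z => (N z)^-1) z (- N' z * (N z)^-1 ^+ 2).
  move=> z1; apply: cder_eq (cder_inv _ (dN (ltW z1))) _; last by rewrite exprVn.
  exact: denominator_neq0 (ltW z1).
have bNi2 : diskbdd (fun z => (N z)^-1 ^+ 2) by apply: bddlip_diskbdd; exact: bddlipX.
pose h z := (psi z - lam) * (N z)^-1.
pose h' z := psi' z * (N z)^-1 + (psi z - lam) * (- N' z * (N z)^-1 ^+ 2).
have dh z : cabs z < 1 -> cder h z (h' z).
  move=> z1; apply: cder_eq (cder_mul (cder_add (dpsi1 _ z1) (cder_cst (- lam) z)) (dNi _ z1)) _.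
  by rewrite addr0.
have bh' : diskbdd h'.
  apply: diskbddD; first by apply: diskbddM => //; exact: bddlip_diskbdd.
  apply: diskbddM; first by apply: bddlip_diskbdd; apply: bddlipB => //; exact: bddlip_cst.
  by apply: diskbddM => //; exact: diskbddN.
have bh : diskbdd h.
  by apply: diskbddM; apply: bddlip_diskbdd => //; apply: bddlipB => //; exact: bddlip_cst.
have [M HM] := bh'.
have [H dH] := primitive_exists dh HM.
have [Mh HMh] := bh.
have [MH HMH] := bddlip_diskbdd (cder_bddlip dH HMh).
pose G z := cexp (- H z); pose G' z := - h z * G z.
have dG z : cabs z < 1 -> cder G z (G' z).
  move=> z1; apply: cder_eq (cder_comp (cder_opp (dH _ z1)) (cder_cexp (- H z))) _.
  by rewrite /G' mulrC.
have bG : diskbdd G.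
  exists (expR MH) => z z1; rewrite cabs_cexp ler_expR.
  by apply: (le_trans (ler_norm _)); apply: (le_trans (cabs_Re _)); rewrite cabsN; exact: HMH.
have bG' : diskbdd G' by apply: diskbddM => //; exact: diskbddN.
pose f z := gamma * (G z * (N z)^-1).
pose f' z := gamma * (G' z * (N z)^-1 + G z * (- N' z * (N z)^-1 ^+ 2)).
exists G, G', f, f'; split.
- move=> z z1; split; first exact: dG.
  exact: cder_scale (cder_mul (dG _ z1) (dNi _ z1)).
- split=> //; apply: diskbddM; first exact: bddlip_diskbdd (bddlip_cst _).
  apply: diskbddD; first by apply: diskbddM => //; exact: bddlip_diskbdd.
  by apply: diskbddM => //; apply: diskbddM => //; exact: diskbddN.
- move=> z z1; have := denominator_neq0 (ltW z1).
  by rewrite /f /G' /h /N => n0; field.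
- move=> z z1; have := denominator_neq0 (ltW z1).
  by rewrite /f /G' /h /N => n0; field.
rewrite /f /N mul0r addr0 mulf_neq0// mulf_neq0//; first exact: cexp_neq0.
by rewrite invr_eq0.
Qed.

End Symbol.
End Eigenfunction.

(** * The eigenvalue equation for the Toeplitz operator *)

Section Spectrum.
Context {R : realType}.
Local Notation plane := (measurableTypeR R * measurableTypeR R)%type.
Local Notation area := (@area_measure R).
Implicit Types (z w : R[i]).

Lemma open_disk_plane : open (@of_plane R @^-1` disk).
Proof.
have -> : @of_plane R @^-1` disk = pball 1.
  by apply/seteqP; split => p; rewrite /pball /= diskE.
exact: open_pball.
Qed.

Lemma open_disk : open (@disk R).
Proof.
rewrite openE => z; rewrite diskE => z1; apply/nbhs_cabsP.
exists (1 - cabs z); first by rewrite subr_gt0.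
by move=> w; rewrite diskE => hw; have := cabsD (w - z) z; rewrite subrK; lra.
Qed.

Lemma bergman_space_bounded f f' : (forall z, cabs z < 1 -> cder f z (f' z)) ->
  diskbdd f -> bergman_space f.
Proof.
move=> df [M HM]; split; last first.
  by split; [exact: open_disk|move=> z; rewrite diskE => /df/cder_derivable[]].
have M0 : 0 <= M.
  have h0 : cabs (0 : R[i]) < 1 by rewrite cabs0.
  by apply: le_trans (HM 0 h0); exact: cabs_ge0.
have cF (p : R * R) : (@of_plane R @^-1` disk) p -> {for p, continuous (real_map f)}.
  by rewrite /preimage /= diskE => /df/wder_real_map[].
have m1 : measurable_fun (@of_plane R @^-1` disk : set plane)
    (fun p : R * R => complex.Re (f (of_plane p))).
  apply: continuous_measurable_plane; first exact: open_disk_plane.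
  by move=> p /cF cp; apply: (continuous_comp (f := real_map f) (g := fst) cp); exact: cvg_fst.
have m2 : measurable_fun (@of_plane R @^-1` disk : set plane)
    (fun p : R * R => complex.Im (f (of_plane p))).
  apply: continuous_measurable_plane; first exact: open_disk_plane.
  by move=> p /cF cp; apply: (continuous_comp (f := real_map f) (g := snd) cp); exact: cvg_snd.
have mD : measurable (@of_plane R @^-1` disk : set plane).
  by apply: open_measurable_plane; exact: open_disk_plane.
split => //.
have E (p : plane) : (complex.Re `|f (of_plane p)|) ^+ 2 =
    complex.Re (f (of_plane p)) ^+ 2 + complex.Im (f (of_plane p)) ^+ 2 by exact: cabs_sqr.
apply: (@le_lt_trans _ _ (\int[area]_(p in @of_plane R @^-1` disk) (cst (M ^+ 2)%:E p))%E).
  apply: ge0_le_integral => //.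
  - by move=> p _; rewrite lee_fin sqr_ge0.
  - under eq_fun do rewrite E.
    by apply/measurable_EFinP; apply: measurable_funD; apply: measurable_funX.
  - move=> p; rewrite /preimage /= diskE => p1; rewrite lee_fin lerXn2r ?nnegrE ?cabs_ge0//.
    exact: HM.
by rewrite integral_cst// area_disk mule1 ltry.
Qed.

Section Eigenvalue.
Variables (gamma : R[i]) (psi psi' : R[i] -> R[i]).
Hypothesis gamma0 : gamma != 0.
Hypothesis dpsi : forall z, cabs z <= 1 -> cder psi z (psi' z).
Hypothesis psi'_lt : forall z, cabs z <= 1 -> cabs (psi' z) < cabs gamma.

(* In terms of Toeplitz operators: the symbol [z^*] maps [(z G)'] to [G']. *)
Lemma conj_integral (G G' : R[i] -> R[i]) z : cabs z < 1 ->
  (forall z, cabs z < 1 -> cder G z (G' z)) -> bddlip G ->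
  plane_int (cut 1 (fun w => (conjc w * (G w + w * G' w) - G' w) * kern z w ^+ 2)) = 0.
Proof.
move=> z1 dG bG.
have dk w : cabs w < 1 -> wder (fun w => kern z w ^+ 2) w 0 (2 * z * kern z w ^+ 3).
  move=> w1; have d := wder_kern z1 w1.
  have -> : (fun w => kern z w ^+ 2) = (fun w => kern z w * kern z w).
    by apply/funext => v; rewrite expr2.
  by apply: wder_eq (wder_mul d d) _ _; ring.
(* With [g] the conjugation only the [w]-derivative of [weight * B] remains, and in [B = G kern^2]
   the kernel is antiholomorphic in [w], so that derivative falls on [weight] and [G] alone. *)
have := @weighted_integral R (fun w => conjc w) (fun=> 0) (fun=> 1)
  (fun w => G w * kern z w ^+ 2) (fun w => G' w * kern z w ^+ 2)
  (fun w => G w * (2 * z * kern z w ^+ 3)) 1 1 ltr01 _ _ _ _.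
have -> : cut 1 (fun w => 0 * (- w * (G w * kern z w ^+ 2) + weight w * (G w * (2 * z * kern z w ^+ 3))) -
   1 * (- conjc w * (G w * kern z w ^+ 2) + weight w * (G' w * kern z w ^+ 2))) =
   cut 1 (fun w => (conjc w * (G w + w * G' w) - G' w) * kern z w ^+ 2).
  by apply/funext => w; rewrite /cut /weight; case: ifP => // _; ring.
apply.
- by move=> u v _ _; rewrite -conjcB cabsJ mul1r.
- by move=> w _; exact: wder_conj.
- by apply: bddlipM => //; apply: bddlipX; exact: kern_bddlip.
- by move=> w w1; apply: wder_eq (wder_mul (dG _ w1) (dk _ w1)) _ _; ring.
Qed.

(** The differential equation gives [Psi f = gamma (conj w f - G') + lam f]; the first part projects
    to 0 by [conj_integral], the second is reproduced. *)
Lemma harmonic_image_spectrum z0 : cabs z0 < 1 ->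
  bergman_point_spectrum (toeplitz (harmonic_symbol gamma psi)) (harmonic_symbol gamma psi z0).
Proof.
move=> z01.
have [G [G' [f [f' [dGf [bG' bf'] fG ode f0]]]]] := eigenfunction_exists gamma0 dpsi psi'_lt z01.
set lam := harmonic_symbol gamma psi z0 in ode *.
have dG z : cabs z < 1 -> cder G z (G' z) by move=> /dGf[].
have df z : cabs z < 1 -> cder f z (f' z) by move=> /dGf[].
have [MG HMG] := bG'; have [Mf HMf] := bf'.
have blG := cder_bddlip dG HMG; have blf := cder_bddlip df HMf.
exists f; split.
- exact: bergman_space_bounded df (bddlip_diskbdd blf).
- by exists 0 => //; rewrite diskE cabs0.
move=> z; rewrite diskE => z1.
rewrite /toeplitz /bergman_proj plane_int_cut.
have bk := bddlipX 2 (kern_bddlip z1).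
have dpsi1 w : cabs w < 1 -> cder psi w (psi' w) by move=> /ltW; exact: dpsi.
have blpsi : bddlip psi.
  by apply: (cder_bddlip dpsi1 (M := cabs gamma)) => w /ltW w1; apply: ltW; exact: psi'_lt.
(* About [G'] only a bound is known so far; the equation exhibits it as a product of bounded
   Lipschitz functions, which makes the integrand [bddsupp]. *)
have fE w : cabs w < 1 -> G' w = gamma^-1 * ((lam - psi w) * f w).
  by move=> w1; have := ode w w1 => h; rewrite mulrBl -h; field.
have b1 : bddsupp (cut 1 (fun w => (conjc w * (G w + w * G' w) - G' w) * kern z w ^+ 2)).
  have -> : cut 1 (fun w => (conjc w * (G w + w * G' w) - G' w) * kern z w ^+ 2) =
      cut 1 (fun w => (conjc w * f w - gamma^-1 * ((lam - psi w) * f w)) * kern z w ^+ 2).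
    by apply/funext => w; rewrite /cut; case: ifPn => // w1; rewrite -fE// -fG.
  apply: bddlip_bddsupp; apply: bddlipM => //; apply: bddlipB.
    by apply: bddlipM => //; exact: bddlip_conj bddlip_id.
  apply: bddlipM; first exact: bddlip_cst.
  by apply: bddlipM => //; apply: bddlipB => //; exact: bddlip_cst.
have b2 : bddsupp (cut 1 (fun w => f w * kern z w ^+ 2)) by apply: bddlip_bddsupp; exact: bddlipM.
rewrite (_ : cut 1 _ = (fun w => gamma * cut 1 (fun w => (conjc w * (G w + w * G' w) - G' w) * kern z w ^+ 2) w
   + lam * cut 1 (fun w => f w * kern z w ^+ 2) w)); last first.
  apply/funext => w; rewrite /cut; case: ifPn => w1; last by rewrite !mulr0 addr0.
  rewrite -fG// (mulrA lam) -(ode w w1) /harmonic_symbol /kern.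
  by have n0 := kern_neq0 z1 w1; field.
rewrite plane_int_D ?plane_int_Z//; try exact: bddsuppZ.
by rewrite conj_integral// mulr0 add0r (bergman_reproducing df HMf z1).
Qed.

End Eigenvalue.
End Spectrum.

(** * The harmonic diffeomorphism *)

Section Diffeomorphism.
Context {R : realType}.
Implicit Types (z w h y k : R[i]).
Variables (gamma : R[i]) (psi psi' : R[i] -> R[i]).
Hypothesis gamma0 : gamma != 0.
Hypothesis dpsi : forall z, cabs z <= 1 -> cder psi z (psi' z).
Hypothesis psi'_lt : forall z, cabs z <= 1 -> cabs (psi' z) < cabs gamma.

Local Notation Psi := (harmonic_symbol gamma psi).

Lemma harmonic_inj z w : cabs z < 1 -> cabs w < 1 -> Psi z = Psi w -> z = w.
Proof.
move=> z1 w1 E; apply/eqP; apply: contraT => zw.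
have := strict_contraction dpsi psi'_lt (ltW z1) (ltW w1) zw.
have -> : psi z - psi w = - (gamma * conjc (z - w)).
  rewrite conjcB; have -> : psi z = Psi z - gamma * conjc z by rewrite /harmonic_symbol; ring.
  by rewrite E /harmonic_symbol; ring.
by rewrite cabsN cabsM cabsJ ltxx.
Qed.

Lemma wder_harmonic z : cabs z <= 1 -> wder Psi z (psi' z) gamma.
Proof.
move=> z1; have -> : Psi = (fun z => gamma * conjc z + psi z) by [].
by apply: wder_eq (wder_add (wder_scale gamma (wder_conj z)) (dpsi z1)) _ _; ring.
Qed.

(** Minus the Jacobian determinant of [Psi], whose Wirtinger derivatives are [psi'] and [gamma]. *)
Definition jac z : R := cabs gamma ^+ 2 - cabs (psi' z) ^+ 2.

Lemma jac_gt0 z : cabs z <= 1 -> 0 < jac z.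
Proof.
move=> z1; have := psi'_lt z1; have := cabs_ge0 (psi' z); rewrite /jac !expr2; nra.
Qed.

Lemma jacE z : (jac z)%:C%C = gamma * conjc gamma - psi' z * conjc (psi' z).
Proof. by rewrite !mulcJ /jac rmorphB. Qed.

Lemma jac_neq0 z : cabs z <= 1 -> gamma * conjc gamma - psi' z * conjc (psi' z) != 0.
Proof. by move=> z1; rewrite -jacE eq_complex /= eqxx andbT gt_eqF// jac_gt0. Qed.

(* A minimum point of [|Psi - y|] in a small disk around [z0] is interior, and
   there the invertible differential of [Psi] would allow to decrease a positive
   value. *)
Lemma harmonic_open z0 : cabs z0 < 1 -> exists r C : R, [/\ 0 < r, 0 < C &
  forall y, cabs (y - Psi z0) < r ->
    exists z, [/\ cabs z < 1, Psi z = y & cabs (z - z0) <= C * cabs (y - Psi z0)]].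
Proof.
move=> z01; set m := cabs gamma - cabs (psi' z0).
have m0 : 0 < m by rewrite subr_gt0; exact: psi'_lt (ltW z01).
have m20 : 0 < m / 2 by lra.
have [r r0 Hr] := wder_harmonic (ltW z01) m20.
(* The differential at [z0] stretches every [h] by at least [m]; half of this absorbs the
   linearization error. *)
have low h : cabs h < r -> m / 2 * cabs h <= cabs (Psi (z0 + h) - Psi z0).
  move=> hr; have := Hr h hr.
  set X := Psi (z0 + h) - Psi z0 => H1.
  have := cabsB (X - (psi' z0 * h + gamma * conjc h)) (X + - (psi' z0 * h)).
  have -> : X - (psi' z0 * h + gamma * conjc h) - (X + - (psi' z0 * h)) = - (gamma * conjc h) by ring.
  rewrite cabsN cabsM cabsJ => H2.
  have := cabsB X (psi' z0 * h); rewrite cabsM.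
  by move: H1 H2; rewrite /m; lra.
pose s : R := Num.min r (1 - cabs z0) / 2.
have [s0 sr sz] : [/\ 0 < s, s <= r / 2 & s <= (1 - cabs z0) / 2].
  rewrite /s; split; first by rewrite divr_gt0// lt_min r0 subr_gt0.
    by rewrite ler_pM2r// ge_min lexx.
  by rewrite ler_pM2r// ge_min lexx orbT.
have inD z : cabs (z - z0) <= s -> cabs z < 1.
  by move=> hz; have := cabsD (z - z0) z0; rewrite subrK; lra.
(* On the circle of radius [s] the value of [Psi] is at least [(m / 2) s] away from [Psi z0]. If [y]
   is within [(m / 4) s] of [Psi z0], the minimum of [|Psi - y|] cannot lie there. The constant
   [2 / m] inverts [low]. *)
exists (m / 4 * s), (2 / m); split; [by rewrite mulr_gt0// divr_gt0|by rewrite divr_gt0|].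
move=> y hy.
have [z1 z1s zmin] : exists2 z1, cabs (z1 - z0) <= s &
    forall z, cabs (z - z0) <= s -> cabs (Psi z1 - y) <= cabs (Psi z - y).
  apply: (@ccont_min _ (fun z => Psi z - y)); first exact: ltW.
  move=> z /inD z1; have d := wder_add (wder_harmonic (ltW z1)) (wder_cst (- y) z).
  exact: wder_ccont d.
have z1lt : cabs (z1 - z0) < s.
  rewrite lt_neqAle z1s andbT; apply/eqP => E.
  have h1 : cabs (z1 - z0) < r by lra.
  have := low _ h1; rewrite E (addrC z0) subrK => h2.
  have := zmin z0; rewrite subrr cabs0 (cabsBC (Psi z0)) => /(_ (ltW s0)) h3.
  have := cabsD (Psi z1 - y) (y - Psi z0); rewrite addrA subrK => h4.
  lra.
have z11 := inD _ z1s.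
have Ez : Psi z1 = y.
  apply/eqP; rewrite -subr_eq0; apply: contraT => e_neq0.
  set e := y - Psi z1.
  have e0 : 0 < cabs e by rewrite cabs_gt0 /e -opprB oppr_eq0.
  have J0 := jac_neq0 (ltW z11).
  (* The solution of the real-linear equation [psi' h + gamma conj h = e], by Cramer's rule on the
     equation and its conjugate. *)
  pose h0 := (gamma * conjc e - conjc (psi' z1) * e) / (gamma * conjc gamma - psi' z1 * conjc (psi' z1)).
  have Eh : psi' z1 * h0 + gamma * conjc h0 = e.
    have Jr : conjc (gamma * conjc gamma - psi' z1 * conjc (psi' z1)) =
       gamma * conjc gamma - psi' z1 * conjc (psi' z1) by rewrite -jacE conjc_real.
    rewrite /h0 [conjc (_ / _)]conjcM conjc_inv Jr (conjcB (gamma * _)) (conjcM gamma)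
      (conjcM (conjc (psi' z1))) !conjcK.
    by field.
  have K0 : 0 < cabs h0 + 1 by have := cabs_ge0 h0; lra.
  have e'0 : 0 < cabs e / 2 / (cabs h0 + 1) by rewrite !divr_gt0.
  have [q q0 Hq] := wder_harmonic (ltW z11) e'0.
  (* Short enough for the point [z1 + t h0] to stay in the small disk and in the range of the
     linearization; there the distance to [y] is at most [(1 - t / 2) |e|], below the minimum. *)
  pose t : R := Num.min 1 (Num.min (q / 2) (s - cabs (z1 - z0)) / (cabs h0 + 1)).
  have [t0 t1 t2] : [/\ 0 < t, t <= 1 & t * (cabs h0 + 1) <= Num.min (q / 2) (s - cabs (z1 - z0))].
    rewrite /t; split.
    - by rewrite lt_min ltr01 divr_gt0// lt_min divr_gt0// subr_gt0.
    - by rewrite ge_min lexx.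
    - by rewrite -ler_pdivlMr// ge_min lexx orbT.
  move: t2; rewrite le_min => /andP[t2 t3].
  have ct : cabs (t%:C%C * h0) = t * cabs h0 by rewrite cabsM cabsR gtr0_norm.
  have th : t * cabs h0 <= t * (cabs h0 + 1) by rewrite ler_pM2l//; lra.
  have tq : cabs (t%:C%C * h0) < q by rewrite ct; lra.
  have := zmin (z1 + t%:C%C * h0).
  have -> : z1 + t%:C%C * h0 - z0 = (z1 - z0) + t%:C%C * h0 by ring.
  have hs : cabs ((z1 - z0) + t%:C%C * h0) <= s.
    by apply: (le_trans (cabsD _ _)); rewrite ct; lra.
  move=> /(_ hs).
  set X := Psi (z1 + t%:C%C * h0) - Psi z1 - (psi' z1 * (t%:C%C * h0) + gamma * conjc (t%:C%C * h0)).
  have HX : cabs X <= cabs e / 2 / (cabs h0 + 1) * (t * cabs h0) by rewrite -ct; exact: Hq.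
  have -> : Psi (z1 + t%:C%C * h0) - y = X - (1 - t)%:C%C * e.
    rewrite /X conjcM conjc_real rmorphB rmorph1 mulrBl -{2}Eh /e mul1r; ring.
  rewrite (cabsBC (Psi z1)) -/e => Hmin.
  have := cabsB X ((1 - t)%:C%C * e).
  rewrite cabsM cabsR ger0_norm; last lra.
  have HX2 : cabs e / 2 / (cabs h0 + 1) * (t * cabs h0) <= cabs e / 2 / (cabs h0 + 1) * (t * (cabs h0 + 1)).
    by rewrite ler_pM2l.
  have E3 : cabs e / 2 / (cabs h0 + 1) * (t * (cabs h0 + 1)) = t * cabs e / 2 by field; lra.
  have : 0 < t * cabs e by exact: mulr_gt0.
  lra.
exists z1; split => //.
have h1 : cabs (z1 - z0) < r by lra.
have := low _ h1; rewrite (addrC z0) subrK Ez => h2.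
have -> : cabs (z1 - z0) = 2 / m * (m / 2 * cabs (z1 - z0)) by field; lra.
by rewrite ler_pM2l// divr_gt0.
Qed.

(** A total function, with default value 0 outside the image of the disk. *)
Definition harmonic_inv y : R[i] := xget 0 [set z | cabs z < 1 /\ Psi z = y].

Lemma harmonic_invK z : cabs z < 1 -> harmonic_inv (Psi z) = z.
Proof.
move=> z1; rewrite /harmonic_inv; case: xgetP => [w _ [w1 E]|/(_ z)[]//].
exact: harmonic_inj.
Qed.

(** The coefficients invert [k = psi' h + gamma conj h]. The linear bound [|h| <= C |k|] of
    [harmonic_open] turns an error small against [h] into one small against [k]. *)
Lemma wder_harmonic_inv z : cabs z < 1 -> wder harmonic_inv (Psi z)
  (- conjc (psi' z) / (gamma * conjc gamma - psi' z * conjc (psi' z)))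
  (gamma / (gamma * conjc gamma - psi' z * conjc (psi' z))).
Proof.
move=> z1 e e0.
have J0 := jac_neq0 (ltW z1); set J := gamma * conjc gamma - _ in J0 *.
have [r [C [r0 C0 Hopen]]] := harmonic_open z1.
(* The factor by which the error is amplified: the inverse differential contributes the quotient,
   [C] the passage from [h] to [k]. *)
set B := (cabs gamma + cabs (psi' z)) / cabs J * C.
have B0 : 0 <= B.
  by rewrite /B mulr_ge0 ?divr_ge0 ?addr_ge0 ?cabs_ge0// ltW.
have e'0 : 0 < e / (B + 1) by rewrite divr_gt0//; lra.
have [q q0 Hq] := wder_harmonic (ltW z1) e'0.
exists (Num.min r (q / C)); first by rewrite lt_min r0 divr_gt0.
move=> k; rewrite lt_min => /andP[kr kq].
have kr' : cabs (Psi z + k - Psi z) < r by rewrite addrC addKr.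
have [w [w1 Ew hw]] := Hopen _ kr'.
rewrite (addrC (Psi z)) addrK in hw.
rewrite -Ew !harmonic_invK//.
have wq : cabs (w - z) < q.
  by apply: (le_lt_trans hw); rewrite mulrC -ltr_pdivlMr.
have := Hq _ wq; rewrite (addrC z) subrK Ew (addrC (Psi z)) addrK.
set h := w - z in hw wq *; set rho := k - (psi' z * h + gamma * conjc h) => Hrho.
have -> : h - (- conjc (psi' z) / J * k + gamma / J * conjc k) =
   (conjc (psi' z) * rho - gamma * conjc rho) / J.
  rewrite /rho (conjcB k) (conjcD (psi' z * h)) (conjcM (psi' z)) (conjcM gamma) !conjcK /J.
  by field; exact: J0.
have cJ : 0 < cabs J by rewrite cabs_gt0.
rewrite cabsM cabsV ler_pdivrMr//.
apply: (le_trans (cabsB _ _)); rewrite !cabsM !cabsJ -mulrDl.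
have H1 : (cabs (psi' z) + cabs gamma) * cabs rho <=
   (cabs (psi' z) + cabs gamma) * (e / (B + 1) * (C * cabs k)).
  apply: ler_wpM2l; first by rewrite addr_ge0 ?cabs_ge0.
  by apply: (le_trans Hrho); apply: ler_wpM2l => //; exact: ltW.
apply: (le_trans H1).
have EB : B * cabs J = (cabs gamma + cabs (psi' z)) * C by rewrite /B; field; exact: lt0r_neq0.
have -> : (cabs (psi' z) + cabs gamma) * (e / (B + 1) * (C * cabs k)) =
   (cabs gamma + cabs (psi' z)) * C * (e * cabs k / (B + 1)) by ring.
have -> : (cabs gamma + cabs (psi' z)) * C * (e * cabs k / (B + 1)) =
   (B / (B + 1)) * (e * cabs k * cabs J) by rewrite -EB; ring.
rewrite -[leRHS]mul1r; apply: ler_wpM2r.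
  by rewrite !mulr_ge0 ?cabs_ge0// ltW.
by rewrite ler_pdivrMr; lra.
Qed.

End Diffeomorphism.

(** * Smoothness of the map and of its inverse, and the image domain *)

Section SmoothClass.
Context {R : realType}.
Implicit Types (z w v y : R[i]) (F : R[i] -> R[i]).
Variables (gamma : R[i]) (psi psi' : R[i] -> R[i]) (D : nat -> R[i] -> R[i]).
Hypothesis gamma0 : gamma != 0.
Hypothesis dpsi : forall z, cabs z <= 1 -> cder psi z (psi' z).
Hypothesis psi'_lt : forall z, cabs z <= 1 -> cabs (psi' z) < cabs gamma.
Hypothesis towerD : holo_tower D.
Hypothesis D0 : forall z, cabs z < 1 -> D 0%N z = psi z.

Let D1 z : cabs z < 1 -> D 1%N z = psi' z.
Proof.
move=> z1; apply: cder_unique (dpsi (ltW z1)).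
apply: (wder_ext (f := D 0%N) (r := 1 - cabs z)); [by rewrite subr_gt0| |exact: towerD].
by move=> w hw; apply: D0; have := cabsD (w - z) z; rewrite subrK; lra.
Qed.

(** Written with [D 1] instead of [psi'], so that its derivatives are expressed by the next member
    of the tower. *)
Let jacobian z := gamma * conjc gamma - D 1%N z * conjc (D 1%N z).

(** The class that feeds [smooth_wirtinger]. Division enters only through the inverse Jacobian,
    whose derivatives are polynomial in itself, the tower and conjugates. *)
Inductive smooth_expr : (R[i] -> R[i]) -> Prop :=
| SE_cst c : smooth_expr (fun=> c)
| SE_id : smooth_expr id
| SE_tower n : smooth_expr (D n)
| SE_conj F : smooth_expr F -> smooth_expr (fun z => conjc (F z))
| SE_add F G : smooth_expr F -> smooth_expr G -> smooth_expr (fun z => F z + G z)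
| SE_mul F G : smooth_expr F -> smooth_expr G -> smooth_expr (fun z => F z * G z)
| SE_jac : smooth_expr (fun z => (jacobian z)^-1).

Let SE_opp F : smooth_expr F -> smooth_expr (fun z => - F z).
Proof.
move=> eF; have -> : (fun z => - F z) = (fun z => -1 * F z).
  by apply/funext => z; rewrite mulN1r.
by apply: SE_mul => //; exact: SE_cst.
Qed.

Lemma smooth_expr_wder F : smooth_expr F -> exists A B,
  [/\ smooth_expr A, smooth_expr B & forall z, cabs z < 1 -> wder F z (A z) (B z)].
Proof.
elim=> [c||n|G eG [A [B [eA eB dG]]]|F1 F2 e1 [A1 [B1 [eA1 eB1 d1]]] e2 [A2 [B2 [eA2 eB2 d2]]]
  |F1 F2 e1 [A1 [B1 [eA1 eB1 d1]]] e2 [A2 [B2 [eA2 eB2 d2]]]|].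
- exists (fun=> 0), (fun=> 0); split; [exact: SE_cst|exact: SE_cst|move=> z _; exact: wder_cst].
- exists (fun=> 1), (fun=> 0); split; [exact: SE_cst|exact: SE_cst|move=> z _; exact: wder_id].
- exists (D n.+1), (fun=> 0); split; [exact: SE_tower|exact: SE_cst|move=> z z1; exact: towerD].
- exists (fun z => conjc (B z)), (fun z => conjc (A z)); split; [exact: SE_conj|exact: SE_conj|].
  by move=> z z1; apply: wder_conjc; exact: dG.
- exists (fun z => A1 z + A2 z), (fun z => B1 z + B2 z); split; [exact: SE_add|exact: SE_add|].
  by move=> z z1; apply: wder_add; [exact: d1|exact: d2].
- exists (fun z => A1 z * F2 z + F1 z * A2 z), (fun z => B1 z * F2 z + F1 z * B2 z).
  split; [by apply: SE_add; exact: SE_mul|by apply: SE_add; exact: SE_mul|].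
  by move=> z z1; apply: wder_mul; [exact: d1|exact: d2].
exists (fun z => D 2%N z * conjc (D 1%N z) * ((jacobian z)^-1 * (jacobian z)^-1)),
  (fun z => D 1%N z * conjc (D 2%N z) * ((jacobian z)^-1 * (jacobian z)^-1)).
have eT n : smooth_expr (D n) by exact: SE_tower.
split.
- by apply: SE_mul; apply: SE_mul; [exact: eT|exact: SE_conj|exact: SE_jac|exact: SE_jac].
- by apply: SE_mul; apply: SE_mul; [exact: eT|exact: SE_conj|exact: SE_jac|exact: SE_jac].
move=> z z1.
have J0 : jacobian z != 0 by rewrite /jacobian D1//; exact: jac_neq0 (ltW z1).
have dD := towerD 1%N z1.
have dJ : wder jacobian z (- (D 2%N z * conjc (D 1%N z))) (- (D 1%N z * conjc (D 2%N z))).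
  have -> : jacobian = (fun z => gamma * conjc gamma + -1 * (D 1%N z * conjc (D 1%N z))).
    by apply/funext => w; rewrite /jacobian mulN1r.
  apply: wder_eq (wder_add (wder_cst _ z) (wder_scale (-1) (wder_mul dD (wder_conjc dD)))) _ _.
    by rewrite conjc0; ring.
  by ring.
by apply: wder_eq (wder_inv J0 dJ) _ _; field.
Qed.

Lemma smooth_expr_smooth F : smooth_expr F ->
  smooth_on (@of_plane R @^-1` disk) (real_map F).
Proof.
apply: (smooth_wirtinger open_disk_plane (S := smooth_expr)) => {}F eF.
have [A [B [eA eB dF]]] := smooth_expr_wder eF; exists A, B; split.
  by move=> z; rewrite diskE; exact: dF.
by move=> v; apply: SE_add; apply: SE_mul => //; exact: SE_cst.
Qed.

Local Notation Psi := (harmonic_symbol gamma psi).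

Lemma harmonic_smooth : smooth_on (@of_plane R @^-1` disk) (real_map Psi).
Proof.
move=> n.
have e : smooth_expr (fun z => gamma * conjc z + D 0%N z).
  apply: SE_add; last exact: SE_tower.
  by apply: SE_mul; [exact: SE_cst|exact: SE_conj SE_id].
apply: Cn_on_eq (smooth_expr_smooth e n); first exact: open_disk_plane.
by move=> p; rewrite /preimage /= diskE => p1; rewrite /real_map /= D0.
Qed.

Lemma open_harmonic_image : open (Psi @` disk).
Proof.
rewrite openE => _ [z + <-]; rewrite diskE => z1.
have [r [C [r0 _ H]]] := harmonic_open dpsi psi'_lt z1.
apply/nbhs_cabsP; exists r => // y /H[w [w1 Ew _]].
by exists w => //; rewrite diskE.
Qed.

Lemma open_harmonic_image_plane : open (@of_plane R @^-1` (Psi @` disk)).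
Proof.
rewrite openE => p [z + Ez]; rewrite diskE => z1.
have [r [C [r0 _ H]]] := harmonic_open dpsi psi'_lt z1.
apply/plane_nbhsP; exists r => // q; rewrite of_planeB -Ez => /H[w [w1 Ew _]].
by exists w => //; rewrite diskE.
Qed.

Let G := harmonic_inv gamma psi.

(** The Wirtinger derivatives of [G] are smooth expressions evaluated at [G], so by the chain rule
    the functions [E \o G] form a stable class; it contains [G] through [E = id]. *)
Lemma harmonic_inv_smooth : smooth_on (@of_plane R @^-1` (Psi @` disk)) (real_map G).
Proof.
pose S F := exists2 E, smooth_expr E & F = E \o G.
apply: (smooth_wirtinger open_harmonic_image_plane (S := S)); last by exists id => //; exact: SE_id.
move=> _ [E eE ->].
have [A [B [eA eB dE]]] := smooth_expr_wder eE.
pose a z := - conjc (D 1%N z) * (jacobian z)^-1; pose b z := gamma * (jacobian z)^-1.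
have ea : smooth_expr a.
  by apply: SE_mul; [apply: SE_opp; apply: SE_conj; exact: SE_tower|exact: SE_jac].
have eb : smooth_expr b by apply: SE_mul; [exact: SE_cst|exact: SE_jac].
pose X z := A z * a z + B z * conjc (b z); pose Y z := A z * b z + B z * conjc (a z).
have eX : smooth_expr X by apply: SE_add; apply: SE_mul => //; exact: SE_conj.
have eY : smooth_expr Y by apply: SE_add; apply: SE_mul => //; exact: SE_conj.
exists (X \o G), (Y \o G); split.
  move=> _ [z + <-]; rewrite diskE => z1.
  have dG := wder_harmonic_inv dpsi psi'_lt z1.
  have GK := harmonic_invK dpsi psi'_lt z1.
  have dEG : wder E (G (Psi z)) (A z) (B z) by rewrite /G GK; exact: dE.
  apply: wder_eq (wder_comp dG dEG) _ _.
    by rewrite /= /X /G GK /a /b /jacobian D1.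
  by rewrite /= /Y /G GK /a /b /jacobian D1.
move=> v; exists (fun z => v * X z + conjc v * Y z) => //.
by apply: SE_add; apply: SE_mul => //; exact: SE_cst.
Qed.

Lemma harmonic_jacobian p : disk (of_plane p) -> jacobian_det (real_map Psi) p < 0.
Proof.
rewrite diskE => p1.
have [dv _] := wder_real_map (wder_harmonic gamma dpsi (ltW p1)).
have [_ E1] := dv (1, 0); have [_ E2] := dv (0, 1).
rewrite /jacobian_det E1 E2.
suff -> : (to_plane (of_plane (1, 0) * psi' (of_plane p) + conjc (of_plane (1, 0)) * gamma)).1 *
  (to_plane (of_plane (0, 1) * psi' (of_plane p) + conjc (of_plane (0, 1)) * gamma)).2 -
  (to_plane (of_plane (0, 1) * psi' (of_plane p) + conjc (of_plane (0, 1)) * gamma)).1 *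
  (to_plane (of_plane (1, 0) * psi' (of_plane p) + conjc (of_plane (1, 0)) * gamma)).2 =
  - jac gamma psi' (of_plane p).
  by rewrite oppr_lt0; apply: jac_gt0 psi'_lt _ _; exact: ltW.
rewrite /jac !cabs_sqr; case: (psi' _) => a b; case: (gamma) => c d.
by rewrite /to_plane /of_plane /=; ring.
Qed.

Lemma harmonic_diffeo : orientation_reversing_diffeo disk (Psi @` disk) Psi.
Proof.
split; last exact: harmonic_jacobian.
split.
- exact: open_disk_plane.
- exact: open_harmonic_image_plane.
- split.
  + by move=> p p1; exists (of_plane p) => //; rewrite /real_map /= to_planeK.
  + move=> p q; rewrite !inE /preimage /= !diskE => p1 q1 E.
    rewrite -(of_planeK p) -(of_planeK q); congr to_plane.
    apply: (harmonic_inj dpsi psi'_lt p1 q1).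
    by rewrite -[LHS]to_planeK -[RHS]to_planeK; congr of_plane.
  + move=> p [z z1 Ez]; exists (to_plane z); first by rewrite /preimage /= to_planeK.
    by rewrite /real_map /= to_planeK Ez of_planeK.
- exact: harmonic_smooth.
exists (real_map G); last exact: harmonic_inv_smooth.
move=> p; rewrite /preimage /= diskE => p1.
by rewrite /real_map /= to_planeK /G (harmonic_invK dpsi psi'_lt p1) of_planeK.
Qed.

Lemma harmonic_image_bounded : bounded_set (Psi @` disk).
Proof.
exists (cabs gamma + (cabs gamma + cabs (psi 0)))%:C%C; split.
  by apply/complex_realP; eexists; reflexivity.
move=> x hx _ [z + <-]; rewrite diskE => z1.
apply: le_trans (ltW hx); rewrite normr_cabs lecR /harmonic_symbol.
apply: (le_trans (cabsD _ _)); rewrite cabsM cabsJ.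
have g0 := cabs_ge0 gamma.
have h1 : cabs gamma * cabs z <= cabs gamma * 1 by apply: ler_wpM2l => //; exact: ltW.
have c0 : cabs (0 : R[i]) <= 1 by rewrite cabs0.
have h2 : cabs (psi z - psi 0) <= cabs gamma * cabs z.
  have [->|zn0] := eqVneq z 0; first by rewrite subrr cabs0 mulr0.
  by have := strict_contraction dpsi psi'_lt (ltW z1) c0 zn0; rewrite subr0; exact: ltW.
have := cabsD (psi z - psi 0) (psi 0); rewrite subrK; lra.
Qed.

(** Connectedness: the image is a union of curves, the images of the radii, all passing through
    [Psi 0]. *)
Lemma harmonic_image_domain : domain (Psi @` disk).
Proof.
have c0 : cabs (0 : R[i]) < 1 by rewrite cabs0.
split; [by exists (Psi 0); exists 0 => //; rewrite diskE|exact: open_harmonic_image|].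
pose seg z := (fun t : R => Psi (t%:C%C * z)) @` `[0, 1].
have tz (t : R) z : t \in `[0, 1] -> cabs z < 1 -> cabs (t%:C%C * z) < 1.
  rewrite in_itv /= => /andP[t0 t1] z1; rewrite cabsM cabsR ger0_norm//.
  have : t * cabs z <= 1 * cabs z by apply: ler_wpM2r; rewrite ?cabs_ge0.
  lra.
have -> : Psi @` disk = \bigcup_(z in disk) seg z.
  apply/seteqP; split => [_ [z z1 <-]|_ [z + [t t01 <-]]].
    exists z => //; exists 1; first by rewrite /= in_itv /= ler01 lexx.
    by rewrite mul1r.
  by rewrite diskE => z1; exists (t%:C%C * z) => //; rewrite diskE; exact: tz.
apply: bigcup_connected.
  exists (Psi 0) => z _; exists 0; first by rewrite /= in_itv /= ler01 lexx.
  by rewrite mul0r.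
move=> z; rewrite diskE => z1; apply: connected_continuous_connected; first exact: segment_connected.
apply: continuous_in_subspaceT => t; rewrite inE /= => t01.
have cP := wder_ccont (wder_harmonic gamma dpsi (ltW (tz _ _ t01 z1))).
move=> B /nbhs_cabsP[e e0 HB].
have e20 : 0 < e / 2 by lra.
have [d d0 Hd] := cP _ e20.
have K0 : 0 < cabs z + 1 by have := cabs_ge0 z; lra.
apply/nbhs_ballP; exists (d / (cabs z + 1)) => /=; first by rewrite divr_gt0.
move=> s; rewrite /ball /= ltr_pdivlMr// => hs; apply: HB.
have -> : s%:C%C * z = t%:C%C * z + (s - t)%:C%C * z by rewrite rmorphB; ring.
apply: le_lt_trans (Hd _ _) _; last by lra.
rewrite cabsM cabsR distrC; apply: le_lt_trans hs; apply: ler_wpM2l => //; lra.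
Qed.

End SmoothClass.

Theorem proposition3p2 (R : realType) (gamma : R[i]) (psi : R[i] -> R[i])
    (U : set R[i]) :
  gamma != 0 ->
  closure disk `<=` U ->
  analytic_on U psi ->
  (forall z, closure disk z -> `|derive1 psi z| < `|gamma|) ->
  let Psi := harmonic_symbol gamma psi in
  let Rsym := meromorphic_symbol gamma psi in
  [/\ orientation_reversing_diffeo disk (Psi @` disk) Psi,
      bounded_set (Psi @` disk) /\ domain (Psi @` disk),
      (forall lambda, (Psi @` disk) lambda ->
         forall z, closure disk z -> z != 0 -> Rsym z <> lambda)
    & Psi @` disk `<=` bergman_point_spectrum (toeplitz Psi)].
Proof.
move=> gamma0 clU [_ aU] hlt Psi Rsym.
have dpsi z : cabs z <= 1 -> cder psi z (derive1 psi z).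
  by move=> /closure_diskE/clU/aU; exact: derivable_cder.
have psi'_lt z : cabs z <= 1 -> cabs (derive1 psi z) < cabs gamma.
  by move=> /closure_diskE/hlt; rewrite !normr_cabs ltcR.
have dpsi1 z : cabs z < 1 -> cder psi z (derive1 psi z) by move=> /ltW; exact: dpsi.
have psi'_le z : cabs z < 1 -> cabs (derive1 psi z) <= cabs gamma.
  by move=> /ltW/psi'_lt/ltW.
(* The sense-reversing condition supplies the bounded derivative from which the kernel yields
   derivatives of [psi] of all orders. *)
have [D [towerD D0]] := holo_tower_exists dpsi1 psi'_le.
split.
- exact: harmonic_diffeo dpsi psi'_lt towerD D0.
- split; first exact: harmonic_image_bounded dpsi psi'_lt.
  exact: harmonic_image_domain dpsi psi'_lt.
- move=> _ [z0 + <-] z /closure_diskE z1 zn0; rewrite diskE => z01.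
  exact: meromorphic_symbol_neq gamma0 dpsi psi'_lt _ z01 _ z1 zn0.
- move=> _ [z0 + <-]; rewrite diskE => z01.
  exact: harmonic_image_spectrum gamma0 dpsi psi'_lt _ z01.
Qed.
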